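(* Let $\mathbb{A}=\langle A;L(\mathbb{A})\rangle$ and $\mathbb{B}=\langle B;L(\mathbb{B})\rangle$ be algebraic structures. Then the following conditions are equivalent: (1) $\mathbb{A}$ and $\mathbb{B}$ are strongly bi-interpretable in each other; (2) the categories of projective definable sets over $\mathbb{A}$ and $\mathbb{B}$ are equivalent relative to the class $\mathbf{Tr}$ of translation functors: $\mathcal{PDS}(\mathbb{A})\sim_{\mathbf{Tr}}\mathcal{PDS}(\mathbb{B})$; (3) the categories of projective logical sets over $\mathbb{A}$ and $\mathbb{B}$ are equivalent relative to the class $\mathbf{Int}$ of interpretation functors: $\mathcal{PLS}(\mathbb{A})\sim_{\mathbf{Int}}\mathcal{PLS}(\mathbb{B})$. In this case one also has $\mathcal{PLS}_{\alpha,\beta}(\mathbb{A})\sim_{\mathbf{Tr}}\mathcal{PLS}_{\alpha,\beta}(\mathbb{B})$ for any infinite cardinals $\alpha\leqslant\beta$.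
   Context: **Structures and codes.** $\mathbb{A}=\langle A;L(\mathbb{A})\rangle$ denotes a first-order structure with non-empty underlying set $A$ in the language $L(\mathbb{A})$ (logic with equality; constant, function and predicate symbols); similarly for other letters. For $P\subseteq A$, $\mathbb{A}_P$ is the expansion of $\mathbb{A}$ by constants naming the elements of $P$. Maps are applied to tuples coordinatewise. An interpretation code $\Gamma\colon L(\mathbb{A})\to L(\mathbb{B})$ is a family of $L(\mathbb{B})$-formulas $U_\Gamma(\bar x,\bar y)$, $E_\Gamma(\bar x,\bar x',\bar y)$, $c_\Gamma(\bar x,\bar y)$, $f_\Gamma(\bar x_0,\bar x_1,\ldots,\bar x_{n_f},\bar y)$, $R_\Gamma(\bar x_1,\ldots,\bar x_{n_R},\bar y)$, one for each constant symbol $c$, function symbol $f$, predicate symbol $R$ of $L(\mathbb{A})$, where all tuples $\bar x,\bar x',\bar x_i$ have the same length $\dim\Gamma$ and $|\bar y|=\dim_{\mathrm{par}}\Gamma$. For a tuple $\bar p$ from $B$ with $|\bar p|=\dim_{\mathrm{par}}\Gamma$ put $U_\Gamma(\mathbb{B},\bar p)=\{\bar b\mid\mathbb{B}\models U_\Gamma(\bar b,\bar p)\}$. The $L(\mathbb{A})$-structure $\Gamma(\mathbb{B},\bar p)$ is well-defined if $U_\Gamma(\mathbb{B},\bar p)\neq\emptyset$ and, on $U_\Gamma(\mathbb{B},\bar p)$, $E_\Gamma(\cdot,\cdot,\bar p)$ defines an equivalence relation $\sim_\Gamma$, each $c_\Gamma$ defines exactly one $\sim_\Gamma$-class, each $f_\Gamma$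 defines (the preimage of) the graph $x_0=f(x_1,\ldots,x_{n_f})$ of an operation on $U_\Gamma(\mathbb{B},\bar p)/{\sim_\Gamma}$, and each $R_\Gamma$ defines (the preimage of) a relation on $U_\Gamma(\mathbb{B},\bar p)/{\sim_\Gamma}$; then $\Gamma(\mathbb{B},\bar p)$ is the resulting structure on $U_\Gamma(\mathbb{B},\bar p)/{\sim_\Gamma}$. An interpretation $(\Gamma,\bar p,\mu_\Gamma)\colon\mathbb{A}\rightsquigarrow\mathbb{B}$ consists of a code $\Gamma$, a tuple $\bar p$ such that $\Gamma(\mathbb{B},\bar p)$ is well-defined, and a surjection (coordinate map) $\mu_\Gamma\colon U_\Gamma(\mathbb{B},\bar p)\to A$ that induces an $L(\mathbb{A})$-isomorphism $\bar\mu_\Gamma\colon\Gamma(\mathbb{B},\bar p)\to\mathbb{A}$, $\bar\mu_\Gamma(\bar b/{\sim_\Gamma})=\mu_\Gamma(\bar b)$. **Translations.** A formula is in normal form if it is prenex and its matrix is a disjunction of conjunctions of unnested atomic formulas ($x=x'$, $x=c$, $f(x_1,\ldots,x_{n_f})=x_0$, $R(x_1,\ldots,x_{n_R})$) and their negations. For an $L(\mathbb{A})$-formula $\psi(x_1,\ldots,x_s)$ in normal form, $\psi_\Gamma(\bar x_1,\ldots,\bar x_s,\bar y)$ is the $L(\mathbb{B})$-formula obtained by replacing each variable by a tuple of $\dim\Gamma$ variables, replacing the unnested atomic formulas by $E_\Gamma,c_\Gamma,f_\Gamma,R_\Gamma$ respectively, relativizing all quantifiers to $U_\Gamma(\cdot,\bar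 y)$, and adding the conjuncts $U_\Gamma(\bar x_i,\bar y)$ for all listed free variables. A formula not in normal form is translated via a logically equivalent normal form. An extended code $(\Gamma,\bar p,\gamma)\colon L(\mathbb{A})\cup A\to L(\mathbb{B})\cup B$ consists of a code $\Gamma\colon L(\mathbb{A})\to L(\mathbb{B})$, a tuple $\bar p$ from $B$ with $|\bar p|=\dim_{\mathrm{par}}\Gamma$, and a map $\gamma\colon A\to B^{\dim\Gamma}$. For a formula $\psi(x_1,\ldots,x_m,a_1,\ldots,a_s)$ of $L(\mathbb{A})\cup A$ (with constants $a_i\in A$) put $\psi_{\Gamma,\bar p,\gamma}(\bar x_1,\ldots,\bar x_m)=\psi_\Gamma(\bar x_1,\ldots,\bar x_m,\gamma(a_1),\ldots,\gamma(a_s),\bar p)$, where $\psi_\Gamma$ is the translation of $\psi(x_1,\ldots,x_m,z_1,\ldots,z_s)$. **Projective logical geometry.** For a set $S$ of $L(\mathbb{A})\cup A$-formulas in free variables $x_1,\ldots,x_m$ put $\mathrm{V}_{\mathbb{A}}(S)=\{\bar a\in A^m\mid\mathbb{A}_A\models\psi(\bar a)\ \forall\psi\in S\}$. Sets $X=\mathrm{V}_{\mathbb{A}}(S)$ are the logical sets over $\mathbb{A}$; $X$ is an $(\alpha,\beta)$-logical set ($\alpha\leqslant\beta$ infinite cardinals; the symbol $\infty$ means no restriction) if $S$ can be chosen with $|S|<\beta$ and fewer than $\alpha$ parameters from $A$. The $(\omega,\omega)$-logical sets are the definable sets. An equivalence relation $\sim_X$ on a non-empty logical set $X\subseteq A^m$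 is a formula equivalence, induced by an $L(\mathbb{A})\cup A$-formula $E(\bar x,\bar x')$, if for all $\bar a,\bar a'\in X$: $\bar a\sim_X\bar a'$ iff $\mathbb{A}_A\models E(\bar a,\bar a')$; and for all $\bar a\in X$, $\bar a'\in A^m$, $\mathbb{A}_A\models E(\bar a,\bar a')\vee E(\bar a',\bar a)$ implies $\bar a'\in X$. A projective logical set over $\mathbb{A}$ is a quotient $X/{\sim_X}$ of a non-empty logical set by a formula equivalence ($X$ is identified with $X/{=}$); it is an $(\alpha,\beta)$-projective logical set if $X$ is $(\alpha,\beta)$-logical, and a projective definable set if $X$ is definable. A map $F\colon X/{\sim_X}\to Y/{\sim_Y}$ ($X\subseteq A^m$, $Y\subseteq A^s$) is a formula map, induced by an $L(\mathbb{A})\cup A$-formula $\varphi(\bar x,\bar y)$, if (I) for all $\bar a\in X,\bar b\in Y$: $F(\bar a/{\sim_X})=\bar b/{\sim_Y}$ iff $\mathbb{A}_A\models\varphi(\bar a,\bar b)$; (II) $\bar a\in X,\bar b\in A^s\setminus Y$ implies $\mathbb{A}_A\not\models\varphi(\bar a,\bar b)$. The category $\mathcal{PLS}(\mathbb{A})$ has as objects all projective logical sets over $\mathbb{A}$ and $\emptyset$; morphisms between non-empty objects are the formula maps; $\emptyset$ is an initial object and there are no morphisms from non-empty objects to $\emptyset$. $\mathcal{PLS}_{\alpha,\beta}(\mathbb{A})$ is the full subcategory of $(\alpha,\beta)$-projective logical sets (and $\emptyset$); $\mathcal{PDS}(\mathbb{A})=\mathcal{PLS}_{\omega,\omega}(\mathbb{A})$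 is the full subcategory of projective definable sets. **Translation and interpretation functors.** Let $(\Gamma,\bar p,\gamma)\colon L(\mathbb{A})\cup A\to L(\mathbb{B})\cup B$ be an extended code; for a set $S$ of formulas put $S_{\Gamma,\bar p,\gamma}=\{\psi_{\Gamma,\bar p,\gamma}\mid\psi\in S\}$. Consider the following conditions, where all systems $S,S',S_X,\ldots$ are non-empty sets of formulas in finitely many free variables, with fewer than $\beta$ formulas and fewer than $\alpha$ parameters from $A$, and for $X=\mathrm{V}_{\mathbb{A}}(S_X)$ we write $\bar X=\mathrm{V}_{\mathbb{B}}((S_X)_{\Gamma,\bar p,\gamma})$ (conditions required for all choices of normal forms): (F1) $\mathrm{V}_{\mathbb{A}}(S)=\emptyset$ iff $\mathrm{V}_{\mathbb{B}}(S_{\Gamma,\bar p,\gamma})=\emptyset$; (F2) $\mathrm{V}_{\mathbb{A}}(S)=\mathrm{V}_{\mathbb{A}}(S')$ implies $\mathrm{V}_{\mathbb{B}}(S_{\Gamma,\bar p,\gamma})=\mathrm{V}_{\mathbb{B}}(S'_{\Gamma,\bar p,\gamma})$; (F3) if $E$ induces a formula equivalence on $X\ne\emptyset$, then $E_{\Gamma,\bar p,\gamma}$ induces a formula equivalence on $\bar X$; (F4) if $E,E'$ induce the same formula equivalence on $X$, then so do $E_{\Gamma,\bar p,\gamma},E'_{\Gamma,\bar p,\gamma}$ on $\bar X$; (F5) if $\varphi$ induces a formula map $X/{\sim_X}\to Y/{\sim_Y}$, then $\varphi_{\Gamma,\bar p,\gamma}$ induces a formula map $\bar X/{\sim_{\bar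 X}}\to\bar Y/{\sim_{\bar Y}}$, where $\sim_{\bar X},\sim_{\bar Y}$ are induced by the translations of formulas inducing $\sim_X,\sim_Y$; (F6) if $\varphi,\varphi'$ induce the same formula map, then so do $\varphi_{\Gamma,\bar p,\gamma},\varphi'_{\Gamma,\bar p,\gamma}$; (F7) if $\varphi_{XY},\varphi_{YZ}$ induce formula maps $X/{\sim_X}\to Y/{\sim_Y}$, $Y/{\sim_Y}\to Z/{\sim_Z}$, then the composition of the formula maps induced by their translations is induced by the translation of $\exists\bar y(\varphi_{XY}(\bar x,\bar y)\wedge\varphi_{YZ}(\bar y,\bar z))$. If (F1)–(F7) hold for $(\alpha,\beta)$, one says that the translation $(\Gamma,\bar p,\gamma)$-functor $\mathcal{F}=\mathcal{F}_{\Gamma,\bar p,\gamma}\colon\mathcal{PLS}_{\alpha,\beta}(\mathbb{A})\to\mathcal{PLS}_{\alpha,\beta}(\mathbb{B})$ exists (is well-defined): $\mathcal{F}(\emptyset)=\emptyset$, $\mathcal{F}(X/{\sim_X})=\bar X/{\sim_{\bar X}}$, $\mathcal{F}(\emptyset\to O)=(\emptyset\to\mathcal{F}(O))$, and $\mathcal{F}$ sends the formula map induced by $\varphi$ to the one induced by $\varphi_{\Gamma,\bar p,\gamma}$. Functors of this form are translation functors (class $\mathbf{Tr}$); for $(\alpha,\beta)=(\infty,\infty)$ they are called interpretation functors (class $\mathbf{Int}$); for $(\omega,\omega)$ they are functors $\mathcal{PDS}(\mathbb{A})\to\mathcal{PDS}(\mathbb{B})$. **Equivalence relative to a class.** $\mathcal{C}\sim_{\mathbf{K}}\mathcal{D}$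 means that there are functors $\mathcal{F}\colon\mathcal{C}\to\mathcal{D}$ and $\mathcal{G}\colon\mathcal{D}\to\mathcal{C}$ in the class $\mathbf{K}$ with natural isomorphisms $\mathcal{G}\circ\mathcal{F}\cong\mathrm{id}_{\mathcal{C}}$ and $\mathcal{F}\circ\mathcal{G}\cong\mathrm{id}_{\mathcal{D}}$. **Composition.** For codes $\Gamma\colon L(\mathbb{A})\to L(\mathbb{B})$ and $\Delta\colon L(\mathbb{B})\to L(\mathbb{C})$, the code $\Gamma\circ\Delta\colon L(\mathbb{A})\to L(\mathbb{C})$ consists of the $\Delta$-translations $(U_\Gamma)_\Delta,(E_\Gamma)_\Delta,(c_\Gamma)_\Delta,(f_\Gamma)_\Delta,(R_\Gamma)_\Delta$; $\dim\Gamma\circ\Delta=\dim\Gamma\cdot\dim\Delta$, $\dim_{\mathrm{par}}\Gamma\circ\Delta=\dim_{\mathrm{par}}\Gamma\cdot\dim\Delta+\dim_{\mathrm{par}}\Delta$. The composition of interpretations $(\Gamma,\bar p,\mu_\Gamma)\colon\mathbb{A}\rightsquigarrow\mathbb{B}$ and $(\Delta,\bar q,\mu_\Delta)\colon\mathbb{B}\rightsquigarrow\mathbb{C}$ is the interpretation $(\Gamma\circ\Delta,(\bar{\bar p},\bar q),\mu_\Gamma\circ\mu_\Delta)\colon\mathbb{A}\rightsquigarrow\mathbb{C}$, where $\bar{\bar p}\in\mu_\Delta^{-1}(\bar p)$ (any choice). The identical interpretation of $\mathbb{A}$ in $\mathbb{A}$ is $(\mathbf{Id}_{L(\mathbb{A})},\emptyset,\mathrm{id}_A)$,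 where $\mathbf{Id}_{L(\mathbb{A})}$ has dimension 1, no parameters, $U$ is $x=x$, $E$ is $x=x'$, and symbols are coded by $x=c$, $f(x_1,\ldots,x_{n_f})=x_0$, $R(x_1,\ldots,x_{n_R})$. **Strong homotopy and strong bi-interpretation.** Interpretations $(\Gamma_1,\bar p_1,\mu_{\Gamma_1}),(\Gamma_2,\bar p_2,\mu_{\Gamma_2})\colon\mathbb{A}\rightsquigarrow\mathbb{B}$ are strongly homotopic if there is an $L(\mathbb{A})$-isomorphism $\lambda\colon\Gamma_1(\mathbb{B},\bar p_1)\to\Gamma_2(\mathbb{B},\bar p_2)$, definable in $\mathbb{B}$ with parameters (i.e. the preimage of its graph in a power of $B$ is definable), with $\bar\mu_{\Gamma_1}=\bar\mu_{\Gamma_2}\circ\lambda$. $\mathbb{A}$ and $\mathbb{B}$ are strongly bi-interpretable in each other if there are interpretations $(\Gamma,\bar p,\mu_\Gamma)\colon\mathbb{A}\rightsquigarrow\mathbb{B}$ and $(\Delta,\bar q,\mu_\Delta)\colon\mathbb{B}\rightsquigarrow\mathbb{A}$ such that $(\Gamma\circ\Delta,(\bar{\bar p},\bar q),\mu_\Gamma\circ\mu_\Delta)$ is strongly homotopic to $(\mathbf{Id}_{L(\mathbb{A})},\emptyset,\mathrm{id}_A)$ and $(\Delta\circ\Gamma,(\bar{\bar q},\bar p),\mu_\Delta\circ\mu_\Gamma)$ is strongly homotopic to $(\mathbf{Id}_{L(\mathbb{B})},\emptyset,\mathrm{id}_B)$. *)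

(* Defs.v *)
(* Tuples of length m over M are functions 'I_m -> M, with m >= 0. *)
From Stdlib Require List.
From mathcomp Require Import all_boot.
From mathcomp Require Import matrix.
From mathcomp Require Import boolp classical_sets functions cardinality.

Set Implicit Arguments.
Unset Strict Implicit.
Unset Printing Implicit Defensive.

Local Open Scope classical_set_scope.

(** * First-order logic *)

Record language := Language {
  const_sym : Type;
  fun_sym : Type;
  pred_sym : Type;
  fun_arity : fun_sym -> nat;
  pred_arity : pred_sym -> nat }.

Record structure (L : language) := Structure {
  carrier :> Type;
  carrier_inh : inhabited carrier;
  cint : const_sym L -> carrier;
  fint : forall f : fun_sym L, ('I_(fun_arity f) -> carrier) -> carrier;
  pint : forall R : pred_sym L, ('I_(pred_arity R) -> carrier) -> Prop }.

(* Formulas are well scoped: the free variables of [fo At X] are among the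
   elements of X, and a quantifier binds the variable [None] of [option X].
   The type of atoms is a parameter, so that the same connectives serve for
   arbitrary formulas and for formulas with unnested atoms only.
   A -> B is written ~ A \/ B. *)
Inductive fo (At : Type -> Type) (X : Type) : Type :=
| Atom of At X
| Neg of fo At X
| Conj of fo At X & fo At X
| Disj of fo At X & fo At X
| Ex of fo At (option X)
| All of fo At (option X).

Inductive term (L : language) (X : Type) : Type :=
| Var of X
| Cst of const_sym L
| App (f : fun_sym L) of 'I_(fun_arity f) -> term L X.

Arguments Var {L X} _.
Arguments Cst {L X} _.
Arguments App {L X} f _.

Inductive atomic (L : language) (X : Type) : Type :=
| Eq of term L X & term L X
| Pred (R : pred_sym L) of 'I_(pred_arity R) -> term L X.

Arguments Eq {L X} _ _.
Arguments Pred {L X} R _.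

Definition formula (L : language) (X : Type) : Type := fo (atomic L) X.

(* The unnested atomic formulas x = x', x = c, f(x_1,...,x_n) = x_0 and
   R(x_1,...,x_n). *)
Inductive unnested (L : language) (X : Type) : Type :=
| UEq of X & X
| UCst of X & const_sym L
| UFun (f : fun_sym L) of 'I_(fun_arity f) -> X & X
| UPred (R : pred_sym L) of 'I_(pred_arity R) -> X.

Definition ueq (L : language) (X : Type) (u : unnested L X) : atomic L X :=
  match u with
  | UEq x x' => Eq (Var x) (Var x')
  | UCst x c => Eq (Var x) (Cst c)
  | UFun f xs x0 => Eq (App f (fun i => Var (xs i))) (Var x0)
  | UPred R xs => Pred R (fun i => Var (xs i))
  end.

Fixpoint embed (L : language) (X : Type) (p : fo (unnested L) X) :
    formula L X :=
  match p with
  | Atom u => Atom (ueq u)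
  | Neg p => Neg (embed p)
  | Conj p q => Conj (embed p) (embed q)
  | Disj p q => Disj (embed p) (embed q)
  | Ex p => Ex (embed p)
  | All p => All (embed p)
  end.

Fixpoint teval (L : language) (M : structure L) (X : Type) (v : X -> M)
    (t : term L X) : M :=
  match t with
  | Var x => v x
  | Cst c => cint M c
  | App f ts => fint (fun i => teval v (ts i))
  end.

Definition aeval (L : language) (M : structure L) (X : Type) (v : X -> M)
    (a : atomic L X) : Prop :=
  match a with
  | Eq t t' => teval v t = teval v t'
  | Pred R ts => pint (fun i => teval v (ts i))
  end.

Definition vcons (X T : Type) (v : X -> T) (a : T) : option X -> T :=
  fun x => if x is Some y then v y else a.

Fixpoint sat (L : language) (M : structure L) (X : Type) (v : X -> M)
    (p : fo (atomic L) X) : Prop :=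
  match p with
  | Atom a => aeval v a
  | Neg p => ~ sat v p
  | Conj p q => sat v p /\ sat v q
  | Disj p q => sat v p \/ sat v q
  | Ex p => exists a : M, sat (vcons v a) p
  | All p => forall a : M, sat (vcons v a) p
  end.

Definition logeq (L : language) (X : Type) (p q : formula L X) : Prop :=
  forall (M : structure L) (v : X -> M), sat v p <-> sat v q.

Fixpoint trename (L : language) (X Y : Type) (r : X -> Y) (t : term L X) :
    term L Y :=
  match t with
  | Var x => Var (r x)
  | Cst c => Cst c
  | App f ts => App f (fun i => trename r (ts i))
  end.

Definition arename (L : language) (X Y : Type) (r : X -> Y) (a : atomic L X) :
    atomic L Y :=
  match a with
  | Eq t t' => Eq (trename r t) (trename r t')
  | Pred R ts => Pred R (fun i => trename r (ts i))
  end.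

Fixpoint rename (L : language) (X Y : Type) (r : X -> Y)
    (p : fo (atomic L) X) : formula L Y :=
  match p with
  | Atom a => Atom (arename r a)
  | Neg p => Neg (rename r p)
  | Conj p q => Conj (rename r p) (rename r q)
  | Disj p q => Disj (rename r p) (rename r q)
  | Ex p => Ex (rename (omap r) p)
  | All p => All (rename (omap r) p)
  end.

Fixpoint tvars (L : language) (X : Type) (t : term L X) : seq X :=
  match t with
  | Var x => [:: x]
  | Cst _ => [::]
  | App f ts => flatten [seq tvars (ts i) | i <- enum 'I_(fun_arity f)]
  end.

Definition avars (L : language) (X : Type) (a : atomic L X) : seq X :=
  match a with
  | Eq t t' => tvars t ++ tvars t'
  | Pred R ts => flatten [seq tvars (ts i) | i <- enum 'I_(pred_arity R)]
  end.

Fixpoint fvars (L : language) (X : Type) (p : fo (atomic L) X) : seq X :=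
  match p with
  | Atom a => avars a
  | Neg p => fvars p
  | Conj p q => fvars p ++ fvars q
  | Disj p q => fvars p ++ fvars q
  | Ex p => pmap id (fvars p)
  | All p => pmap id (fvars p)
  end.

Definition split_first (X : Type) (n : nat) (x : X + 'I_n.+1) :
    option X + 'I_n :=
  match x with
  | inl y => inl (Some y)
  | inr i => if unlift ord0 i is Some j then inr j else inl None
  end.

Definition from_ord0 (X : Type) (i : 'I_0) : X :=
  False_rect X (notF (ltn_ord i)).

Fixpoint Exs (L : language) (n : nat) : forall X : Type,
    formula L (X + 'I_n) -> formula L X :=
  match n with
  | 0 => fun X p =>
      rename (fun x => match x with inl y => y | inr i => from_ord0 X i end) p
  | n'.+1 => fun X p => Ex (Exs (rename (@split_first X n') p))
  end.

Fixpoint Alls (L : language) (n : nat) : forall X : Type,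
    formula L (X + 'I_n) -> formula L X :=
  match n with
  | 0 => fun X p =>
      rename (fun x => match x with inl y => y | inr i => from_ord0 X i end) p
  | n'.+1 => fun X p => All (Alls (rename (@split_first X n') p))
  end.

(** * Normal forms *)

Definition is_literal (At : Type -> Type) (X : Type) (p : fo At X) : bool :=
  match p with
  | Atom _ => true
  | Neg (Atom _) => true
  | _ => false
  end.

Fixpoint is_conjunction (At : Type -> Type) (X : Type) (p : fo At X) : bool :=
  is_literal p ||
  (if p is Conj q r then is_conjunction q && is_conjunction r else false).

Fixpoint is_dnf (At : Type -> Type) (X : Type) (p : fo At X) : bool :=
  is_conjunction p || (if p is Disj q r then is_dnf q && is_dnf r else false).

Fixpoint is_normal (At : Type -> Type) (X : Type) (p : fo At X) : bool :=
  match p with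
  | Ex q => is_normal q
  | All q => is_normal q
  | _ => is_dnf p
  end.

(* A formula which already is in normal form has no other normal form than
   itself. *)
Definition normal_form_of (L : language) (X : Type) (p : formula L X)
    (n : fo (unnested L) X) : Prop :=
  [/\ is_normal n, logeq p (embed n) &
      (exists2 m : fo (unnested L) X, is_normal m & embed m = p) ->
      embed n = p].

(** * Codes and translations *)

(* Variables of a formula in n tuples of length d and k parameters;
   [inl (i, j)] is the j-th coordinate of the i-th tuple. *)
Definition cvar (n d k : nat) : Type := ('I_n * 'I_d + 'I_k)%type.

(* d is the dimension and k the number of parameters.  In [code_f f] the
   tuple x_0 has index [ord0] and x_i, for i >= 1, has index i. *)
Record code (L L' : language) (d k : nat) := Code {
  code_U : formula L' (cvar 1 d k);
  code_E : formula L' (cvar 2 d k);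
  code_c : const_sym L -> formula L' (cvar 1 d k);
  code_f : forall f : fun_sym L, formula L' (cvar (fun_arity f).+1 d k);
  code_R : forall R : pred_sym L, formula L' (cvar (pred_arity R) d k) }.

Definition fcons (T : Type) (n : nat) (x0 : T) (xs : 'I_n -> T) :
    'I_n.+1 -> T :=
  fun i => if unlift ord0 i is Some j then xs j else x0.

(* The variable x of the original formula becomes the tuple
   [inl (x, j)], j < d. *)
Definition plug (L' : language) (d k n : nat) (X : Type) (xs : 'I_n -> X)
    (p : formula L' (cvar n d k)) : formula L' (X * 'I_d + 'I_k) :=
  rename (fun z => match z with
                   | inl (i, j) => inl (xs i, j)
                   | inr l => inr l
                   end) p.

Definition unbind_tuple (X : Type) (d k : nat) (z : option X * 'I_d + 'I_k) :
    (X * 'I_d + 'I_k) + 'I_d :=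
  match z with
  | inl (Some x, j) => inl (inl (x, j))
  | inl (None, j) => inr j
  | inr l => inl (inr l)
  end.

Fixpoint tr (L L' : language) (d k : nat) (G : code L L' d k) (X : Type)
    (p : fo (unnested L) X) : formula L' (X * 'I_d + 'I_k) :=
  match p with
  | Atom (UEq x x') => plug (fcons x (fun _ : 'I_1 => x')) (code_E G)
  | Atom (UCst x c) => plug (fun _ => x) (code_c G c)
  | Atom (UFun f xs x0) => plug (fcons x0 xs) (code_f G f)
  | Atom (UPred R xs) => plug xs (code_R G R)
  | Neg p => Neg (tr G p)
  | Conj p q => Conj (tr G p) (tr G q)
  | Disj p q => Disj (tr G p) (tr G q)
  | Ex p =>
      Exs (rename (@unbind_tuple X d k)
             (Conj (plug (fun _ => None) (code_U G)) (tr G p)))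
  | All p =>
      Alls (rename (@unbind_tuple X d k)
              (Disj (Neg (plug (fun _ => None) (code_U G))) (tr G p)))
  end.

(* The full translation, when the listed free variables are [xs]. *)
Definition translation (L L' : language) (d k : nat) (G : code L L' d k)
    (X : Type) (xs : seq X) (p : fo (unnested L) X) :
    formula L' (X * 'I_d + 'I_k) :=
  foldr (fun x q => Conj (plug (fun _ => x) (code_U G)) q) (tr G p) xs.

(** * Formulas with parameters *)

(* An (L(M) u M)-formula with free variables in X: the parameter a is the
   variable [inr a], which is always assigned the value a. *)
Definition pformula (L : language) (M : structure L) (X : Type) : Type :=
  formula L (X + M).

Definition psat (L : language) (M : structure L) (X : Type) (v : X -> M)
    (p : pformula M X) : Prop :=
  sat (fun x : X + M => match x with inl y => v y | inr a => a end) p.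

Definition params_in (X M : Type) (s : seq (X + M)) : seq M :=
  pmap (fun x => if x is inr a then Some a else None) s.

Definition params (L : language) (M : structure L) (X : Type)
    (p : pformula M X) : seq M := params_in (fvars p).

Definition psat2 (L : language) (M : structure L) (m n : nat)
    (p : pformula M ('I_m + 'I_n)) (a : 'I_m -> M) (b : 'I_n -> M) : Prop :=
  psat (fun x => match x with inl i => a i | inr j => b j end) p.

(** * Logical sets *)

(* A bound on cardinalities: [Some K] is the cardinal of the type K, [None] is
   the symbol oo (no restriction). *)
Definition below (T : Type) (S : set T) (kappa : option Type) : Prop :=
  if kappa is Some K then (S #<= [set: K])%card /\ ~ ([set: K] #<= S)%card
  else True.

Definition params_of (L : language) (M : structure L) (X : Type)
    (S : set (pformula M X)) : set M :=
  [set a | exists2 p, S p & List.In a (params p)].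

Definition small (alpha beta : option Type) (L : language) (M : structure L)
    (X : Type) (S : set (pformula M X)) : Prop :=
  below S beta /\ below (params_of S) alpha.

Definition V (L : language) (M : structure L) (m : nat)
    (S : set (pformula M 'I_m)) : set ('I_m -> M) :=
  [set a | forall p, S p -> psat a p].

Definition logical (alpha beta : option Type) (L : language) (M : structure L)
    (m : nat) (X : set ('I_m -> M)) : Prop :=
  exists2 S : set (pformula M 'I_m), small alpha beta S & X = V S.

Definition omega : option Type := Some (nat : Type).

Definition definable (L : language) (M : structure L) (m : nat)
    (X : set ('I_m -> M)) : Prop := logical omega omega X.

(** * Quotients *)

Definition equivalence_on (T : Type) (X : set T) (r : T -> T -> Prop) : Prop :=
  [/\ forall a, X a -> r a a,
      forall a b, X a -> X b -> r a b -> r b a &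
      forall a b c, X a -> X b -> X c -> r a b -> r b c -> r a c].

Definition quot (T : Type) (X : set T) (r : T -> T -> Prop) : Type :=
  {c : set T | exists2 a, X a & c = [set b | X b /\ r a b]}.

Definition cls (T : Type) (X : set T) (r : T -> T -> Prop) (a : T) (Xa : X a) :
    quot X r :=
  exist _ [set b | X b /\ r a b] (ex_intro2 _ _ a Xa erefl).

Lemma quot_ind (T : Type) (X : set T) (r : T -> T -> Prop)
    (P : quot X r -> Prop) :
  (forall a (Xa : X a), P (cls r Xa)) -> forall c, P c.
Proof.
move=> H [c [a Xa e]]; subst c.
exact: (H a Xa).
Qed.

Lemma clsP (T : Type) (X : set T) (r : T -> T -> Prop) :
  equivalence_on X r ->
  forall a b (Xa : X a) (Xb : X b), cls r Xa = cls r Xb <-> r a b.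
Proof.
move=> [rr rs rt] a b Xa Xb; split.
  move=> /(congr1 sval) /= e.
  have : [set b0 | X b0 /\ r b b0] b by split=> //; exact: rr.
  by rewrite -e => -[].
move=> ab; apply: eq_exist; apply/seteqP; split=> c /= [Xc H]; split=> //.
  by apply: (rt _ a) => //; apply: rs.
exact: (rt _ b).
Qed.

(** * Projective logical sets and formula maps *)

Definition formula_equivalence (L : language) (M : structure L) (m : nat)
    (X : set ('I_m -> M)) (r : ('I_m -> M) -> ('I_m -> M) -> Prop)
    (E : pformula M ('I_m + 'I_m)) : Prop :=
  [/\ equivalence_on X r,
      forall a a', X a -> X a' -> (r a a' <-> psat2 E a a') &
      forall a a', X a -> psat2 E a a' \/ psat2 E a' a -> X a'].

(* [pl_support] makes [pl_rel] a relation on [pl_set], so that equal quotients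
   are equal records. *)
Record plset (alpha beta : option Type) (L : language) (M : structure L)
    (m : nat) := PLSet {
  pl_set : set ('I_m -> M);
  pl_rel : ('I_m -> M) -> ('I_m -> M) -> Prop;
  pl_nonempty : pl_set !=set0;
  pl_logical : logical alpha beta pl_set;
  pl_support : forall a a', pl_rel a a' -> pl_set a /\ pl_set a';
  pl_formula : exists E, formula_equivalence pl_set pl_rel E }.

Definition pl_quot (alpha beta : option Type) (L : language) (M : structure L)
    (m : nat) (X : plset alpha beta M m) : Type :=
  quot (pl_set X) (@pl_rel _ _ _ _ _ X).

Definition pl_cls (alpha beta : option Type) (L : language) (M : structure L)
    (m : nat) (X : plset alpha beta M m) (a : 'I_m -> M) (Xa : pl_set X a) :
    pl_quot X :=
  cls (@pl_rel _ _ _ _ _ X) Xa.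

Definition induces (alpha beta : option Type) (L : language) (M : structure L)
    (m n : nat) (X : plset alpha beta M m) (Y : plset alpha beta M n)
    (phi : pformula M ('I_m + 'I_n)) (F : pl_quot X -> pl_quot Y) : Prop :=
  (forall a b (Xa : pl_set X a) (Yb : pl_set Y b),
      F (pl_cls Xa) = pl_cls Yb <-> psat2 phi a b) /\
  (forall a b, pl_set X a -> ~ pl_set Y b -> ~ psat2 phi a b).

Definition formula_map (alpha beta : option Type) (L : language)
    (M : structure L) (m n : nat) (X : plset alpha beta M m)
    (Y : plset alpha beta M n) : Type :=
  {F : pl_quot X -> pl_quot Y | exists phi, induces phi F}.

(* The formula  exists y, phi(x, y) /\ psi(y, z). *)
Definition compose_formula (L : language) (M : structure L) (m n s : nat)
    (phi : pformula M ('I_m + 'I_n)) (psi : pformula M ('I_n + 'I_s)) :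
    pformula M ('I_m + 'I_s) :=
  Exs (Conj
    (rename (fun x => match x with
                      | inl (inl i) => inl (inl (inl i))
                      | inl (inr j) => inr j
                      | inr a => inl (inr a)
                      end) phi)
    (rename (fun x => match x with
                      | inl (inl j) => inr j
                      | inl (inr l) => inl (inl (inr l))
                      | inr a => inl (inr a)
                      end) psi)).

Lemma teval_rename (L : language) (M : structure L) (X Y : Type) (r : X -> Y)
    (v : Y -> M) (t : term L X) :
  teval v (trename r t) = teval (fun x => v (r x)) t.
Proof.
elim: t => //= f ts IH; congr fint; apply: funext => i; exact: IH.
Qed.

Lemma sat_rename (L : language) (M : structure L) (X : Type)
    (p : formula L X) :
  forall (Y : Type) (r : X -> Y) (v : Y -> M),
  sat v (rename r p) = sat (fun x => v (r x)) p.
Proof.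
have vconsE (W Y : Type) (r : W -> Y) (v : Y -> M) a :
    (fun x => vcons v a (omap r x)) = vcons (fun x => v (r x)) a.
  by apply: funext => -[].
elim: p => {X} [X [t t'|R ts]|X p IH|X p IHp q IHq|X p IHp q IHq|X p IH|X p IH]
  Y r v /=.
- by rewrite !teval_rename.
- by congr pint; apply: funext => i; rewrite teval_rename.
- by rewrite IH.
- by rewrite IHp IHq.
- by rewrite IHp IHq.
- by congr ex; apply: funext => a; rewrite IH vconsE.
- by apply: eq_forall => a; rewrite IH vconsE.
Qed.

Lemma sat_Exs (L : language) (M : structure L) (n : nat) :
  forall (X : Type) (v : X -> M) (p : formula L (X + 'I_n)),
  sat v (Exs p) <->
  exists b : 'I_n -> M,
    sat (fun x => match x with inl y => v y | inr i => b i end) p.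
Proof.
elim: n => [|n IH] X v p /=.
  rewrite sat_rename.
  have E (b : 'I_0 -> M) :
    (fun x : X + 'I_0 => v match x with
                  | inl y => y
                  | inr i => from_ord0 X i
                  end) =
    (fun x => match x with inl y => v y | inr i => b i end).
    by apply: funext => -[y|[]].
  split=> [H|[b]]; last by rewrite -(E b).
  have b : 'I_0 -> M by case.
  by exists b; rewrite -(E b).
split=> [[a /IH[b]]|[b H]].
  rewrite sat_rename => H.
  exists (fcons a b); move: H; congr (sat _ _).
  apply: funext => -[y|i] //=.
  by rewrite /fcons; case: (unlift ord0 i).
exists (b ord0); apply/IH; exists (fun j => b (lift ord0 j)).
rewrite sat_rename; move: H; congr (sat _ _).
by apply: funext => -[y|i] //=; case: unliftP => [j ->|->].
Qed.

Lemma psat2_compose (L : language) (M : structure L) (m n s : nat)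
    (phi : pformula M ('I_m + 'I_n)) (psi : pformula M ('I_n + 'I_s)) a c :
  psat2 (compose_formula phi psi) a c <->
  exists b, psat2 phi a b /\ psat2 psi b c.
Proof.
rewrite /psat2 /psat /compose_formula sat_Exs /=.
have E (b : 'I_n -> M) :
    (sat (fun x => match x with
        | inl y => match y with
                   | inl z => match z with inl i => a i | inr j => c j end
                   | inr e => e end
        | inr i => b i end)
      (rename (fun x => match x with
                      | inl (inl i) => inl (inl (inl i))
                      | inl (inr j) => inr j
                      | inr a => inl (inr a)
                      end) phi) = psat2 phi a b) *
    (sat (fun x => match x with
        | inl y => match y with
                   | inl z => match z with inl i => a i | inr j => c j end
                   | inr e => e end
        | inr i => b i end)
      (rename (fun x => match x with
                      | inl (inl j) => inr j
                      | inl (inr l) => inl (inl (inr l))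
                      | inr a => inl (inr a)
                      end) psi) = psat2 psi b c).
  by split; rewrite sat_rename /psat2 /psat; congr (sat _ _);
     apply: funext => -[[]|].
by split=> -[b H]; exists b; move: H; rewrite !E.
Qed.

Lemma induces_id (alpha beta : option Type) (L : language) (M : structure L)
    (m : nat) (X : plset alpha beta M m) :
  exists phi, induces (X := X) (Y := X) phi id.
Proof.
have [E [eqr rE sE]] := pl_formula X; exists E; split.
  move=> a b Xa Xb; rewrite -(rE _ _ Xa Xb).
  exact: (clsP eqr).
by move=> a b Xa nXb Eab; apply: nXb; apply: (sE a b Xa); left.
Qed.

Lemma induces_comp (alpha beta : option Type) (L : language) (M : structure L)
    (m n s : nat) (X : plset alpha beta M m) (Y : plset alpha beta M n)
    (Z : plset alpha beta M s) (F : pl_quot X -> pl_quot Y)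
    (G : pl_quot Y -> pl_quot Z) phi psi :
  induces phi F -> induces psi G ->
  induces (compose_formula phi psi) (fun x => G (F x)).
Proof.
move=> [F1 F2] [G1 G2]; split.
  move=> a c Xa Zc; rewrite psat2_compose; split.
    have [b [Yb Fa]] : exists b (Yb : pl_set Y b), F (pl_cls Xa) = pl_cls Yb.
      by elim/quot_ind: (F (pl_cls Xa)) => b Yb; exists b, Yb.
    move=> Gb; exists b; split; first exact/(F1 _ _ Xa Yb).
    by apply/(G1 _ _ Yb Zc); rewrite -Fa.
  move=> [b [ab bc]].
  have [Yb|nYb] := pselect (pl_set Y b); last by case: (F2 _ _ Xa nYb ab).
  by move/(F1 _ _ Xa Yb): ab => ->; apply/(G1 _ _ Yb Zc).
move=> a c Xa nZc; rewrite psat2_compose => -[b [ab bc]].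
have [Yb|nYb] := pselect (pl_set Y b); last exact: (F2 _ _ Xa nYb ab).
exact: (G2 _ _ Yb nZc bc).
Qed.

Definition formula_id (alpha beta : option Type) (L : language)
    (M : structure L) (m : nat) (X : plset alpha beta M m) : formula_map X X :=
  exist _ id (induces_id X).

Definition formula_comp (alpha beta : option Type) (L : language)
    (M : structure L) (m n s : nat) (X : plset alpha beta M m)
    (Y : plset alpha beta M n) (Z : plset alpha beta M s)
    (F : formula_map X Y) (G : formula_map Y Z) : formula_map X Z :=
  exist _ (fun x => sval G (sval F x))
    (let: ex_intro phi Hphi := svalP F in
     let: ex_intro psi Hpsi := svalP G in
     ex_intro _ (compose_formula phi psi) (induces_comp Hphi Hpsi)).

(** * Categories *)

(* [cmp f g] is "f, then g". *)
Record category := Category {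
  ob :> Type;
  hom : ob -> ob -> Type;
  idm : forall x, hom x x;
  cmp : forall x y z, hom x y -> hom y z -> hom x z;
  cmp_idl : forall x y (f : hom x y), cmp (idm x) f = f;
  cmp_idr : forall x y (f : hom x y), cmp f (idm y) = f;
  cmpA : forall x y z t (f : hom x y) (g : hom y z) (h : hom z t),
    cmp f (cmp g h) = cmp (cmp f g) h }.

Arguments idm {c} x.
Arguments cmp {c x y z} _ _.

Record functor (C D : category) := Functor {
  fob :> C -> D;
  fhom : forall x y : C, hom x y -> hom (fob x) (fob y);
  fhom_id : forall x : C, fhom (idm x) = idm (fob x);
  fhom_cmp : forall (x y z : C) (f : hom x y) (g : hom y z),
    fhom (cmp f g) = cmp (fhom f) (fhom g) }.

Arguments fhom {C D} _ {x y} _.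

Definition functor_id (C : category) : functor C C :=
  @Functor C C (fun x => x) (fun _ _ f => f) (fun _ => erefl)
    (fun _ _ _ _ _ => erefl).

Lemma functor_comp_id (C D E : category) (F : functor C D) (G : functor D E)
    (x : C) : fhom G (fhom F (idm x)) = idm (G (F x)).
Proof. by rewrite !fhom_id. Qed.

Lemma functor_comp_cmp (C D E : category) (F : functor C D) (G : functor D E)
    (x y z : C) (f : hom x y) (g : hom y z) :
  fhom G (fhom F (cmp f g)) =
  cmp (fhom G (fhom F f)) (fhom G (fhom F g)).
Proof. by rewrite !fhom_cmp. Qed.

(* "F, then G". *)
Definition functor_comp (C D E : category) (F : functor C D)
    (G : functor D E) : functor C E :=
  @Functor C E (fun x => G (F x)) (fun _ _ f => fhom G (fhom F f))
    (functor_comp_id F G) (@functor_comp_cmp _ _ _ F G).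

Definition is_iso (C : category) (x y : C) (f : hom x y) : Prop :=
  exists g : hom y x, cmp f g = idm x /\ cmp g f = idm y.

Definition naturally_isomorphic (C D : category) (F G : functor C D) : Prop :=
  exists eta : forall x : C, hom (F x) (G x),
    (forall x, is_iso (eta x)) /\
    (forall (x y : C) (f : hom x y),
       cmp (fhom F f) (eta y) = cmp (eta x) (fhom G f)).

Definition equivalent_relative (C D : category) (K : functor C D -> Prop)
    (K' : functor D C -> Prop) : Prop :=
  exists (F : functor C D) (G : functor D C),
    [/\ K F, K' G,
        naturally_isomorphic (functor_comp F G) (functor_id C) &
        naturally_isomorphic (functor_comp G F) (functor_id D)].

(* An arrow together with its source and target. *)
Definition arrow (C : category) (x y : C) (f : hom x y) :
    {xy : C * C & hom xy.1 xy.2} :=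
  existT (fun xy : C * C => hom xy.1 xy.2) (x, y) f.

(** * The categories of projective logical sets *)

(* [None] is the empty set. *)
Definition pls_ob (alpha beta : option Type) (L : language) (M : structure L) :
    Type := option {m : nat & plset alpha beta M m}.

Definition pls_some (alpha beta : option Type) (L : language)
    (M : structure L) (m : nat) (X : plset alpha beta M m) :
    pls_ob alpha beta M := Some (existT _ m X).

Definition pls_hom (alpha beta : option Type) (L : language) (M : structure L)
    (O P : pls_ob alpha beta M) : Type :=
  match O, P with
  | None, _ => unit
  | Some _, None => Empty_set
  | Some X, Some Y => formula_map (projT2 X) (projT2 Y)
  end.

Definition pls_id (alpha beta : option Type) (L : language) (M : structure L)
    (O : pls_ob alpha beta M) : pls_hom O O :=
  match O with
  | None => tt
  | Some X => formula_id (projT2 X)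
  end.

Definition pls_cmp (alpha beta : option Type) (L : language) (M : structure L)
    (O P Q : pls_ob alpha beta M) :
    pls_hom O P -> pls_hom P Q -> pls_hom O Q :=
  match O, P, Q with
  | None, _, _ => fun _ _ => tt
  | Some _, None, _ => fun f _ => match f with end
  | Some _, Some _, None => fun _ g => g
  | Some X, Some Y, Some Z => fun f g => formula_comp f g
  end.

Lemma pls_idl (alpha beta : option Type) (L : language) (M : structure L)
    (O P : pls_ob alpha beta M) (f : pls_hom O P) : pls_cmp (pls_id O) f = f.
Proof.
case: O P f => [X|] [Y|] //= f;
  first [by case: f | by case: f => F HF; apply: eq_exist].
Qed.

Lemma pls_idr (alpha beta : option Type) (L : language) (M : structure L)
    (O P : pls_ob alpha beta M) (f : pls_hom O P) : pls_cmp f (pls_id P) = f.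
Proof.
case: O P f => [X|] [Y|] //= f;
  first [by case: f | by case: f => F HF; apply: eq_exist].
Qed.

Lemma pls_cmpA (alpha beta : option Type) (L : language) (M : structure L)
    (O P Q R : pls_ob alpha beta M) (f : pls_hom O P) (g : pls_hom P Q)
    (h : pls_hom Q R) :
  pls_cmp f (pls_cmp g h) = pls_cmp (pls_cmp f g) h.
Proof.
case: O P Q R f g h => [X|] [Y|] [Z|] [W|] //= f g h;
  first [by case: f | by case: g | by case: h | exact: eq_exist].
Qed.

Definition PLS (alpha beta : option Type) (L : language) (M : structure L) :
    category :=
  @Category (pls_ob alpha beta M) (@pls_hom alpha beta L M)
    (@pls_id alpha beta L M) (@pls_cmp alpha beta L M)
    (@pls_idl alpha beta L M) (@pls_idr alpha beta L M)
    (@pls_cmpA alpha beta L M).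

(** * Translation functors *)

Definition flat (m d : nat) (x : 'I_m * 'I_d) : 'I_(m * d) :=
  mxvec_index x.1 x.2.

Definition flat2 (m n d : nat) (x : ('I_m + 'I_n) * 'I_d) :
    'I_(m * d) + 'I_(n * d) :=
  match x with
  | (inl i, j) => inl (flat (i, j))
  | (inr i, j) => inr (flat (i, j))
  end.

(* [p'] is p_{G,q,g} for some normal form of p.  The listed free variables of
   p are all the variables of X and the parameters that occur in p; [h] renames
   the resulting variables. *)
Definition ptranslation (L L' : language) (A : structure L) (B : structure L')
    (d k : nat) (G : code L L' d k) (q : 'I_k -> B) (g : A -> 'I_d -> B)
    (X : finType) (Y : Type) (h : X * 'I_d -> Y) (p : pformula A X)
    (p' : pformula B Y) : Prop :=
  exists n : fo (unnested L) (X + A),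
    [/\ normal_form_of p n,
        (forall a, List.In a (params (embed n : pformula A X)) ->
                   List.In a (params p)) &
        p' = rename (fun z => match z with
                              | inl (inl x, j) => inl (h (x, j))
                              | inl (inr a, j) => inr (g a j)
                              | inr l => inr (q l)
                              end)
               (translation G (map inl (enum X) ++ map inr (params p)) n)].

Definition ptrans1 (L L' : language) (A : structure L) (B : structure L')
    (d k : nat) (G : code L L' d k) (q : 'I_k -> B) (g : A -> 'I_d -> B)
    (m : nat) :
    pformula A 'I_m -> pformula B 'I_(m * d) -> Prop :=
  ptranslation G q g (@flat m d).

Definition ptrans2 (L L' : language) (A : structure L) (B : structure L')
    (d k : nat) (G : code L L' d k) (q : 'I_k -> B) (g : A -> 'I_d -> B)
    (m n : nat) :
    pformula A ('I_m + 'I_n) -> pformula B ('I_(m * d) + 'I_(n * d)) -> Prop :=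
  ptranslation (X := ('I_m + 'I_n)%type) G q g (@flat2 m n d).

(* [T] is S_{G,q,g} for some choice of normal forms. *)
Definition strans (L L' : language) (A : structure L) (B : structure L')
    (d k : nat) (G : code L L' d k) (q : 'I_k -> B) (g : A -> 'I_d -> B)
    (m : nat) (S : set (pformula A 'I_m)) (T : set (pformula B 'I_(m * d))) :
    Prop :=
  exists2 c : pformula A 'I_m -> pformula B 'I_(m * d),
    (forall p, S p -> ptrans1 G q g p (c p)) & T = c @` S.

Definition small_system (alpha beta : option Type) (L : language)
    (M : structure L) (m : nat) (S : set (pformula M 'I_m)) : Prop :=
  S !=set0 /\ small alpha beta S.

Definition presents (alpha beta : option Type) (L : language)
    (M : structure L) (m : nat) (X : plset alpha beta M m)
    (S : set (pformula M 'I_m)) (E : pformula M ('I_m + 'I_m)) : Prop :=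
  pl_set X = V S /\ formula_equivalence (pl_set X) (@pl_rel _ _ _ _ _ X) E.

(* [X'] is the translation of the projective logical set X, computed from some
   small presentation of X. *)
Definition pl_translation (alpha beta : option Type) (L L' : language)
    (A : structure L) (B : structure L') (d k : nat) (G : code L L' d k)
    (q : 'I_k -> B) (g : A -> 'I_d -> B) (m : nat)
    (X : plset alpha beta A m) (X' : plset alpha beta B (m * d)) : Prop :=
  exists S E T E',
    [/\ small_system alpha beta S, presents X S E, strans G q g S T,
        ptrans2 G q g E E' & presents X' T E'].

(* As [T], [E'], [phi'], ... range over all translations of [S], [E],
   [phi], ..., the conditions are required for all choices of normal forms. *)
Record functor_conditions (alpha beta : option Type) (L L' : language)
    (A : structure L) (B : structure L') (d k : nat) (G : code L L' d k)
    (q : 'I_k -> B) (g : A -> 'I_d -> B) : Prop := {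
  F1 : forall m (S : set (pformula A 'I_m)) T,
    small_system alpha beta S -> strans G q g S T ->
    V S = set0 <-> V T = set0;
  F2 : forall m (S S' : set (pformula A 'I_m)) T T',
    small_system alpha beta S -> small_system alpha beta S' ->
    strans G q g S T -> strans G q g S' T' ->
    V S = V S' -> V T = V T';
  F3 : forall m (S : set (pformula A 'I_m)) T E E',
    small_system alpha beta S -> strans G q g S T -> ptrans2 G q g E E' ->
    V S !=set0 ->
    (exists r, formula_equivalence (V S) r E) ->
    (exists r, formula_equivalence (V T) r E');
  F4 : forall m (S : set (pformula A 'I_m)) T E1 E1' E2 E2',
    small_system alpha beta S -> strans G q g S T ->
    ptrans2 G q g E1 E1' -> ptrans2 G q g E2 E2' ->
    V S !=set0 ->
    (exists r, formula_equivalence (V S) r E1 /\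
               formula_equivalence (V S) r E2) ->
    (exists r, formula_equivalence (V T) r E1' /\
               formula_equivalence (V T) r E2');
  F5 : forall m n (X : plset alpha beta A m) (Y : plset alpha beta A n) X' Y'
      phi phi',
    pl_translation G q g X X' -> pl_translation G q g Y Y' ->
    ptrans2 G q g phi phi' ->
    (exists F : pl_quot X -> pl_quot Y, induces phi F) ->
    (exists F : pl_quot X' -> pl_quot Y', induces phi' F);
  F6 : forall m n (X : plset alpha beta A m) (Y : plset alpha beta A n) X' Y'
      phi phi' psi psi',
    pl_translation G q g X X' -> pl_translation G q g Y Y' ->
    ptrans2 G q g phi phi' -> ptrans2 G q g psi psi' ->
    (exists F : pl_quot X -> pl_quot Y, induces phi F /\ induces psi F) ->
    (exists F : pl_quot X' -> pl_quot Y', induces phi' F /\ induces psi' F);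
  F7 : forall m n s (X : plset alpha beta A m) (Y : plset alpha beta A n)
      (Z : plset alpha beta A s) X' Y' Z' phi phi' psi psi' chi'
      (F : pl_quot X -> pl_quot Y) (H : pl_quot Y -> pl_quot Z)
      (F' : pl_quot X' -> pl_quot Y') (H' : pl_quot Y' -> pl_quot Z'),
    pl_translation G q g X X' -> pl_translation G q g Y Y' ->
    pl_translation G q g Z Z' ->
    ptrans2 G q g phi phi' -> ptrans2 G q g psi psi' ->
    ptrans2 G q g (compose_formula phi psi) chi' ->
    induces phi F -> induces psi H ->
    induces phi' F' -> induces psi' H' ->
    induces chi' (fun x => H' (F' x)) }.

(* The value of a functor on an arrow out of [None] is forced by its value on
   [None]. *)
Definition translation_functor (alpha beta : option Type) (L L' : language)
    (A : structure L) (B : structure L')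
    (F : functor (PLS alpha beta A) (PLS alpha beta B)) : Prop :=
  exists (d k : nat) (G : code L L' d k) (q : 'I_k -> B) (g : A -> 'I_d -> B),
    [/\ functor_conditions alpha beta G q g,
        F None = None,
        (forall m (X : plset alpha beta A m) S E T E',
           small_system alpha beta S -> presents X S E ->
           strans G q g S T -> ptrans2 G q g E E' ->
           exists2 X' : plset alpha beta B (m * d),
             F (pls_some X) = pls_some X' & presents X' T E') &
        (forall m n (X : plset alpha beta A m) (Y : plset alpha beta A n)
           (f : formula_map X Y) phi phi',
           induces phi (sval f) -> ptrans2 G q g phi phi' ->
           exists (X' : plset alpha beta B (m * d))
                  (Y' : plset alpha beta B (n * d)) (f' : formula_map X' Y'),
             induces phi' (sval f') /\
             arrow (fhom F (f : hom (c := PLS alpha beta A)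
                                    (pls_some X) (pls_some Y))) =
             arrow (f' : hom (c := PLS alpha beta B)
                             (pls_some X') (pls_some Y')))].

Definition equivalent_Tr (alpha beta : option Type) (L L' : language)
    (A : structure L) (B : structure L') : Prop :=
  equivalent_relative (@translation_functor alpha beta L L' A B)
                      (@translation_functor alpha beta L' L B A).

(** * Interpretations *)

(* Truth of a formula of a code at the tuples bs and the parameters q. *)
Definition csat (L : language) (M : structure L) (n d k : nat) (q : 'I_k -> M)
    (bs : 'I_n -> 'I_d -> M) (p : formula L (cvar n d k)) : Prop :=
  sat (fun z : cvar n d k => match z with
                             | inl (i, j) => bs i j
                             | inr l => q l
                             end) p.

Definition U_set (L L' : language) (d k : nat) (G : code L L' d k)
    (B : structure L') (q : 'I_k -> B) : set ('I_d -> B) :=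
  [set b | csat q (fun _ => b) (code_U G)].

Definition E_rel (L L' : language) (d k : nat) (G : code L L' d k)
    (B : structure L') (q : 'I_k -> B) (b b' : 'I_d -> B) : Prop :=
  csat q (fcons b (fun _ : 'I_1 => b')) (code_E G).

Definition U_quot (L L' : language) (d k : nat) (G : code L L' d k)
    (B : structure L') (q : 'I_k -> B) : Type := quot (U_set G q) (E_rel G q).

Definition U_cls (L L' : language) (d k : nat) (G : code L L' d k)
    (B : structure L') (q : 'I_k -> B) (b : 'I_d -> B) (Ub : U_set G q b) :
    U_quot G q := cls (E_rel G q) Ub.

(* G(B, q) is well-defined; the element, operations and relations on the
   quotient are uniquely determined by the other fields. *)
Record well_defined (L L' : language) (d k : nat) (G : code L L' d k)
    (B : structure L') (q : 'I_k -> B) : Type := WellDefined {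
  wd_U : U_set G q !=set0;
  wd_E : equivalence_on (U_set G q) (E_rel G q);
  wd_c : const_sym L -> U_quot G q;
  wd_cP : forall c b (Ub : U_set G q b),
    csat q (fun _ => b) (code_c G c) <-> U_cls Ub = wd_c c;
  wd_f : forall f : fun_sym L, ('I_(fun_arity f) -> U_quot G q) -> U_quot G q;
  wd_fP : forall (f : fun_sym L) b (bs : 'I_(fun_arity f) -> 'I_d -> B)
      (Ub : U_set G q b) (Ubs : forall i, U_set G q (bs i)),
    csat q (fcons b bs) (code_f G f) <->
    U_cls Ub = wd_f (fun i => U_cls (Ubs i));
  wd_R : forall R : pred_sym L, ('I_(pred_arity R) -> U_quot G q) -> Prop;
  wd_RP : forall (R : pred_sym L) (bs : 'I_(pred_arity R) -> 'I_d -> B)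
      (Ubs : forall i, U_set G q (bs i)),
    csat q bs (code_R G R) <-> wd_R (fun i => U_cls (Ubs i)) }.

Lemma U_quot_inh (L L' : language) (d k : nat) (G : code L L' d k)
    (B : structure L') (q : 'I_k -> B) :
  well_defined G q -> inhabited (U_quot G q).
Proof. by move=> w; have [b Ub] := wd_U w; split; exact: (U_cls Ub). Qed.

Definition interpreted (L L' : language) (d k : nat) (G : code L L' d k)
    (B : structure L') (q : 'I_k -> B) (w : well_defined G q) : structure L :=
  @Structure L (U_quot G q) (U_quot_inh w) (wd_c w) (wd_f w) (wd_R w).

Definition isomorphism (L : language) (M N : structure L) (h : M -> N) :
    Prop :=
  [/\ bijective h,
      forall c, h (cint M c) = cint N c,
      forall (f : fun_sym L) (xs : 'I_(fun_arity f) -> M),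
        h (fint xs) = fint (fun i => h (xs i)) &
      forall (R : pred_sym L) (xs : 'I_(pred_arity R) -> M),
        pint xs <-> pint (fun i => h (xs i))].

(* Only the restriction of the coordinate map [it_map] to U matters; [it_bar]
   is the induced map on the quotient. *)
Record interpretation (L L' : language) (A : structure L) (B : structure L')
    (d k : nat) := Interpretation {
  it_code : code L L' d k;
  it_par : 'I_k -> B;
  it_wd : well_defined it_code it_par;
  it_map : ('I_d -> B) -> A;
  it_surj : set_surj (U_set it_code it_par) [set: A] it_map;
  it_bar : interpreted it_wd -> A;
  it_barP : forall b (Ub : U_set it_code it_par b),
    it_bar (U_cls Ub) = it_map b;
  it_iso : isomorphism it_bar }.

Definition strongly_homotopic (L L' : language) (A : structure L)
    (B : structure L') (d1 k1 d2 k2 : nat) (I1 : interpretation A B d1 k1)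
    (I2 : interpretation A B d2 k2) : Prop :=
  exists lambda : interpreted (it_wd I1) -> interpreted (it_wd I2),
    [/\ isomorphism lambda,
        definable [set v : 'I_(d1 + d2) -> B |
          exists (U1 : U_set (it_code I1) (it_par I1)
                         (fun i => v (lshift d2 i)))
                 (U2 : U_set (it_code I2) (it_par I2)
                         (fun j => v (rshift d1 j))),
            lambda (U_cls U1) = U_cls U2] &
        forall x, it_bar (i := I1) x = it_bar (i := I2) (lambda x)].

(** * Composition *)

Definition reindex (n d k d' k' : nat) (z : cvar n d k * 'I_d' + 'I_k') :
    cvar n (d * d') (k * d' + k') :=
  match z with
  | inl (inl (i, j), j') => inl (i, flat (j, j'))
  | inl (inr l, j') => inr (lshift k' (flat (l, j')))
  | inr l' => inr (rshift (k * d') l')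
  end.

(* [p'] is the D-translation of the formula p of a code, for some normal form
   of p. *)
Definition ctranslation (L L' : language) (d' k' : nat) (D : code L L' d' k')
    (n d k : nat) (p : formula L (cvar n d k))
    (p' : formula L' (cvar n (d * d') (k * d' + k'))) : Prop :=
  exists2 m : fo (unnested L) (cvar n d k), normal_form_of p m &
    p' = rename (@reindex n d k d' k')
           (translation D (enum (('I_n * 'I_d + 'I_k)%type : finType)) m).

Definition code_composition (L L' L'' : language) (d k d' k' : nat)
    (G : code L L' d k) (D : code L' L'' d' k')
    (GD : code L L'' (d * d') (k * d' + k')) : Prop :=
  [/\ ctranslation D (code_U G) (code_U GD),
      ctranslation D (code_E G) (code_E GD),
      forall c, ctranslation D (code_c G c) (code_c GD c),
      forall f, ctranslation D (code_f G f) (code_f GD f) &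
      forall R, ctranslation D (code_R G R) (code_R GD R)].

(* J is a composition of I and I'; ps is the chosen preimage of the parameters
   of I. *)
Definition composition (L L' L'' : language) (A : structure L)
    (B : structure L') (C : structure L'') (d k d' k' : nat)
    (I : interpretation A B d k) (I' : interpretation B C d' k')
    (J : interpretation A C (d * d') (k * d' + k')) : Prop :=
  [/\ code_composition (it_code I) (it_code I') (it_code J),
      (exists ps : 'I_k -> 'I_d' -> C,
        [/\ forall l, U_set (it_code I') (it_par I') (ps l),
            forall l, it_map I' (ps l) = it_par I l,
            forall l j, it_par J (lshift k' (flat (l, j))) = ps l j &
            forall l', it_par J (rshift (k * d') l') = it_par I' l']) &
      forall v, U_set (it_code J) (it_par J) v ->
        it_map J v =
        it_map I (fun j => it_map I' (fun j' => v (flat (j, j'))))].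

(** * The identical interpretation *)

Definition idvar (n : nat) (i : 'I_n) : cvar n 1 0 := inl (i, ord0).

Definition id_code (L : language) : code L L 1 0 :=
  {| code_U := Atom (Eq (Var (idvar ord0)) (Var (idvar ord0)));
     code_E := Atom (Eq (Var (idvar ord0)) (Var (idvar ord_max)));
     code_c := fun c => Atom (Eq (Var (idvar ord0)) (Cst c));
     code_f := fun f =>
       Atom (Eq (App f (fun i => Var (idvar (lift ord0 i))))
                (Var (idvar ord0)));
     code_R := fun R => Atom (Pred R (fun i => Var (idvar i))) |}.

Definition id_par (M : Type) : 'I_0 -> M := @from_ord0 M.

Definition id_map (M : Type) (b : 'I_1 -> M) : M := b ord0.

Section IdInterpretation.
Variables (L : language) (A : structure L).

Let U := U_set (id_code L) (id_par A).
Let E := E_rel (id_code L) (id_par A).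

Lemma id_U (b : 'I_1 -> A) : U b.
Proof. by []. Qed.

Lemma id_E (b b' : 'I_1 -> A) : E b b' <-> b = b'.
Proof.
rewrite /E /E_rel /csat /= /fcons unlift_none.
have -> : @ord_max 1 = lift ord0 ord0 by apply: val_inj.
rewrite liftK; split=> [e|->//].
by apply: funext => i; rewrite (ord1 i).
Qed.

Lemma id_equiv : equivalence_on U E.
Proof.
split=> [a _|a b _ _|a b c _ _ _]; rewrite !id_E //.
by move=> -> ->.
Qed.

Definition id_cls (a : A) : U_quot (id_code L) (id_par A) :=
  U_cls (id_U (fun _ => a)).

Definition id_bar (c : U_quot (id_code L) (id_par A)) : A :=
  id_map (sval (cid2 (svalP c))).

Lemma id_barP b (Ub : U b) : id_bar (U_cls Ub) = id_map b.
Proof.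
rewrite /id_bar; case: cid2 => /= a Ua e.
have : [set c | U c /\ E b c] b by split=> //; apply/id_E.
by rewrite [X in X b]e => -[_ /id_E ->].
Qed.

Lemma id_clsK : cancel id_cls id_bar.
Proof. by move=> a; rewrite id_barP. Qed.

Lemma id_U_cls b (Ub : U b) : U_cls Ub = id_cls (id_map b).
Proof.
apply/(clsP id_equiv)/id_E; apply: funext => i; by rewrite (ord1 i).
Qed.

Lemma id_barK : cancel id_bar id_cls.
Proof. by elim/quot_ind => b Ub; rewrite -/(U_cls Ub) id_barP id_U_cls. Qed.

Lemma id_cls_eq b (Ub : U b) a : U_cls Ub = id_cls a <-> id_map b = a.
Proof.
split=> [/(congr1 id_bar)|<-]; last exact: id_U_cls.
by rewrite id_barP id_clsK.
Qed.

Lemma id_wd_U : U !=set0.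
Proof. by have [a] := carrier_inh A; exists (fun _ => a). Qed.

Lemma id_wd_c c b (Ub : U b) :
  csat (id_par A) (fun _ => b) (code_c (id_code L) c) <->
  U_cls Ub = id_cls (cint A c).
Proof. by rewrite id_cls_eq. Qed.

Lemma id_wd_f (f : fun_sym L) b (bs : 'I_(fun_arity f) -> 'I_1 -> A) (Ub : U b)
    (Ubs : forall i, U (bs i)) :
  csat (id_par A) (fcons b bs) (code_f (id_code L) f) <->
  U_cls Ub = id_cls (fint (fun i => id_bar (U_cls (Ubs i)))).
Proof.
rewrite id_cls_eq /csat /= /fcons unlift_none.
have -> : (fun i => (if unlift ord0 (lift ord0 i) is Some j then bs j else b)
             ord0) = (fun i => id_bar (U_cls (Ubs i))).
  by apply: funext => i; rewrite liftK id_barP.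
by split; move/esym.
Qed.

Lemma id_wd_R (R : pred_sym L) (bs : 'I_(pred_arity R) -> 'I_1 -> A)
    (Ubs : forall i, U (bs i)) :
  csat (id_par A) bs (code_R (id_code L) R) <->
  pint (fun i => id_bar (U_cls (Ubs i))).
Proof.
rewrite /csat /=.
have -> : (fun i => bs i ord0) = (fun i => id_bar (U_cls (Ubs i))).
  by apply: funext => i; rewrite id_barP.
by [].
Qed.

Definition id_wd : well_defined (id_code L) (id_par A) :=
  WellDefined (wd_f := fun f xs => id_cls (fint (fun i => id_bar (xs i))))
    (wd_R := fun R xs => pint (fun i => id_bar (xs i)))
    id_wd_U id_equiv id_wd_c id_wd_f id_wd_R.

Lemma id_surj : set_surj U [set: A] (@id_map A).
Proof. by move=> a _; exists (fun _ => a). Qed.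

Lemma id_iso : @isomorphism L (interpreted id_wd) A id_bar.
Proof.
split=> [|c|f xs|R xs] //; last 2 first.
- exact: id_clsK.
- exact: id_clsK.
by exists id_cls; [exact: id_barK|exact: id_clsK].
Qed.

Definition id_interpretation : interpretation A A 1 0 :=
  Interpretation (it_wd := id_wd) id_surj id_barP id_iso.

End IdInterpretation.

Definition strongly_bi_interpretable (L L' : language) (A : structure L)
    (B : structure L') : Prop :=
  exists (d k d' k' : nat) (I : interpretation A B d k)
         (I' : interpretation B A d' k'),
    (exists2 J, composition I I' J &
       strongly_homotopic J (id_interpretation A)) /\
    (exists2 J', composition I' I J' &
       strongly_homotopic J' (id_interpretation B)).

(* Main.v *)
Require Import Defs.
From Stdlib Require List Eqdep_dec.
From mathcomp Require Import all_boot.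
From mathcomp Require Import matrix.
From mathcomp Require Import boolp classical_sets functions cardinality.

(** A strong bi-interpretation and an equivalence by translation functors are
    two descriptions of the same data: a code, its parameters, a coordinate map
    [mu] onto the interpreted structure and a section [g] of [mu].  The record
    [coordinates] isolates these data, without the quotient structure of an
    interpretation.  All statements are proved for arbitrary infinite bounds
    (or no bound) on the numbers of formulas and of parameters, so that the
    three parts of the theorem are instances of one equivalence.

    From interpretations to functors.  As [mu] is onto, relativized quantifiers
    range over the whole of [A], and so the translation of a formula holds at
    some tuples exactly when these are coordinates of elements that satisfy the
    formula ([sat_tr], [psat_ptranslation]).  Hence translating a logical set,
    a formula equivalence or a formula map is the same as pulling it back along
    [mu] ([V_strans], [psat2_ptrans2]), whatever the normal forms are.  The
    conditions on translation functors become formal properties of inverse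
    images ([pull_functor_conditions]); the bounds are respected because adding
    finitely many parameters and taking coordinates does not increase an
    infinite cardinal ([below_coordinates]).  Going to [B] and back pulls a set
    back along the composite coordinate map [mu] o [nu].  Strong homotopy with
    the identity says that this map is definable ([homotopic_id]), and then
    it induces isomorphisms, natural because they all come from one map of
    underlying elements ([pull_natural_isomorphism]).

    From functors to interpretations.  Since parameters are allowed, the
    elements of [A] are the arrows from a one-point object to the object [A],
    and a translation functor sends the arrow of [a] to the class of [g a].  An
    equivalence is full, so that the classes of the elements [g a] are all the
    elements of the would-be interpreted structure
    ([image_of_parameters_exhausts]).  An open formula that is valid in [A] has
    the same solutions as a trivial one; so have their translations, and this
    transfers enough of the theory of [A] to show that every symbol is
    translated correctly at all coordinates ([transfer], [translated_atom]).
    Sending each tuple to the unique [a] with [g a] in its class is therefore a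
    coordinate map ([extracted_coordinates]).  Finally, naturality with respect
    to the points of [A] leaves only one possibility for the component at [A]
    of the isomorphism between the composite functor and the identity: it is
    the composite coordinate map ([component_at_line]).  As arrows are given by
    formulas, that map is definable ([composite_definable]), which is the
    strong homotopy that was wanted. *)

Set Implicit Arguments.
Unset Strict Implicit.
Unset Printing Implicit Defensive.

Local Open Scope classical_set_scope.

(** * Variables and renamings *)

Lemma In_mem (T : eqType) (s : seq T) (x : T) : List.In x s <-> x \in s.
Proof.
elim: s => //= y s ->; rewrite inE; split=> [[->|->]|/orP[/eqP->|]];
  rewrite ?eqxx ?orbT; by [left|right|].
Qed.

Lemma In_flatten (I T : Type) (f : I -> seq T) (s : seq I) (x : T) :
  List.In x (flatten [seq f i | i <- s]) <->
  exists2 i, List.In i s & List.In x (f i).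
Proof.
elim: s => /= [|i s IH]; first by split=> // -[].
rewrite List.in_app_iff IH; split=> [[?|[j ??]]|[j [->|?] ?]].
- by exists i => //; left.
- by exists j => //; right.
- by left.
- by right; exists j.
Qed.

Lemma In_flatten_enum (I : finType) (T : Type) (f : I -> seq T) (x : T) :
  List.In x (flatten [seq f i | i <- enum I]) <-> exists i, List.In x (f i).
Proof.
rewrite In_flatten; split=> [[i _ ?]|[i ?]]; exists i => //.
by apply/In_mem; rewrite mem_enum.
Qed.

Lemma In_pmap_id (T : Type) (s : seq (option T)) (x : T) :
  List.In x (pmap id s) <-> List.In (Some x) s.
Proof.
elim: s => //= -[y|] s /= IH; last by rewrite IH; split=> [|[]//]; right.
by rewrite IH; split=> -[|?]; [move=>->; left|right|case=>->; left|right].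
Qed.

Section FreeVariables.
Variable L : language.

Lemma tvars_rename (X Y : Type) (r : X -> Y) (t : term L X) y :
  List.In y (tvars (trename r t)) ->
  exists2 x, List.In x (tvars t) & y = r x.
Proof.
elim: t => [x|c|f ts IH] //=.
  by case=> // <-; exists x => //; left.
move/In_flatten_enum => [i /IH[x xi ->]]; exists x => //.
by apply/In_flatten_enum; exists i.
Qed.

Lemma avars_rename (X Y : Type) (r : X -> Y) (a : atomic L X) y :
  List.In y (avars (arename r a)) ->
  exists2 x, List.In x (avars a) & y = r x.
Proof.
case: a => [t t'|R ts] /=.
  rewrite List.in_app_iff => -[] H; have [x xt ->] := tvars_rename H;
    exists x => //; by rewrite List.in_app_iff; auto.
move/In_flatten_enum => [i H]; have [x xi ->] := tvars_rename H.
exists x => //.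
by apply/In_flatten_enum; exists i.
Qed.

Lemma fvars_rename (X : Type) (p : formula L X) :
  forall (Y : Type) (r : X -> Y) y, List.In y (fvars (rename r p)) ->
  exists2 x, List.In x (fvars p) & y = r x.
Proof.
have bound (Z Y : Type) (q : formula L (option Z)) (r : Z -> Y) y :
    (forall y', List.In y' (fvars (rename (omap r) q)) ->
       exists2 x, List.In x (fvars q) & y' = omap r x) ->
    List.In y (pmap id (fvars (rename (omap r) q))) ->
    exists2 x, List.In x (pmap id (fvars q)) & y = r x.
  move=> IH /In_pmap_id /IH[[x|] // xq [->]].
  by exists x => //; apply/In_pmap_id.
elim: p => {X} [X a|X p IH|X p IHp q IHq|X p IHp q IHq|X p IH|X p IH] Y r y /=.
- exact: avars_rename.
- exact: IH.
- rewrite List.in_app_iff => -[] H;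
    [have [x xt ->] := IHp _ _ _ H|have [x xt ->] := IHq _ _ _ H];
    exists x => //; by rewrite List.in_app_iff; auto.
- rewrite List.in_app_iff => -[] H;
    [have [x xt ->] := IHp _ _ _ H|have [x xt ->] := IHq _ _ _ H];
    exists x => //; by rewrite List.in_app_iff; auto.
- by apply: bound => y'; exact: IH.
- by apply: bound => y'; exact: IH.
Qed.

Lemma split_first_inl (X : Type) (n : nat) (z : X + 'I_n.+1) (x : X) :
  split_first z = inl (Some x) -> z = inl x.
Proof. by case: z => [y [->]|i] //=; case: (unlift ord0 i). Qed.

Lemma fvars_Exs (n : nat) : forall (X : Type) (p : formula L (X + 'I_n)) x,
  List.In x (fvars (Exs p)) -> List.In (inl x) (fvars p).
Proof.
elim: n => [|n IH] X p x /=.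
  by move=> H; have [[y|i] yp e] := fvars_rename H; [rewrite e|case: i {yp e}].
move/In_pmap_id => H; have [z zp e] := fvars_rename (IH _ _ _ H).
by rewrite -(split_first_inl (esym e)).
Qed.

Lemma fvars_Alls (n : nat) : forall (X : Type) (p : formula L (X + 'I_n)) x,
  List.In x (fvars (Alls p)) -> List.In (inl x) (fvars p).
Proof.
elim: n => [|n IH] X p x /=.
  by move=> H; have [[y|i] yp e] := fvars_rename H; [rewrite e|case: i {yp e}].
move/In_pmap_id => H; have [z zp e] := fvars_rename (IH _ _ _ H).
by rewrite -(split_first_inl (esym e)).
Qed.

Lemma sat_Alls_not_Exs (M : structure L) (n : nat) :
  forall (X : Type) (v : X -> M) (p : formula L (X + 'I_n)),
  sat v (Alls p) <-> ~ sat v (Exs (Neg p)).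
Proof.
elim: n => [|n IH] X v p /=; first by split=> [? []|/contrapT].
split=> [H [a]|H a]; first by have /IH := H a.
by apply/IH => na; apply: H; exists a.
Qed.

Lemma sat_Alls (M : structure L) (n : nat) (X : Type) (v : X -> M)
    (p : formula L (X + 'I_n)) :
  sat v (Alls p) <->
  forall b : 'I_n -> M,
    sat (fun x => match x with inl y => v y | inr i => b i end) p.
Proof.
rewrite sat_Alls_not_Exs sat_Exs.
split=> [H b|H [b]]; last by move=> /(_ (H b)).
by apply: contrapT => nb; apply: H; exists b.
Qed.

Lemma sat_ext (M : structure L) (X : Type) (v w : X -> M) (p : formula L X) :
  v =1 w -> sat v p <-> sat w p.
Proof. by move/funext->. Qed.

(** * Normal forms *)

(** The second clause is what allows a normal form to be translated with the
    parameters of the original formula. *)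
Definition expresses (X : Type) (n : fo (unnested L) X) (p : formula L X) :
    Prop :=
  logeq p (embed n) /\
  forall x, List.In x (fvars (embed n)) -> List.In x (fvars p).

Lemma expresses_refl (X : Type) (n : fo (unnested L) X) :
  expresses n (embed n).
Proof. by []. Qed.

Lemma expresses_trans (X : Type) (n m : fo (unnested L) X) (p : formula L X) :
  expresses n (embed m) -> expresses m p -> expresses n p.
Proof.
move=> [nm1 nm2] [mp1 mp2]; split=> [M v|x /nm2/mp2//].
by rewrite mp1 nm1.
Qed.

Lemma expresses_Neg (X : Type) (n : fo (unnested L) X) (p : formula L X) :
  expresses n p -> expresses (Neg n) (Neg p).
Proof. by move=> [e v]; split=> // M w /=; rewrite e. Qed.

Lemma expresses_Conj (X : Type) (n m : fo (unnested L) X)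
    (p q : formula L X) :
  expresses n p -> expresses m q -> expresses (Conj n m) (Conj p q).
Proof.
move=> [e v] [e' v']; split=> [M w|x] /=; first by rewrite e e'.
by rewrite !List.in_app_iff => -[H|H]; [left; exact: v|right; exact: v'].
Qed.

Lemma expresses_Disj (X : Type) (n m : fo (unnested L) X)
    (p q : formula L X) :
  expresses n p -> expresses m q -> expresses (Disj n m) (Disj p q).
Proof.
move=> [e v] [e' v']; split=> [M w|x] /=; first by rewrite e e'.
by rewrite !List.in_app_iff => -[H|H]; [left; exact: v|right; exact: v'].
Qed.

Lemma expresses_Ex (X : Type) (n : fo (unnested L) (option X))
    (p : formula L (option X)) :
  expresses n p -> expresses (Ex n) (Ex p).
Proof.
move=> [e v]; split=> [M w|x] /=; last by move/In_pmap_id/v/In_pmap_id.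
by split=> -[a /e]; exists a.
Qed.

Lemma expresses_All (X : Type) (n : fo (unnested L) (option X))
    (p : formula L (option X)) :
  expresses n p -> expresses (All n) (All p).
Proof.
move=> [e v]; split=> [M w|x] /=; last by move/In_pmap_id/v/In_pmap_id.
by split=> H a; apply/e.
Qed.

Definition urename (X Y : Type) (r : X -> Y) (u : unnested L X) :
    unnested L Y :=
  match u with
  | UEq x x' => UEq _ (r x) (r x')
  | UCst x c => UCst (r x) c
  | UFun f xs x0 => UFun (fun i => r (xs i)) (r x0)
  | UPred R xs => UPred (fun i => r (xs i))
  end.

Fixpoint nrename (X Y : Type) (r : X -> Y) (p : fo (unnested L) X) :
    fo (unnested L) Y :=
  match p with
  | Atom u => Atom (urename r u)
  | Neg p => Neg (nrename r p)
  | Conj p q => Conj (nrename r p) (nrename r q)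
  | Disj p q => Disj (nrename r p) (nrename r q)
  | Ex p => Ex (nrename (omap r) p)
  | All p => All (nrename (omap r) p)
  end.

Lemma embed_nrename (X : Type) (p : fo (unnested L) X) :
  forall (Y : Type) (r : X -> Y), embed (nrename r p) = rename r (embed p).
Proof.
elim: p => {X} [X u|X p IH|X p IHp q IHq|X p IHp q IHq|X p IH|X p IH] Y r /=;
  [by case: u|by rewrite IH|by rewrite IHp IHq|by rewrite IHp IHq|
   by rewrite IH|by rewrite IH].
Qed.

Lemma sat_nrename (M : structure L) (X Y : Type) (r : X -> Y) (v : Y -> M)
    (p : fo (unnested L) X) :
  sat v (embed (nrename r p)) = sat (fun x => v (r x)) (embed p).
Proof. by rewrite embed_nrename sat_rename. Qed.

Lemma fvars_nrename (X Y : Type) (r : X -> Y) (p : fo (unnested L) X) y :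
  List.In y (fvars (embed (nrename r p))) ->
  exists2 x, List.In x (fvars (embed p)) & y = r x.
Proof. by rewrite embed_nrename; exact: fvars_rename. Qed.

Fixpoint is_qf (X : Type) (p : fo (unnested L) X) : bool :=
  match p with
  | Atom _ => true
  | Neg p => is_qf p
  | Conj p q => is_qf p && is_qf q
  | Disj p q => is_qf p && is_qf q
  | _ => false
  end.

Fixpoint is_prenex (X : Type) (p : fo (unnested L) X) : bool :=
  match p with
  | Ex p => is_prenex p
  | All p => is_prenex p
  | _ => is_qf p
  end.

Lemma is_qf_nrename (X : Type) (p : fo (unnested L) X) :
  forall (Y : Type) (r : X -> Y), is_qf (nrename r p) = is_qf p.
Proof.
elim: p => {X} [X u|X p IH|X p IHp q IHq|X p IHp q IHq|X p IH|X p IH] Y r //=;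
  by rewrite IHp IHq.
Qed.

Lemma is_prenex_nrename (X : Type) (p : fo (unnested L) X) :
  forall (Y : Type) (r : X -> Y), is_prenex (nrename r p) = is_prenex p.
Proof.
elim: p => {X} [X u|X p IH|X p IHp q IHq|X p IHp q IHq|X p IH|X p IH] Y r //=;
  by rewrite !is_qf_nrename.
Qed.

Lemma prenex_Neg (X : Type) (p : fo (unnested L) X) :
  is_prenex p ->
  exists2 n, is_prenex n & expresses n (embed (Neg p)).
Proof.
elim: p => {X} [X a|X p _|X p _ q _|X p _ q _|X p IH|X p IH] Hp;
  try by eexists; last exact: expresses_refl.
- have [n Hn en] := IH Hp; exists (All n) => //.
  apply: (expresses_trans (m := All (Neg p)) (expresses_All en)).
  split=> // M v /=.
  by split=> [H a ?|H [a]]; [apply: H; exists a|exact: H].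
- have [n Hn en] := IH Hp; exists (Ex n) => //.
  apply: (expresses_trans (m := Ex (Neg p)) (expresses_Ex en)).
  split=> // M v /=.
  by split=> [/existsNP|[a na] H]; [|exact: na (H a)].
Qed.


(** Weakening [q] to [option X] is what lets a quantifier of [p] be moved in
    front of the conjunction. *)
Lemma expresses_Conj_ExL (X : Type) (p : fo (unnested L) (option X))
    (q : fo (unnested L) X) :
  expresses (Ex (Conj p (nrename Some q))) (embed (Conj (Ex p) q)).
Proof.
split=> [M v|x] /=.
  split=> [[[a pa] qv]|[a [pa]]].
    by exists a; split=> //; rewrite sat_nrename.
  by rewrite sat_nrename => qv; split=> //; exists a.
rewrite In_pmap_id !List.in_app_iff In_pmap_id => -[|H]; first by left.
by right; have [y yq [->]] := fvars_nrename H.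
Qed.

Lemma expresses_Conj_AllL (X : Type) (p : fo (unnested L) (option X))
    (q : fo (unnested L) X) :
  expresses (All (Conj p (nrename Some q))) (embed (Conj (All p) q)).
Proof.
split=> [M v|x] /=.
  split=> [[pa qv] a|H]; first by split=> //; rewrite sat_nrename.
  split=> [a|]; first by have [] := H a.
  by have [a] := carrier_inh M; have [_] := H a; rewrite sat_nrename.
rewrite In_pmap_id !List.in_app_iff In_pmap_id => -[|H]; first by left.
by right; have [y yq [->]] := fvars_nrename H.
Qed.

Lemma expresses_ConjC (X : Type) (p q : fo (unnested L) X) :
  expresses (Conj q p) (embed (Conj p q)).
Proof.
split=> [M v|x] /=; first by split=> -[].
by rewrite !List.in_app_iff => -[]; [right|left].
Qed.

Lemma prenex_Conj (X : Type) (p q : fo (unnested L) X) :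
  is_prenex p -> is_prenex q ->
  exists2 n, is_prenex n & expresses n (embed (Conj p q)).
Proof.
(* If [q] has no quantifiers, those of [p] can be moved out.  In general the
   quantifiers of [p] are moved out first, and the factors are exchanged when
   [p] has none left. *)
have qfl : forall (X : Type) (p q : fo (unnested L) X),
    is_prenex p -> is_qf q ->
    exists2 n, is_prenex n & expresses n (embed (Conj p q)).
  move=> {X p q} X p; elim: p => {X} [X a|X p _|X p _ p' _|X p _ p' _|
    X p IH|X p IH] q Hp Hq;
    try by eexists; last exact: expresses_refl; rewrite /= Hq ?andbT.
  - have Hq' : is_qf (nrename Some q) by rewrite is_qf_nrename.
    have [n Hn en] := IH (nrename Some q) Hp Hq'.
    exists (Ex n) => //.
    exact: (expresses_trans (m := Ex (Conj _ _)) (expresses_Ex en)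
      (expresses_Conj_ExL _ _)).
  - have Hq' : is_qf (nrename Some q) by rewrite is_qf_nrename.
    have [n Hn en] := IH (nrename Some q) Hp Hq'.
    exists (All n) => //.
    exact: (expresses_trans (m := All (Conj _ _)) (expresses_All en)
      (expresses_Conj_AllL _ _)).
elim: p q => {X} [X a|X p _|X p _ p' _|X p _ p' _|X p IH|X p IH] q Hp Hq;
  try by have [n Hn en] := qfl _ q _ Hq Hp; exists n => //;
    exact: (expresses_trans en (expresses_ConjC _ _)).
- have Hq' : is_prenex (nrename Some q) by rewrite is_prenex_nrename.
  have [n Hn en] := IH (nrename Some q) Hp Hq'.
  exists (Ex n) => //.
  exact: (expresses_trans (m := Ex (Conj _ _)) (expresses_Ex en)
      (expresses_Conj_ExL _ _)).
- have Hq' : is_prenex (nrename Some q) by rewrite is_prenex_nrename.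
  have [n Hn en] := IH (nrename Some q) Hp Hq'.
  exists (All n) => //.
  exact: (expresses_trans (m := All (Conj _ _)) (expresses_All en)
      (expresses_Conj_AllL _ _)).
Qed.

Lemma prenex_form (X : Type) (p : fo (unnested L) X) :
  exists2 n, is_prenex n & expresses n (embed p).
Proof.
have conj (Y : Type) (q r : fo (unnested L) Y) :
    (exists2 n, is_prenex n & expresses n (embed q)) ->
    (exists2 n, is_prenex n & expresses n (embed r)) ->
    exists2 n, is_prenex n & expresses n (embed (Conj q r)).
  move=> [n Hn en] [m Hm em].
  have [s Hs es] := prenex_Conj Hn Hm; exists s => //.
  exact: (expresses_trans es (expresses_Conj en em)).
have neg (Y : Type) (q : fo (unnested L) Y) :
    (exists2 n, is_prenex n & expresses n (embed q)) ->
    exists2 n, is_prenex n & expresses n (embed (Neg q)).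
  move=> [n Hn en].
  have [s Hs es] := prenex_Neg Hn; exists s => //.
  exact: (expresses_trans es (expresses_Neg en)).
elim: p => {X} [X a|X p IH|X p IHp q IHq|X p IHp q IHq|X p IH|X p IH].
- by exists (Atom a).
- exact: neg.
- exact: conj.
- have [s Hs es] := neg _ _ (conj _ _ _ (neg _ _ IHp) (neg _ _ IHq)).
  exists s => //; apply: (expresses_trans es); split=> // M v /=.
  split=> [[H|H] []//|H]; apply: contrapT => nH; apply: H.
  by split=> H; apply: nH; [left|right].
- by have [n Hn en] := IH; exists (Ex n) => //; exact: expresses_Ex.
- by have [n Hn en] := IH; exists (All n) => //; exact: expresses_All.
Qed.

Lemma dnf_Disj (X : Type) (p q : fo (unnested L) X) :
  is_dnf p -> is_dnf q -> is_dnf (Disj p q).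
Proof. by move=> /= -> ->. Qed.

(** Distributivity, one factor at a time. *)
Lemma dnf_Conj (X : Type) (p q : fo (unnested L) X) :
  is_dnf p -> is_dnf q ->
  exists2 n, is_dnf n & expresses n (embed (Conj p q)).
Proof.
have two (Y : Type) (n m : fo (unnested L) Y) (r : formula L Y) :
    is_dnf n -> is_dnf m -> expresses (Disj n m) r ->
    exists2 n', is_dnf n' & expresses n' r.
  by move=> Hn Hm; exists (Disj n m) => //; exact: dnf_Disj.
have conjl : forall (Y : Type) (d c : fo (unnested L) Y),
    is_conjunction c -> is_dnf d ->
    exists2 n, is_dnf n & expresses n (embed (Conj c d)).
  move=> Y d; elim: d => {Y} [Y a|Y d IH|Y d IHd e IHe|Y d IHd e IHe|
    Y d IH|Y d IH] c Hc //= Hd.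
  - by exists (Conj c (Atom a)) => //=; rewrite Hc.
  - by exists (Conj c (Neg d)) => //=; rewrite Hc; case: d {IH} Hd.
  - exists (Conj c (Conj d e)) => //=; rewrite Hc /=.
    by move: Hd; rewrite orbF => ->.
  - have /andP[Hd1 He] : is_dnf d && is_dnf e := Hd.
    have [n Hn en] := IHd c Hc Hd1; have [m Hm em] := IHe c Hc He.
    apply: (two _ n m _ Hn Hm (expresses_trans
      (m := Disj (Conj _ _) (Conj _ _)) (expresses_Disj en em) _)).
    split=> [M v|x] /=; first by split=> [[? []]|[[]|[]]]; auto.
    by rewrite !List.in_app_iff; tauto.
elim: p q => {X} [X a|X d IH|X d IHd e IHe|X d IHd e IHe|X d IH|X d IH] q
  Hd Hq //; try by apply: conjl => //; move: Hd; rewrite /= ?orbF.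
have /andP[Hd1 He] : is_dnf d && is_dnf e := Hd.
have [n Hn en] := IHd q Hd1 Hq.
have [m Hm em] := IHe q He Hq.
apply: (two _ n m _ Hn Hm (expresses_trans
  (m := Disj (Conj _ _) (Conj _ _)) (expresses_Disj en em) _)).
split=> [M v|x] /=; first by split=> [[[] ?]|[[]|[]]]; auto.
by rewrite !List.in_app_iff; tauto.
Qed.

(** The negation is treated along with the formula, so that negations can be
    pushed to the atoms. *)
Lemma dnf_form (X : Type) (p : fo (unnested L) X) : is_qf p ->
  (exists2 n, is_dnf n & expresses n (embed p)) /\
  (exists2 n, is_dnf n & expresses n (embed (Neg p))).
Proof.
have conj (q r : fo (unnested L) X) :
    (exists2 n, is_dnf n & expresses n (embed q)) ->
    (exists2 n, is_dnf n & expresses n (embed r)) ->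
    exists2 n, is_dnf n & expresses n (embed (Conj q r)).
  move=> [n Hn en] [m Hm em].
  have [s Hs es] := dnf_Conj Hn Hm; exists s => //.
  exact: (expresses_trans es (expresses_Conj en em)).
have disj (q r : fo (unnested L) X) :
    (exists2 n, is_dnf n & expresses n (embed q)) ->
    (exists2 n, is_dnf n & expresses n (embed r)) ->
    exists2 n, is_dnf n & expresses n (embed (Disj q r)).
  move=> [n Hn en] [m Hm em]; exists (Disj n m); first exact: dnf_Disj.
  exact: expresses_Disj.
elim: p conj disj => {X} [X a|X p IH|X p IHp q IHq|X p IHp q IHq|X p IH|X p IH]
  conj disj //=.
- by move=> _; split; [exists (Atom a)|exists (Neg (Atom a))].
- move=> Hp; have [[n Hn en] np] := IH conj disj Hp; split=> //.
  exists n => //; apply: (expresses_trans en); split=> // M v /=.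
  by split=> [/contrapT|? []].
- move=> /andP[/(IHp conj disj)[p1 p2] /(IHq conj disj)[q1 q2]].
  split; first exact: conj.
  have [n Hn en] := disj _ _ p2 q2; exists n => //.
  by apply: (expresses_trans en); split=> // M v /=; rewrite not_andP.
- move=> /andP[/(IHp conj disj)[p1 p2] /(IHq conj disj)[q1 q2]].
  split; first exact: disj.
  have [n Hn en] := conj _ _ p2 q2; exists n => //.
  by apply: (expresses_trans en); split=> // M v /=; rewrite not_orP.
Qed.

Lemma normal_of_prenex (X : Type) (p : fo (unnested L) X) : is_prenex p ->
  exists2 n, is_normal n & expresses n (embed p).
Proof.
have qf (Y : Type) (q : fo (unnested L) Y) : is_qf q ->
    exists2 n, is_normal n & expresses n (embed q).
  move=> /dnf_form[[n Hn en] _]; exists n => //.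
  by case: n Hn {en}.
elim: p => {X} [X a|X p _|X p _ q _|X p _ q _|X p IH|X p IH] Hp;
  try exact: qf.
- by have [n Hn en] := IH Hp; exists (Ex n) => //; exact: expresses_Ex.
- by have [n Hn en] := IH Hp; exists (All n) => //; exact: expresses_All.
Qed.

Definition defines (X : Type) (d : fo (unnested L) (option X)) (t : term L X) :
    Prop :=
  (forall (M : structure L) (v : X -> M) a,
     sat (vcons v a) (embed d) <-> teval v t = a) /\
  (forall x, List.In (Some x) (fvars (embed d)) -> List.In x (tvars t)).

Lemma defines_rename (X Y : Type) (r : X -> Y) d (t : term L X) :
  defines d t -> defines (nrename (omap r) d) (trename r t).
Proof.
move=> [dt dv]; split=> [M v a|y H].
  rewrite sat_nrename teval_rename -dt; apply: sat_ext.
  by case.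
have [[x|] // /dv xt [->]] := fvars_nrename H.
elim: t xt {dt dv H} => [z|c|f ts IH] //=; first by case=> [->|//]; left.
move/In_flatten_enum => [i xi]; apply/In_flatten_enum; exists i; exact: IH.
Qed.

(** Definable terms can be substituted for variables: quantify over their
    values. *)
Lemma substitute (n : nat) : forall (X : Type) (ts : 'I_n -> term L X)
    (p : fo (unnested L) (X + 'I_n)),
  (forall i, exists d, defines d (ts i)) ->
  exists s : fo (unnested L) X,
    (forall (M : structure L) (v : X -> M), sat v (embed s) <->
       sat (fun x => match x with
                     | inl y => v y
                     | inr i => teval v (ts i)
                     end) (embed p)) /\
    (forall x, List.In x (fvars (embed s)) ->
       List.In (inl x) (fvars (embed p)) \/ exists i, List.In x (tvars (ts i))).
Proof.
elim: n => [|n IH] X ts p Hts.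
  exists (nrename (fun x => match x with
                            | inl y => y
                            | inr i => from_ord0 X i
                            end) p); split=> [M v|x H].
    by rewrite sat_nrename; apply: sat_ext => -[|[]].
  by left; have [[y|i] yp e] := fvars_nrename H; [rewrite e|case: i {yp e}].
have [|s [s1 s2]] := IH (option X) (fun i => trename Some (ts (lift ord0 i)))
    (nrename (@split_first X n) p).
  move=> i; have [d /(defines_rename Some)] := Hts (lift ord0 i).
  by exists (nrename (omap Some) d).
have [d [d1 d2]] := Hts ord0.
exists (Ex (Conj d s)); split=> [M v|x] /=.
  have E : sat (vcons v (teval v (ts ord0))) (embed s) <->
      sat (fun x => match x with
                    | inl y => v y
                    | inr i => teval v (ts i)
                    end) (embed p).
    rewrite s1 sat_nrename; apply: sat_ext => -[y|i] //=.
    by case: unliftP => [j ->|->] //=; rewrite teval_rename.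
  split=> [[a [/d1 <-]]|]; first by rewrite E.
  by rewrite -E => H; exists (teval v (ts ord0)); split=> //; apply/d1.
rewrite In_pmap_id List.in_app_iff => -[/d2|/s2[H|[i H]]].
- by right; exists ord0.
- have [z zp e] := fvars_nrename H; left.
  by rewrite -(split_first_inl (esym e)).
- have [z zt [->]] := tvars_rename H; right; by exists (lift ord0 i).
Qed.

Lemma defines_exists (X : Type) (t : term L X) : exists d, defines d t.
Proof.
elim: t => [x|c|f ts IH].
- exists (Atom (UEq _ (Some x) None)); split=> //= y.
  by case=> [[->]|[]//]; left.
- exists (Atom (UCst None c)); split=> [M v a|y [] //] /=.
  by split=> [->|->].
- have [|s [s1 s2]] := substitute (ts := fun i => trename Some (ts i))
    (Atom (UFun (f := f) (fun i => inr i) (inl None))).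
    move=> i; have [d /(defines_rename Some)] := IH i.
    by exists (nrename (omap Some) d).
  exists s; split=> [M v a|x /s2[|[i H]]] /=.
  + rewrite s1 /=.
    have -> : (fun i => teval (vcons v a) (trename Some (ts i))) =
        (fun i => teval v (ts i)).
      by apply: funext => i; rewrite teval_rename.
    by [].
  + rewrite List.in_app_iff => -[/In_flatten_enum[i]|] /=; by case.
  + have [y yt [->]] := tvars_rename H.
    by apply/In_flatten_enum; exists i.
Qed.

Lemma unnest (X : Type) (p : formula L X) : exists n, expresses n p.
Proof.
elim: p => {X} [X [t t'|R ts]|X p [n ?]|X p [n ?] q [m ?]|X p [n ?] q [m ?]|
  X p [n ?]|X p [n ?]].
- have [|s [s1 s2]] := substitute (ts := fcons t (fun _ : 'I_1 => t'))
    (Atom (UEq L (inr ord0) (inr (lift ord0 ord0)))).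
    by move=> i; exact: defines_exists.
  exists s; split=> [M v|x /s2[[|[]]//|[i]]] /=.
    by rewrite s1 /= /fcons unlift_none liftK.
  rewrite /fcons; case: unlift => [_|] H; rewrite List.in_app_iff; auto.
- have [|s [s1 s2]] := substitute (ts := ts)
    (Atom (UPred (R := R) (fun i => inr i))).
    by move=> i; exact: defines_exists.
  exists s; split=> [M v|x /s2[|[i H]]] /=; first by rewrite s1.
    by move/In_flatten_enum => [i []].
  by apply/In_flatten_enum; exists i.
- by exists (Neg n); exact: expresses_Neg.
- by exists (Conj n m); exact: expresses_Conj.
- by exists (Disj n m); exact: expresses_Disj.
- by exists (Ex n); exact: expresses_Ex.
- by exists (All n); exact: expresses_All.
Qed.

(** A formula that is in normal form has no other normal form than itself, so
    the general construction applies to the other formulas only. *)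
Theorem normal_form_exists (X : Type) (p : formula L X) :
  exists n, normal_form_of p n /\
    forall x, List.In x (fvars (embed n)) -> List.In x (fvars p).
Proof.
have [[m Hm <-]|no] :=
  pselect (exists2 m : fo (unnested L) X, is_normal m & embed m = p).
  by exists m; split.
have [u eu] := unnest p.
have [m Hm em] := prenex_form u.
have [n Hn en] := normal_of_prenex Hm.
have [e v] := expresses_trans (expresses_trans en em) eu.
by exists n.
Qed.

End FreeVariables.

(** * Cardinal bounds *)

(** The cardinal equation P x nat = P for infinite P, with the injection made
    explicit.  By Zorn's lemma take a maximal family of injections from nat
    to P with disjoint ranges.  Only finitely many points are missed, and they
    can be absorbed at the odd positions of one member of the family. *)
Lemma infinite_set_absorbs_nat (T : Type) (P : set T) : infinite_set P ->
  exists h : T -> nat -> T, (forall p i, P p -> P (h p i)) /\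
    forall p i p' i', P p -> P p' -> h p i = h p' i' -> p = p' /\ i = i'.
Proof.
elim/Ppointed: T => T in P *.
  by rewrite emptyE => /infinite_setN0[].
move=> infP.
pose good (F : set (nat -> T)) :=
  (forall f, F f -> forall n, P (f n)) /\
  (forall f g, F f -> F g -> forall n m, f n = g m -> f = g /\ n = m).
have [F FF tot|M [[MP Minj] Mmax]] := @Zorn_bigcup (nat -> T) good.
  split=> [f [X FX Xf]|f g [X FX Xf] [Y FY Yg]]; first exact: (FF X FX).1.
  have [XY|YX] := tot X Y FX FY.
    by apply: (FF Y FY).2 => //; exact: XY.
  by apply: (FF X FX).2 => //; exact: YX.
pose R : set T := [set p | P p /\ ~ exists2 f, M f & exists n, f n = p].
have finR : finite_set R.
  apply: contrapT => infR.
  have /pcard_leP/injfunPex[r rR rinj] := (infiniteP R).1 infR.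
  have rn : forall n, R (r n) by move=> n; exact: rR.
  apply: (Mmax (M `|` [set r])).
    split; first by move=> f Mf; left.
    move=> /(_ r (or_intror erefl)) Mr.
    by have [_] := rn 0%N; apply; exists r => //; exists 0%N.
  split=> [f [Mf|->] n|f g [Mf|->] [Mg|->] n m e].
  - exact: MP Mf n.
  - by have [] := rn n.
  - exact: Minj e.
  - by have [_ []] := rn m; exists f => //; exists n.
  - by have [_ []] := rn n; exists g => //; exists m.
  - by split=> //; apply: rinj; rewrite ?in_setE.
have [f0 Mf0] : exists f0, M f0.
  apply: contrapT => noM; apply: infP; apply: sub_finite_set finR => p Pp.
  by split=> // -[f Mf]; case: noM; exists f.
have /(@pcard_injP T nat R)[idx idx_inj] := finite_set_countable finR.
have /choice[j jP] : forall p, exists j : (nat -> T) * nat, P p ->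
    M j.1 /\ ((exists n, j.1 n = p /\ j.2 = n.*2) \/
              (R p /\ j.1 = f0 /\ j.2 = (idx p).*2.+1)).
  move=> p.
  have [[f Mf [n fn]]|no] := pselect (exists2 f, M f & exists n, f n = p).
    by exists (f, n.*2) => _; split=> //=; left; exists n.
  by exists (f0, (idx p).*2.+1) => Pp; split=> //=; right.
(* [j] embeds [P] into the points (f, n) of the family; pairing n with i makes
   room for a second natural number within the range of the same f. *)
exists (fun p i => (j p).1 (pickle ((j p).2, i))); split=> [p i Pp|].
  by apply: MP; have [] := jP p Pp.
move=> p i p' i' Pp Pp' e.
have [Mj Hj] := jP p Pp; have [Mj' Hj'] := jP p' Pp'.
have [ej1 /(pcan_inj pickleK)[ej2 ->]] := Minj _ _ Mj Mj' _ _ e.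
split=> //; case: Hj => [[n [jn en]]|[Rp [_ en]]];
  case: Hj' => [[n' [jn' en']]|[Rp' [_ en']]]; move: ej2; rewrite en en'.
- by move/double_inj => nn'; rewrite -jn -jn' ej1 nn'.
- by move/(congr1 odd); rewrite /= !odd_double.
- by move/(congr1 odd); rewrite /= !odd_double.
- by case=> /double_inj ei; apply: idx_inj; rewrite ?in_setE.
Qed.

Definition admissible (kappa : option Type) : Prop :=
  if kappa is Some K then infinite_set [set: K] else True.

Lemma finite_below (T : Type) (S : set T) (kappa : option Type) :
  admissible kappa -> finite_set S -> below S kappa.
Proof.
case: kappa => //= K infK finS; split.
  apply: card_le_trans ((infiniteP _).1 infK).
  exact: finite_set_countable.
by move=> KS; exact: infK (card_le_finite KS finS).
Qed.

Lemma below_card_le (T U : Type) (S : set T) (S' : set U)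
    (kappa : option Type) :
  (S' #<= S)%card -> below S kappa -> below S' kappa.
Proof.
case: kappa => //= K SS [SK KS]; split; first exact: card_le_trans SK.
by move=> KS'; apply: KS; exact: card_le_trans SS.
Qed.

(** The parameters of a translated system are coordinates of the images of the
    old parameters, and the finitely many parameters of the interpretation. *)
Lemma below_coordinates (T U : Type) (d k : nat) (S : set T) (S' : set U)
    (g : T -> 'I_d -> U) (q : 'I_k -> U) (kappa : option Type) :
  admissible kappa ->
  (forall b, S' b -> (exists2 a, S a & exists j, b = g a j) \/
                     exists l, b = q l) ->
  below S kappa -> below S' kappa.
Proof.
move=> adm sub bS.
pose val (p : T) (z : 'I_d + 'I_k) :=
  match z with inl j => g p j | inr l => q l end.
have [finS|infS] := pselect (finite_set S).
  apply: finite_below => //.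
  apply: (@sub_finite_set _ _ ((fun x => val x.1 x.2) @` (S `*` setT) `|`
                              range q)); last first.
    rewrite finite_setU; split; last exact: finite_image.
    exact/finite_image/finite_setX.
  move=> b /sub[[a Sa [j ->]]|[l ->]]; last by right; exists l.
  by left; exists (a, inl j).
apply: below_card_le bS.
have [h [hS hinj]] := infinite_set_absorbs_nat infS.
have [a0 Sa0] := infinite_setN0 infS.
have /choice[t tP] : forall b, exists t : T, S' b ->
    S t /\ exists a z, [/\ S a, b = val a z & t = h a (pickle z)].
  move=> b; have [S'b|] := pselect (S' b); last by exists a0.
  have [a [z [Sa e]]] : exists a z, S a /\ b = val a z.
    by have [[a Sa [j ->]]|[l ->]] := sub b S'b;
      [exists a, (inl j)|exists a0, (inr l)].
  by exists (h a (pickle z)) => _; split; [exact: hS|exists a, z].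
have tinj : {in S' &, injective t}.
  move=> b b'; rewrite !in_setE => S'b S'b' e.
  have [_ [a [z [Sa eb ta]]]] := tP b S'b.
  have [_ [a' [z' [Sa' eb' ta']]]] := tP b' S'b'.
  move: e; rewrite ta ta' => /(hinj _ _ _ _ Sa Sa')[aa].
  by move/(pcan_inj pickleK) => zz; rewrite eb eb' aa zz.
have /card_eqPle[_ le] := inj_card_eq tinj.
apply: card_le_trans le _; apply: subset_card_le => _ [b S'b <-].
by have [] := tP b S'b.
Qed.

(** * Coordinate maps *)

(** An interpretation without its quotient structure: [mu] is a coordinate map
    onto [A], and the formulas of the code define the preimages under [mu] of
    equality and of the graphs of the symbols. *)
Record coordinates (L L' : language) (A : structure L) (B : structure L')
    (d k : nat) (G : code L L' d k) (q : 'I_k -> B) (mu : ('I_d -> B) -> A)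
    (g : A -> 'I_d -> B) : Prop := Coordinates {
  co_U : forall a, U_set G q (g a);
  co_K : forall a, mu (g a) = a;
  co_E : forall b b', U_set G q b -> U_set G q b' ->
    (E_rel G q b b' <-> mu b = mu b');
  co_c : forall c b, U_set G q b ->
    (csat q (fun _ => b) (code_c G c) <-> mu b = cint A c);
  co_f : forall (f : fun_sym L) b (bs : 'I_(fun_arity f) -> 'I_d -> B),
    U_set G q b -> (forall i, U_set G q (bs i)) ->
    (csat q (fcons b bs) (code_f G f) <-> mu b = fint (fun i => mu (bs i)));
  co_R : forall (R : pred_sym L) (bs : 'I_(pred_arity R) -> 'I_d -> B),
    (forall i, U_set G q (bs i)) ->
    (csat q bs (code_R G R) <-> pint (fun i => mu (bs i))) }.

Lemma fcons_comp (S T : Type) (f : S -> T) (n : nat) (x : S)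
    (xs : 'I_n -> S) :
  (fun i => f (fcons x xs i)) = fcons (f x) (fun i => f (xs i)).
Proof. by apply: funext => i; rewrite /fcons; case: unlift. Qed.

Definition tval (X B : Type) (d k : nat) (w : X -> 'I_d -> B) (q : 'I_k -> B)
    (z : X * 'I_d + 'I_k) : B :=
  match z with inl (x, j) => w x j | inr l => q l end.

Section Translation.
Variables (L L' : language) (d k : nat) (G : code L L' d k).

Lemma sat_plug (B : structure L') (q : 'I_k -> B) (n : nat) (X : Type)
    (w : X -> 'I_d -> B) (xs : 'I_n -> X) (p : formula L' (cvar n d k)) :
  sat (tval w q) (plug xs p) <-> csat q (fun i => w (xs i)) p.
Proof. by rewrite /plug sat_rename; apply: sat_ext => -[[]|]. Qed.

Lemma sat_tr_Ex (B : structure L') (q : 'I_k -> B) (X : Type)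
    (w : X -> 'I_d -> B) (p : fo (unnested L) (option X)) :
  sat (tval w q) (tr G (Ex p)) <->
  exists2 b, U_set G q b & sat (tval (vcons w b) q) (tr G p).
Proof.
have E (b : 'I_d -> B) :
    (fun z => match unbind_tuple z with
              | inl y => tval w q y
              | inr i => b i
              end) = tval (vcons w b) q by apply: funext => -[[[x|] j]|l].
have -> : tr G (Ex p) = Exs (rename (@unbind_tuple X d k)
    (Conj (plug (fun _ => None) (code_U G)) (tr G p))) by [].
rewrite sat_Exs; split=> [[b]|[b Ub pb]].
  by rewrite sat_rename E => -[/sat_plug Ub pb]; exists b.
by exists b; rewrite sat_rename E; split=> //; apply/sat_plug.
Qed.

Lemma sat_tr_All (B : structure L') (q : 'I_k -> B) (X : Type)
    (w : X -> 'I_d -> B) (p : fo (unnested L) (option X)) :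
  sat (tval w q) (tr G (All p)) <->
  forall b, U_set G q b -> sat (tval (vcons w b) q) (tr G p).
Proof.
have E (b : 'I_d -> B) :
    (fun z => match unbind_tuple z with
              | inl y => tval w q y
              | inr i => b i
              end) = tval (vcons w b) q by apply: funext => -[[[x|] j]|l].
have -> : tr G (All p) = Alls (rename (@unbind_tuple X d k)
    (Disj (Neg (plug (fun _ => None) (code_U G))) (tr G p))) by [].
rewrite sat_Alls; split=> [H b Ub|H b].
  have := H b; rewrite sat_rename E => -[nU|//].
  by case: nU; apply/sat_plug.
rewrite sat_rename E; have [Ub|nU] := pselect (U_set G q b).
  by right; exact: H.
by left=> /sat_plug.
Qed.

(** The fundamental property of translations: as every element has
    coordinates, the relativized quantifiers range over the whole of [A]. *)
Lemma sat_tr (A : structure L) (B : structure L') (q : 'I_k -> B)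
    (mu : ('I_d -> B) -> A) (g : A -> 'I_d -> B) (X : Type)
    (p : fo (unnested L) X) :
  coordinates G q mu g ->
  forall w : X -> 'I_d -> B, (forall x, U_set G q (w x)) ->
  sat (tval w q) (tr G p) <-> sat (fun x => mu (w x)) (embed p).
Proof.
move=> co.
have cons (Y : Type) (w : Y -> 'I_d -> B) b : (forall x, U_set G q (w x)) ->
    U_set G q b -> forall x, U_set G q (vcons w b x) by move=> Uw Ub [].
have muE (Y : Type) (w : Y -> 'I_d -> B) b :
    (fun x => mu (vcons w b x)) = vcons (fun x => mu (w x)) (mu b).
  by apply: funext => -[].
elim: p => {X} [X u|X p IH|X p IHp r IHr|X p IHp r IHr|X p IH|X p IH] w Uw.
- case: u => [x x'|x c|f xs x0|R xs].
  + by rewrite sat_plug fcons_comp; exact: (co_E co).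
  + by rewrite sat_plug; exact: (co_c co).
  + rewrite sat_plug fcons_comp.
    by apply: (iff_trans (co_f co _ _)) => //=; split=> ->.
  + by rewrite sat_plug; exact: (co_R co).
- by rewrite /= IH.
- by rewrite /= IHp // IHr.
- by rewrite /= IHp // IHr.
- rewrite sat_tr_Ex; split=> [[b Ub]|[a]].
    by rewrite IH ?muE; [exists (mu b)|exact: cons].
  rewrite -(co_K co a) -muE => H; exists (g a); first exact: co_U co a.
  by rewrite IH //; exact/cons/(co_U co).
- rewrite sat_tr_All; split=> [H a|H b Ub].
    rewrite -(co_K co a) -muE; have Ua := co_U co a.
    by apply/(IH (vcons w (g a))); [exact: cons|exact: H].
  by rewrite IH ?muE; [exact: H|exact: cons].
Qed.

Lemma sat_translation (B : structure L') (q : 'I_k -> B) (X : Type)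
    (w : X -> 'I_d -> B) (xs : seq X) (p : fo (unnested L) X) :
  sat (tval w q) (translation G xs p) <->
  (forall x, List.In x xs -> U_set G q (w x)) /\ sat (tval w q) (tr G p).
Proof.
elim: xs => [|x xs IH] /=; first by split=> [|[]].
rewrite -/(translation G xs p) IH sat_plug.
split=> [[Ux [Uxs H]]|[U H]]; first by split=> // y [<-|/Uxs].
by split; [apply: U; left|split=> // y yx; apply: U; right].
Qed.

Lemma fvars_plug (n : nat) (X : Type) (xs : 'I_n -> X)
    (p : formula L' (cvar n d k)) (x : X) (j : 'I_d) :
  List.In (inl (x, j)) (fvars (plug xs p)) -> exists i, x = xs i.
Proof.
by move=> H; have [[[i j']|l] _ //] := fvars_rename H; case=> -> _; exists i.
Qed.

Lemma fvars_tr (X : Type) (p : fo (unnested L) X) (x : X) (j : 'I_d) :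
  List.In (inl (x, j)) (fvars (tr G p)) -> List.In x (fvars (embed p)).
Proof.
have bound (Y : Type) (r : fo (unnested L) (option Y)) (r' : formula L' _)
    (y : Y) :
    (List.In (inl (Some y, j)) (fvars (tr G r)) ->
       List.In (Some y) (fvars (embed r))) ->
    (forall z, List.In z (fvars r') ->
       List.In z (fvars (plug (fun _ : 'I_1 => None) (code_U G))) \/
       List.In z (fvars (tr G r))) ->
    List.In (inl (inl (y, j))) (fvars (rename (@unbind_tuple Y d k) r')) ->
    List.In y (pmap id (fvars (embed r))).
  move=> IH sub H; apply/In_pmap_id.
  have [[[[z|] j'] zr //|//]] := fvars_rename H.
  move=> -[ez ej]; subst z j'; have [H'|] := sub _ zr; last exact: IH.
  by have [] := fvars_plug H'.
elim: p x => {X} [X u|X p IH|X p IHp r IHr|X p IHp r IHr|X p IH|X p IH] x /=.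
- case: u => [y y'|y c|f ys y0|R ys] /= H;
    have [i ->] := fvars_plug H; rewrite /fcons.
  + by case: unlift => [_|]; [right; left|left].
  + by left.
  + rewrite List.in_app_iff; case: unlift => [i'|]; last by right; left.
    by left; apply/In_flatten_enum; exists i'; left.
  + by apply/In_flatten_enum; exists i; left.
- exact: IH.
- by rewrite !List.in_app_iff => -[H|H]; [left; exact: IHp|right; exact: IHr].
- by rewrite !List.in_app_iff => -[H|H]; [left; exact: IHp|right; exact: IHr].
- move=> H; apply: (bound _ _ (Conj (plug (fun _ => None) (code_U G)) (tr G p))
    _ (IH _) _ (fvars_Exs H)) => z /=.
  by rewrite List.in_app_iff.
- move=> H; apply: (bound _ _
    (Disj (Neg (plug (fun _ => None) (code_U G))) (tr G p))
    _ (IH _) _ (fvars_Alls H)) => z /=.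
  by rewrite List.in_app_iff.
Qed.

Lemma fvars_translation (X : Type) (xs : seq X) (p : fo (unnested L) X)
    (x : X) (j : 'I_d) :
  List.In (inl (x, j)) (fvars (translation G xs p)) ->
  List.In x xs \/ List.In x (fvars (embed p)).
Proof.
elim: xs => [|y xs IH] /=; first by move=> H; right; exact: fvars_tr H.
rewrite List.in_app_iff => -[H|H]; last by case: (IH H); auto.
by have [_ ->] := fvars_plug H; left; left.
Qed.

End Translation.

Lemma In_params_in (X M : Type) (s : seq (X + M)) (a : M) :
  List.In a (params_in s) <-> List.In (inr a) s.
Proof.
elim: s => //= -[x|b] s /= IH; first by rewrite IH; split=> [|[]//]; right.
by rewrite IH; split=> -[|?]; [move=>->; left|right|case=>->; left|right].
Qed.

Section TranslatedFormulas.
Variables (L L' : language) (A : structure L) (B : structure L').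
Variables (d k : nat) (G : code L L' d k) (q : 'I_k -> B) (g : A -> 'I_d -> B).
Variables (X : finType) (Y : Type) (h : X * 'I_d -> Y).

Lemma ptranslation_exists (p : pformula A X) :
  exists p', ptranslation G q g h p p'.
Proof.
have [n [np nv]] := normal_form_exists p.
eexists; exists n; split=> // a; rewrite !In_params_in; exact: nv.
Qed.

(** A normal form may contain parameters only if the original formula does;
    otherwise the number of parameters of a system could grow. *)
Lemma ptranslation_params (p : pformula A X) p' b :
  ptranslation G q g h p p' -> List.In b (params p') ->
  (exists2 a, List.In a (params p) & exists j, b = g a j) \/ exists l, b = q l.
Proof.
move=> [n [_ nv ->]] /In_params_in H.
have [[[[x|a] j]|l] H' //] := fvars_rename H;
  last by case=> ->; right; exists l.
case=> ->; left; exists a; last by exists j.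
have [|] := fvars_translation H'; last by move/In_params_in/nv.
rewrite List.in_app_iff => -[]; first by move/List.in_map_iff => -[? []].
by move/List.in_map_iff => [a' [[<-]]].
Qed.

Definition wblock (v : Y -> B) (z : X + A) : 'I_d -> B :=
  match z with inl x => fun j => v (h (x, j)) | inr a => g a end.

Lemma psat_ptranslation_raw (p : pformula A X) (n : fo (unnested L) (X + A))
    (v : Y -> B) :
  psat v (rename (fun z => match z with
                           | inl (inl x, j) => inl (h (x, j))
                           | inl (inr a, j) => inr (g a j)
                           | inr l => inr (q l)
                           end)
            (translation G (map inl (enum X) ++ map inr (params p)) n)) <->
  [/\ forall x : X, U_set G q (fun j => v (h (x, j))),
      forall a, List.In a (params p) -> U_set G q (g a) &
      sat (tval (wblock v) q) (tr G n)].
Proof.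
rewrite /psat sat_rename.
have -> : (fun x : (X + A) * 'I_d + 'I_k =>
    match match x with
          | inl (inl x0, j) => inl (h (x0, j))
          | inl (inr a, j) => inr (g a j)
          | inr l => inr (q l)
          end with
    | inl y => v y
    | inr a => a
    end) = tval (wblock v) q by apply: funext => -[[[x|a] j]|l].
rewrite sat_translation; split=> [[U H]|[Ux Ua H]].
  split=> // [x|a pa].
    apply: (U (inl x)); rewrite List.in_app_iff; left; apply/List.in_map_iff.
    by exists x; split=> //; apply/In_mem; rewrite mem_enum.
  apply: (U (inr a)); rewrite List.in_app_iff; right; apply/List.in_map_iff.
  by exists a.
split=> // z; rewrite List.in_app_iff => -[] /List.in_map_iff[y [<- Hy]];
  [exact: Ux|exact: Ua].
Qed.

Lemma psat_ptranslation (mu : ('I_d -> B) -> A) (p : pformula A X) p'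
    (v : Y -> B) :
  coordinates G q mu g -> ptranslation G q g h p p' ->
  psat v p' <-> (forall x : X, U_set G q (fun j => v (h (x, j)))) /\
                psat (fun x => mu (fun j => v (h (x, j)))) p.
Proof.
move=> co [n [[_ np _] _ ->]]; rewrite psat_ptranslation_raw.
have E : (forall x : X, U_set G q (fun j => v (h (x, j)))) ->
    sat (tval (wblock v) q) (tr G n) <->
    psat (fun x => mu (fun j => v (h (x, j)))) p.
  move=> Ux; rewrite (sat_tr n co); last by case=> // a; exact: co_U co a.
  by rewrite /psat np; apply: sat_ext => -[x|a] //=; exact: co_K co a.
split=> [[Ux _ /(E Ux)]|[Ux /(E Ux)]] //.
by split=> // a _; exact: co_U co a.
Qed.

End TranslatedFormulas.

Section CoordinatesOfInterpretation.
Variables (L L' : language) (A : structure L) (B : structure L') (d k : nat).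

Lemma interpretation_coordinates (I : interpretation A B d k) :
  exists g, coordinates (it_code I) (it_par I) (it_map I) g.
Proof.
case: I => G q w mu surj bar barP [bij barc barf barR] /=.
have inj := bij_inj bij.
have /choice[g gP] : forall a, exists b, U_set G q b /\ mu b = a.
  by move=> a; have [b Ub <-] := surj a I; exists b.
exists g; split=> [a|a|b b' Ub Ub'|c b Ub|f b bs Ub Ubs|R bs Ubs].
- by have [] := gP a.
- by have [] := gP a.
- rewrite -(clsP (wd_E w) Ub Ub') -!barP.
  by split=> [e|/inj//]; congr (bar _).
- by rewrite (wd_cP w c Ub) -barP -barc; split=> [->|/inj].
- rewrite (wd_fP w Ub Ubs) -barP.
  have -> : (fun i => mu (bs i)) = (fun i => bar (U_cls (Ubs i))).
    by apply: funext => i; rewrite barP.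
  by rewrite -barf; split=> [->|/inj].
- rewrite (wd_RP w Ubs).
  apply: (iff_trans (barR R (fun i => U_cls (Ubs i)))).
  have -> : (fun i => mu (bs i)) = (fun i => bar (U_cls (Ubs i))).
    by apply: funext => i; rewrite barP.
  by [].
Qed.

(** The operations of the quotient are carried over from [A] along the
    bijection that [mu] induces, so that they are well defined from the
    start. *)
Lemma interpretation_of_coordinates (G : code L L' d k) (q : 'I_k -> B)
    (mu : ('I_d -> B) -> A) (g : A -> 'I_d -> B) : coordinates G q mu g ->
  exists I : interpretation A B d k,
    [/\ it_code I = G, it_par I = q & it_map I = mu].
Proof.
move=> co.
have eqv : equivalence_on (U_set G q) (E_rel G q).
  split=> [a Ua|a b Ua Ub|a b c Ua Ub Uc]; rewrite !(co_E co) //.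
  by move=> -> ->.
pose bar (c : U_quot G q) : A := mu (sval (cid2 (svalP c))).
have barP b (Ub : U_set G q b) : bar (U_cls Ub) = mu b.
  rewrite /bar; case: cid2 => /= a Ua e.
  have : [set c | U_set G q c /\ E_rel G q b c] b.
    by split=> //; apply/(co_E co).
  by rewrite [X in X b]e => -[_ /(co_E co Ua Ub)].
pose cl (a : A) : U_quot G q := U_cls (co_U co a).
have clK a : bar (cl a) = a.
  by rewrite barP (co_K co).
have clP b (Ub : U_set G q b) a : U_cls Ub = cl a <-> mu b = a.
  split=> [/(congr1 bar)|<-]; first by rewrite barP clK.
  apply/(clsP eqv)/(co_E co) => //; first exact: (co_U co).
  by rewrite (co_K co).
have barK : cancel bar cl.
  by elim/quot_ind => b Ub; rewrite -/(U_cls Ub) barP; apply/esym/clP.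
have wdU : U_set G q !=set0.
  by have [a] := carrier_inh A; exists (g a); exact: co_U co a.
have wdc c b (Ub : U_set G q b) :
    csat q (fun _ => b) (code_c G c) <-> U_cls Ub = cl (cint A c).
  by rewrite clP (co_c co).
have wdf (f : fun_sym L) b (bs : 'I_(fun_arity f) -> 'I_d -> B)
    (Ub : U_set G q b) (Ubs : forall i, U_set G q (bs i)) :
    csat q (fcons b bs) (code_f G f) <->
    U_cls Ub = cl (fint (fun i => bar (U_cls (Ubs i)))).
  rewrite clP (co_f co) //.
  have -> : (fun i => mu (bs i)) = (fun i => bar (U_cls (Ubs i))).
    by apply: funext => i; rewrite barP.
  by [].
have wdR (R : pred_sym L) (bs : 'I_(pred_arity R) -> 'I_d -> B)
    (Ubs : forall i, U_set G q (bs i)) :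
    csat q bs (code_R G R) <-> pint (fun i => bar (U_cls (Ubs i))).
  rewrite (co_R co) //.
  have -> : (fun i => mu (bs i)) = (fun i => bar (U_cls (Ubs i))).
    by apply: funext => i; rewrite barP.
  by [].
pose w : well_defined G q :=
  WellDefined (wd_f := fun f xs => cl (fint (fun i => bar (xs i))))
    (wd_R := fun R xs => pint (fun i => bar (xs i))) wdU eqv wdc wdf wdR.
have surj : set_surj (U_set G q) [set: A] mu.
  by move=> a _; exists (g a); [exact: co_U co a|exact: co_K co a].
have iso : @isomorphism L (interpreted w) A bar.
  split=> [|c|f xs|R xs] //; last 2 first.
  - exact: clK.
  - exact: clK.
  by exists cl.
by exists (Interpretation (it_wd := w) surj barP iso).
Qed.

End CoordinatesOfInterpretation.

(** * Tuples of tuples *)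

Definition unflat (m d : nat) (x : 'I_(m * d)) : 'I_m * 'I_d :=
  enum_val (cast_ord (esym (mxvec_cast m d)) x).

Lemma flatK (m d : nat) : cancel (@flat m d) (@unflat m d).
Proof.
by case=> i j; rewrite /unflat /flat /mxvec_index cast_ordK enum_rankK.
Qed.

Lemma unflatK (m d : nat) : cancel (@unflat m d) (@flat m d).
Proof.
move=> x; rewrite /unflat /flat /mxvec_index -surjective_pairing enum_valK.
exact: cast_ordKV.
Qed.

Definition block (T : Type) (m d : nat) (v : 'I_(m * d) -> T) (i : 'I_m) :
    'I_d -> T := fun j => v (flat (i, j)).

Definition glue (T : Type) (m d : nat) (w : 'I_m -> 'I_d -> T) :
    'I_(m * d) -> T := fun x => w (unflat x).1 (unflat x).2.

Lemma block_glue (T : Type) (m d : nat) (w : 'I_m -> 'I_d -> T) :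
  block (glue w) = w.
Proof.
by apply: funext => i; apply: funext => j; rewrite /block /glue flatK.
Qed.

(** * Maps between quotients as relations *)

Lemma quot_repr (T : Type) (X : set T) (r : T -> T -> Prop) (c : quot X r) :
  exists a (Xa : X a), c = cls r Xa.
Proof. by elim/quot_ind: c => a Xa; exists a, Xa. Qed.

Section MapRelation.
Variables (alpha beta : option Type) (L : language) (M : structure L).

Lemma pl_eqv (m : nat) (X : plset alpha beta M m) :
  equivalence_on (pl_set X) (@pl_rel _ _ _ _ _ X).
Proof. by have [E []] := pl_formula X. Qed.

Lemma pl_refl (m : nat) (X : plset alpha beta M m) a :
  pl_set X a -> pl_rel X a a.
Proof. by have [r _ _] := pl_eqv X; exact: r. Qed.

Lemma pl_sym (m : nat) (X : plset alpha beta M m) a b :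
  pl_rel X a b -> pl_rel X b a.
Proof.
move=> ab; have [Xa Xb] := pl_support ab; have [_ s _] := pl_eqv X.
exact: s ab.
Qed.

Lemma pl_trans (m : nat) (X : plset alpha beta M m) a b c :
  pl_rel X a b -> pl_rel X b c -> pl_rel X a c.
Proof.
move=> ab bc; have [Xa Xb] := pl_support ab; have [_ Xc] := pl_support bc.
by have [_ _ t] := pl_eqv X; exact: t ab bc.
Qed.

Lemma pl_clsP (m : nat) (X : plset alpha beta M m) a b (Xa : pl_set X a)
    (Xb : pl_set X b) : pl_cls Xa = pl_cls Xb <-> pl_rel X a b.
Proof. exact: (clsP (pl_eqv X)). Qed.

Lemma plset_eq (m : nat) (X Y : plset alpha beta M m) :
  pl_set X = pl_set Y -> @pl_rel _ _ _ _ _ X = @pl_rel _ _ _ _ _ Y -> X = Y.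
Proof.
case: X => X r ? ? ? ?; case: Y => Y s ? ? ? ? /= e e'; subst Y s.
by congr PLSet; exact: Prop_irrelevance.
Qed.

(** Maps between quotients are handled through relations on representatives,
    which do not mention membership proofs and can be compared for different
    objects. *)
Definition mrel (m n : nat) (X : plset alpha beta M m)
    (Y : plset alpha beta M n) (F : pl_quot X -> pl_quot Y)
    (a : 'I_m -> M) (b : 'I_n -> M) : Prop :=
  exists (Xa : pl_set X a) (Yb : pl_set Y b), F (pl_cls Xa) = pl_cls Yb.

Section Graph.
Variables (m n : nat) (X : plset alpha beta M m) (Y : plset alpha beta M n).

Lemma mrelE (F : pl_quot X -> pl_quot Y) a b (Xa : pl_set X a)
    (Yb : pl_set Y b) : mrel F a b <-> F (pl_cls Xa) = pl_cls Yb.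
Proof.
split=> [[Xa' [Yb']]|]; last by exists Xa, Yb.
by rewrite (Prop_irrelevance Xa' Xa) (Prop_irrelevance Yb' Yb).
Qed.

Lemma mrel_total (F : pl_quot X -> pl_quot Y) a :
  pl_set X a -> exists b, mrel F a b.
Proof.
move=> Xa; have [b [Yb e]] := quot_repr (F (pl_cls Xa)).
by exists b, Xa, Yb.
Qed.

Lemma mrel_fun (F : pl_quot X -> pl_quot Y) a b b' :
  mrel F a b -> mrel F a b' -> pl_rel Y b b'.
Proof.
move=> [Xa [Yb e]] [Xa' [Yb']].
by rewrite (Prop_irrelevance Xa' Xa) e => /pl_clsP.
Qed.

Lemma mrel_compat (F : pl_quot X -> pl_quot Y) a a' b b' :
  pl_rel X a a' -> pl_rel Y b b' -> mrel F a b -> mrel F a' b'.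
Proof.
move=> aa bb [Xa [Yb e]].
have [_ Xa'] := pl_support aa; have [_ Yb'] := pl_support bb.
exists Xa', Yb'; move/(pl_clsP Xa Xa'): aa => <-.
by move/(pl_clsP Yb Yb'): bb => <-.
Qed.

Lemma mrel_inj (F F' : pl_quot X -> pl_quot Y) :
  (forall a b, mrel F a b -> mrel F' a b) -> F = F'.
Proof.
move=> sub; apply: funext => c; have [a [Xa ->]] := quot_repr c.
have [b ab] := mrel_total F Xa; have [_ [Yb _]] := ab.
by rewrite ((mrelE F Xa Yb).1 ab) ((mrelE F' Xa Yb).1 (sub _ _ ab)).
Qed.

(** [mrel] requires its second argument to lie in [Y], and this accounts for
    the second clause of [induces]. *)
Lemma inducesP (phi : pformula M ('I_m + 'I_n)) (F : pl_quot X -> pl_quot Y) :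
  induces phi F <->
  forall a b, pl_set X a -> (psat2 phi a b <-> mrel F a b).
Proof.
split=> [[H1 H2] a b Xa|H].
  split=> [ab|[Xa' [Yb e]]]; last exact/(H1 _ _ Xa' Yb).
  have [Yb|nYb] := pselect (pl_set Y b); last by case: (H2 _ _ Xa nYb).
  by exists Xa, Yb; apply/H1.
split=> [a b Xa Yb|a b Xa nYb ab]; first by rewrite H // (mrelE F Xa Yb).
by case: ((H a b Xa).1 ab) => Xa' [Yb _]; exact: nYb.
Qed.

Lemma induces_unique (phi : pformula M ('I_m + 'I_n))
    (F F' : pl_quot X -> pl_quot Y) :
  induces phi F -> induces phi F' -> F = F'.
Proof.
move=> /inducesP H /inducesP H'; apply: mrel_inj => a b ab.
by have [Xa _] := ab; apply/H'/H.
Qed.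

(** All maps are built from their graphs by this lemma, so that identities
    between maps can be checked on representatives. *)
Lemma graph_exists (R : ('I_m -> M) -> ('I_n -> M) -> Prop) :
  (forall a b, R a b -> pl_set X a /\ pl_set Y b) ->
  (forall a, pl_set X a -> exists b, R a b) ->
  (forall a a' b b', pl_rel X a a' -> R a b -> (R a' b' <-> pl_rel Y b b')) ->
  exists F : pl_quot X -> pl_quot Y, forall a b, mrel F a b <-> R a b.
Proof.
move=> dom tot comp.
have /choice[F HF] : forall c : pl_quot X, exists e : pl_quot Y,
    forall a b (Xa : pl_set X a) (Yb : pl_set Y b),
      c = pl_cls Xa -> (e = pl_cls Yb <-> R a b).
  move=> c; have [a [Xa ec]] := quot_repr c; have [b Rab] := tot a Xa.
  have [_ Yb] := dom _ _ Rab; exists (pl_cls Yb) => a' b' Xa' Yb'.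
  rewrite ec => /(pl_clsP Xa Xa') aa'.
  by rewrite (comp _ _ _ b' aa' Rab) pl_clsP.
exists F => a b; split=> [[Xa [Yb e]]|Rab]; first exact/(HF _ _ _ Xa Yb).
by have [Xa Yb] := dom _ _ Rab; exists Xa, Yb; apply/(HF _ a b Xa Yb).
Qed.

End Graph.

Lemma mrel_id (m : nat) (X : plset alpha beta M m) a b :
  mrel (X := X) id a b <-> pl_rel X a b.
Proof.
split=> [[Xa [Xb /pl_clsP//]]|ab]; have [Xa Xb] := pl_support ab.
by exists Xa, Xb; apply/pl_clsP.
Qed.

Lemma mrel_comp (m n s : nat) (X : plset alpha beta M m)
    (Y : plset alpha beta M n) (Z : plset alpha beta M s)
    (F : pl_quot X -> pl_quot Y) (H : pl_quot Y -> pl_quot Z) a c :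
  mrel (fun x => H (F x)) a c <-> exists b, mrel F a b /\ mrel H b c.
Proof.
split=> [[Xa [Zc e]]|[b [[Xa [Yb eF]] [Yb' [Zc eH]]]]].
  have [b ab] := mrel_total F Xa; have [_ [Yb _]] := ab.
  exists b; split=> //; exists Yb, Zc.
  by move/(mrelE _ Xa Yb): ab => <-.
by exists Xa, Zc; rewrite eF (Prop_irrelevance Yb Yb').
Qed.

End MapRelation.

(** * Small systems *)

Definition verum (L : language) (X : Type) : formula L X :=
  Ex (Atom (Eq (Var None) (Var None))).

Lemma finite_In (T : Type) (s : seq T) : finite_set [set a | List.In a s].
Proof.
elim: s => [|a s IH].
  by rewrite (_ : [set a | _] = set0) //; apply/seteqP; split.
rewrite (_ : [set b | _] = [set a] `|` [set b | List.In b s]).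
  by rewrite finite_setU.
by apply/seteqP; split=> b /= [->|]; auto.
Qed.

Section Small.
Variables (alpha beta : option Type).
Hypothesis (alphaP : admissible alpha) (betaP : admissible beta).

Lemma small_set1 (L : language) (M : structure L) (X : Type)
    (p : pformula M X) : small alpha beta [set p].
Proof.
split; apply: finite_below => //.
apply: sub_finite_set (finite_In (params p)) => a /= [_ -> //].
Qed.

Lemma small_system1 (L : language) (M : structure L) (m : nat)
    (p : pformula M 'I_m) : small_system alpha beta [set p].
Proof. by split; [exists p|exact: small_set1]. Qed.

(** Only non-empty systems have a translation that confines the solutions to
    the domain of the code, because each translated formula contains the
    confinement; a trivial formula is therefore added to the empty system. *)
Lemma logical_system (L : language) (M : structure L) (m : nat)
    (X : set ('I_m -> M)) : logical alpha beta X ->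
  exists2 S, small_system alpha beta S & X = V S.
Proof.
move=> [S Ssmall ->]; have [S0|noS] := pselect (S !=set0); first by exists S.
exists [set verum L ('I_m + M)]; first exact: small_system1.
apply/seteqP; split=> a _ p Sp; last by case: noS; exists p.
by rewrite Sp; have [b] := carrier_inh M; exists b.
Qed.

End Small.

(** * The functor of a coordinate map *)

Section PullBack.
Variables (L L' : language) (A : structure L) (B : structure L').
Variables (d k : nat) (G : code L L' d k) (q : 'I_k -> B).
Variables (mu : ('I_d -> B) -> A) (g : A -> 'I_d -> B).
Hypothesis co : coordinates G q mu g.

Definition inU (m : nat) (b : 'I_(m * d) -> B) : Prop :=
  forall i, U_set G q (block b i).

Definition mus (m : nat) (b : 'I_(m * d) -> B) : 'I_m -> A :=
  fun i => mu (block b i).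

Definition lift_tuple (m : nat) (a : 'I_m -> A) : 'I_(m * d) -> B :=
  glue (fun i => g (a i)).

Lemma inU_lift (m : nat) (a : 'I_m -> A) : inU (lift_tuple a).
Proof. by move=> i; rewrite block_glue; exact: (co_U co). Qed.

Lemma mus_lift (m : nat) (a : 'I_m -> A) : mus (lift_tuple a) = a.
Proof. by apply: funext => i; rewrite /mus block_glue (co_K co). Qed.

Definition pull (m : nat) (X : set ('I_m -> A)) : set ('I_(m * d) -> B) :=
  [set b | inU b /\ X (mus b)].

Definition pull_rel (m : nat) (r : ('I_m -> A) -> ('I_m -> A) -> Prop)
    (b b' : 'I_(m * d) -> B) : Prop :=
  [/\ inU b, inU b' & r (mus b) (mus b')].

Lemma pull_eq0 (m : nat) (X : set ('I_m -> A)) :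
  X = set0 <-> pull X = set0.
Proof.
split=> [->|e]; first by apply/seteqP; split=> // b [].
apply/seteqP; split=> // a Xa.
have : pull X (lift_tuple a).
  by split; [exact: inU_lift|rewrite mus_lift].
by rewrite e.
Qed.

Lemma pull_neq0 (m : nat) (X : set ('I_m -> A)) : X !=set0 -> pull X !=set0.
Proof.
move=> [a Xa]; exists (lift_tuple a); split; first exact: inU_lift.
by rewrite mus_lift.
Qed.

Lemma V_strans (m : nat) (S : set (pformula A 'I_m)) T :
  S !=set0 -> strans G q g S T -> V T = pull (V S).
Proof.
move=> [p0 Sp0] [c Sc ->].
have cP p b : S p -> psat b (c p) <-> inU b /\ psat (mus b) p.
  by move=> Sp; apply: (psat_ptranslation _ co (Sc p Sp)).
apply/seteqP; split=> [b Vb|b [Ub Vb] _ [p Sp <-]]; last first.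
  by apply/cP => //; split=> //; exact: Vb.
have [Ub _] := (cP _ _ Sp0).1 (Vb _ (imageP c Sp0)).
split=> // p Sp.
by have [] := (cP _ _ Sp).1 (Vb _ (imageP c Sp)).
Qed.

Lemma psat2_ptrans2 (m n : nat) (phi : pformula A ('I_m + 'I_n)) phi' b c :
  ptrans2 G q g phi phi' ->
  psat2 phi' b c <-> [/\ inU b, inU c & psat2 phi (mus b) (mus c)].
Proof.
move=> H; rewrite /psat2 (psat_ptranslation _ co H).
have E : psat (fun x : 'I_m + 'I_n => mu (fun j =>
      match flat2 (x, j) with inl i => b i | inr j0 => c j0 end)) phi <->
    psat (fun x => match x with inl i => mus b i | inr j => mus c j end) phi.
  by apply: sat_ext => -[[i|j]|a].
split=> [[U H']|[Ub Uc H']]; last by split; [case|apply/E].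
split; last exact/E.
- by move=> i; exact: (U (inl i)).
- by move=> i; exact: (U (inr i)).
Qed.

Lemma ptrans2_exists (m n : nat) (phi : pformula A ('I_m + 'I_n)) :
  exists phi', ptrans2 G q g phi phi'.
Proof. exact: ptranslation_exists. Qed.

Lemma strans_exists (m : nat) (S : set (pformula A 'I_m)) :
  exists T, strans G q g S T.
Proof.
have /choice[c cP] : forall p : pformula A 'I_m, exists p',
    ptrans1 G q g p p' by move=> p; exact: ptranslation_exists.
by exists (c @` S); exists c.
Qed.

Lemma formula_equivalence_pull (m : nat) (X : set ('I_m -> A)) r E E' :
  formula_equivalence X r E -> ptrans2 G q g E E' ->
  formula_equivalence (pull X) (pull_rel r) E'.
Proof.
move=> [[rr rs rt] rE sE] EE'; split.
- split=> [b [Ub Xb]|b c [Ub Xb] [Uc Xc]|b c e [Ub Xb] [Uc Xc] [Ue Xe]].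
  + by split=> //; exact: rr.
  + by move=> [_ _ bc]; split=> //; exact: rs bc.
  + by move=> [_ _ bc] [_ _ ce]; split=> //; exact: rt bc ce.
- move=> b c [Ub Xb] [Uc Xc]; rewrite (psat2_ptrans2 _ _ EE').
  by split=> -[_ _ /rE bc]; split=> //; apply/bc.
- move=> b c [Ub Xb]; rewrite !(psat2_ptrans2 _ _ EE').
  by case=> -[U1 U2 bc]; split=> //; apply: sE Xb _; [left|right].
Qed.

Variables (alpha beta : option Type).
Hypotheses (alphaP : admissible alpha) (betaP : admissible beta).

Lemma small_strans (m : nat) (S : set (pformula A 'I_m)) T :
  small alpha beta S -> strans G q g S T -> small alpha beta T.
Proof.
move=> [Sb Sa] [c Sc ->]; split.
  by apply: below_card_le Sb; exact: card_image_le.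
apply: (below_coordinates (g := g) (q := q) alphaP _ Sa).
move=> b /= [_ [p Sp <-]] /(ptranslation_params (Sc p Sp)).
by move=> [[a pa [j ->]]|]; [left; exists a; [exists p|exists j]|right].
Qed.

Lemma logical_pull (m : nat) (X : set ('I_m -> A)) :
  logical alpha beta X -> logical alpha beta (pull X).
Proof.
move=> /(logical_system alphaP betaP)[S [S0 Ssmall] ->].
have [T ST] := strans_exists S; exists T; first exact: small_strans ST.
by rewrite (V_strans S0 ST).
Qed.

Lemma pull_support (m : nat) (X : plset alpha beta A m) b b' :
  pull_rel (@pl_rel _ _ _ _ _ X) b b' ->
  pull (pl_set X) b /\ pull (pl_set X) b'.
Proof. by move=> [Ub Ub' /pl_support[]]. Qed.

Lemma pull_formula (m : nat) (X : plset alpha beta A m) :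
  exists E, formula_equivalence (pull (pl_set X))
              (pull_rel (@pl_rel _ _ _ _ _ X)) E.
Proof.
have [E HE] := pl_formula X; have [E' EE'] := ptrans2_exists E.
by exists E'; exact: formula_equivalence_pull EE'.
Qed.

Definition pull_pl (m : nat) (X : plset alpha beta A m) :
    plset alpha beta B (m * d) :=
  PLSet (pull_neq0 (pl_nonempty X)) (logical_pull (pl_logical X))
    (@pull_support m X) (pull_formula X).

Lemma presents_pull (m : nat) (X : plset alpha beta A m) S E T E' :
  small_system alpha beta S -> presents X S E -> strans G q g S T ->
  ptrans2 G q g E E' -> presents (pull_pl X) T E'.
Proof.
move=> [S0 _] [XS XE] ST EE'; split=> /=; first by rewrite (V_strans S0 ST) XS.
exact: formula_equivalence_pull EE'.
Qed.

Lemma presents_unique (M : language) (C : structure M) (m : nat)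
    (X Y : plset alpha beta C m) S E :
  presents X S E -> presents Y S E -> X = Y.
Proof.
move=> [XS [_ XE _]] [YS [_ YE _]].
have e : pl_set X = pl_set Y by rewrite XS YS.
apply: plset_eq => //; apply: funext => a; apply: funext => b; apply/propext.
split=> ab; have [] := pl_support ab.
  by move=> Xa Xb; rewrite YE -?e // -XE.
by move=> Ya Yb; rewrite XE ?e // -YE.
Qed.

(** The inverse image depends on the set and the equivalence relation only, so
    neither the presentation nor the normal forms matter. *)
Lemma pl_translation_pull (m : nat) (X : plset alpha beta A m) X' :
  pl_translation G q g X X' -> X' = pull_pl X.
Proof.
move=> [S [E [T [E' [Ss XS ST EE' X'T]]]]].
exact: presents_unique X'T (presents_pull Ss XS ST EE').
Qed.

Section PullMap.
Variables (m n : nat) (X : plset alpha beta A m) (Y : plset alpha beta A n).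

Lemma pull_map_exists (F : pl_quot X -> pl_quot Y) :
  exists F' : pl_quot (pull_pl X) -> pl_quot (pull_pl Y), forall b c,
    mrel F' b c <-> [/\ inU b, inU c & mrel F (mus b) (mus c)].
Proof.
apply: (graph_exists
  (R := fun b c => [/\ inU b, inU c & mrel F (mus b) (mus c)])).
- by move=> b c [Ub Uc [Xb [Yc _]]].
- move=> b [Ub Xb]; have [c bc] := mrel_total F Xb.
  by exists (lift_tuple c); rewrite mus_lift; split=> //; exact: inU_lift.
- move=> b b' c c' [Ub Ub' bb'] [_ Uc bc]; split.
    move=> [_ Uc' bc']; split=> //.
    have [_ [Yc' _]] := bc'.
    apply: mrel_fun bc _; apply: mrel_compat bc'; first exact: pl_sym.
    exact: pl_refl.
  by move=> [_ Uc' cc']; split=> //; exact: mrel_compat bc.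
Qed.

Definition pull_map (F : pl_quot X -> pl_quot Y) :
    pl_quot (pull_pl X) -> pl_quot (pull_pl Y) :=
  sval (cid (pull_map_exists F)).

Lemma mrel_pull (F : pl_quot X -> pl_quot Y) b c :
  mrel (pull_map F) b c <-> [/\ inU b, inU c & mrel F (mus b) (mus c)].
Proof. exact: (svalP (cid (pull_map_exists F))). Qed.

Lemma induces_pull (F : pl_quot X -> pl_quot Y) phi phi' :
  induces phi F -> ptrans2 G q g phi phi' -> induces phi' (pull_map F).
Proof.
move=> /inducesP HF pp; apply/inducesP => b c [Ub Xb].
rewrite (psat2_ptrans2 _ _ pp) mrel_pull.
by split=> -[? ? H]; split=> //; apply/HF.
Qed.

Lemma pull_fm_subproof (F : formula_map X Y) :
  exists phi, induces phi (pull_map (sval F)).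
Proof.
have [phi HF] := svalP F; have [phi' pp] := ptrans2_exists phi.
by exists phi'; exact: induces_pull pp.
Qed.

Definition pull_fm (F : formula_map X Y) :
    formula_map (pull_pl X) (pull_pl Y) :=
  exist _ (pull_map (sval F)) (pull_fm_subproof F).

End PullMap.

Lemma pull_map_id (m : nat) (X : plset alpha beta A m) :
  pull_map (X := X) id = id.
Proof.
apply: mrel_inj => b c /mrel_pull[Ub Uc /mrel_id bc].
by apply/mrel_id.
Qed.

Lemma pull_map_comp (m n s : nat) (X : plset alpha beta A m)
    (Y : plset alpha beta A n) (Z : plset alpha beta A s)
    (F : pl_quot X -> pl_quot Y) (H : pl_quot Y -> pl_quot Z) :
  pull_map (fun x => H (F x)) = fun x => pull_map H (pull_map F x).
Proof.
apply: mrel_inj => b e /mrel_pull[Ub Ue /mrel_comp[c [bc ce]]].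
apply/mrel_comp; exists (lift_tuple c); rewrite !mrel_pull !mus_lift.
by split; split=> //; exact: inU_lift.
Qed.

Lemma pull_functor_conditions : functor_conditions alpha beta G q g.
Proof.
split.
- by move=> m S T [S0 _] ST; rewrite (V_strans S0 ST) -pull_eq0.
- move=> m S S' T T' [S0 _] [S0' _] ST ST'.
  by rewrite (V_strans S0 ST) (V_strans S0' ST') => ->.
- move=> m S T E E' [S0 _] ST EE' _ [r HE]; rewrite (V_strans S0 ST).
  by exists (pull_rel r); exact: formula_equivalence_pull EE'.
- move=> m S T E1 E1' E2 E2' [S0 _] ST EE1 EE2 _ [r [H1 H2]].
  rewrite (V_strans S0 ST).
  by exists (pull_rel r); split;
    [exact: formula_equivalence_pull H1 EE1|
     exact: formula_equivalence_pull H2 EE2].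
- move=> m n X Y X' Y' phi phi' /pl_translation_pull-> /pl_translation_pull->.
  by move=> pp [F HF]; exists (pull_map F); exact: induces_pull pp.
- move=> m n X Y X' Y' phi phi' psi psi' /pl_translation_pull->.
  move=> /pl_translation_pull-> pp pp' [F [HF HF']].
  by exists (pull_map F); split;
    [exact: induces_pull HF pp|exact: induces_pull HF' pp'].
- move=> m n s X Y Z X' Y' Z' phi phi' psi psi' chi' F H F' H'.
  move=> /pl_translation_pull eX /pl_translation_pull eY.
  move=> /pl_translation_pull eZ; subst X' Y' Z'.
  move=> pp pp' pc HF HH HF' HH'.
  have -> := induces_unique HF' (induces_pull HF pp).
  have -> := induces_unique HH' (induces_pull HH pp').
  rewrite -pull_map_comp; apply: induces_pull pc; exact: induces_comp.
Qed.

Definition pull_ob (O : PLS alpha beta A) : PLS alpha beta B :=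
  match O with
  | None => None
  | Some X => pls_some (pull_pl (projT2 X))
  end.

Definition pull_hom (O P : PLS alpha beta A) :
    hom O P -> hom (pull_ob O) (pull_ob P) :=
  match O, P return @pls_hom _ _ _ A O P -> pls_hom (pull_ob O) (pull_ob P) with
  | None, _ => fun _ => tt
  | Some _, None => fun f => match f with end
  | Some X, Some Y => fun f => pull_fm f
  end.

Lemma pull_hom_id (O : PLS alpha beta A) :
  pull_hom (idm (c := PLS alpha beta A) O) =
  idm (c := PLS alpha beta B) (pull_ob O).
Proof. by case: O => //= X; apply: eq_exist; exact: pull_map_id. Qed.

Lemma pull_hom_cmp (O P Q : PLS alpha beta A) (f : hom O P) (h : hom P Q) :
  pull_hom (cmp (c := PLS alpha beta A) f h) =
  cmp (c := PLS alpha beta B) (pull_hom f) (pull_hom h).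
Proof.
case: O P Q f h => [X|] [Y|] [Z|] //= f h; try by [case: f|case: h].
by apply: eq_exist; exact: pull_map_comp.
Qed.

Definition pull_functor : functor (PLS alpha beta A) (PLS alpha beta B) :=
  @Functor (PLS alpha beta A) (PLS alpha beta B) pull_ob pull_hom
    pull_hom_id pull_hom_cmp.

Lemma translation_pull_functor : translation_functor pull_functor.
Proof.
exists d, k, G, q, g; split=> //.
- exact: pull_functor_conditions.
- move=> m X S E T E' Ss XS ST EE'; exists (pull_pl X) => //.
  exact: presents_pull Ss XS ST EE'.
- move=> m n X Y f phi phi' Hf pp.
  exists (pull_pl X), (pull_pl Y), (pull_fm f); split=> //.
  exact: induces_pull pp.
Qed.

End PullBack.

(** * Composition of coordinate maps *)

Section Composition.
Variables (L L' L'' : language) (A : structure L) (B : structure L')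
          (C : structure L'').
Variables (d k d' k' : nat) (G : code L L' d k) (D : code L' L'' d' k').
Variables (q : 'I_k -> B) (mu : ('I_d -> B) -> A) (g : A -> 'I_d -> B).
Variables (q' : 'I_k' -> C) (nu : ('I_d' -> C) -> B) (g' : B -> 'I_d' -> C).
Hypotheses (coG : coordinates G q mu g) (coD : coordinates D q' nu g').

Definition comp_U (v : 'I_(d * d') -> C) : Prop :=
  (forall j, U_set D q' (block v j)) /\
  U_set G q (fun j => nu (block v j)).

Definition comp_mu (v : 'I_(d * d') -> C) : A :=
  mu (fun j => nu (block v j)).

(** Chosen coordinates of the parameters of the first code, followed by the
    parameters of the second. *)
Definition comp_par (r : 'I_(k * d' + k') -> C) : Prop :=
  exists ps : 'I_k -> 'I_d' -> C,
    [/\ forall l, U_set D q' (ps l), forall l, nu (ps l) = q l,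
        forall l j, r (lshift k' (flat (l, j))) = ps l j &
        forall l', r (rshift (k * d') l') = q' l'].

Lemma comp_par_exists : exists r, comp_par r.
Proof.
exists (fun x => match fintype.split x with
                 | inl y => glue (fun l => g' (q l)) y
                 | inr l' => q' l'
                 end).
exists (fun l => g' (q l)); split=> [l|l|l j|l'].
- exact: co_U coD _.
- exact: co_K coD _.
- case: split_ordP => y /eqP; rewrite eq_shift // => /eqP <-.
  by rewrite -[glue _ _]/(block (glue (fun l => g' (q l))) l j) block_glue.
- by case: split_ordP => y /eqP; rewrite eq_shift // => /eqP <-.
Qed.

(** This is [sat_tr] for the formulas of a code, whose parameters become
    tuples of parameters. *)
Lemma csat_ctranslation r (n : nat) (p : formula L' (cvar n d k)) p'
    (vs : 'I_n -> 'I_(d * d') -> C) :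
  comp_par r -> ctranslation D p p' ->
  csat r vs p' <-> (forall i j, U_set D q' (block (vs i) j)) /\
                   csat q (fun i j => nu (block (vs i) j)) p.
Proof.
move=> [ps [psU psK rl rr]] [m [_ mp _] ->].
pose w (x : 'I_n * 'I_d + 'I_k) : 'I_d' -> C :=
  match x with inl (i, j) => block (vs i) j | inr l => ps l end.
rewrite /csat sat_rename.
have -> : (fun x : cvar n d k * 'I_d' + 'I_k' =>
    match Defs.reindex x with inl (i, j) => vs i j | inr l => r l end) =
    tval w q'.
  by apply: funext => -[[[[i j]|l] j']|l'] //=.
rewrite sat_translation.
have E : (forall i j, U_set D q' (block (vs i) j)) ->
    sat (tval w q') (tr D m) <->
    sat (fun z : cvar n d k => match z with
                         | inl (i, j) => nu (block (vs i) j)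
                         | inr l => q l
                         end) p.
  move=> U; rewrite (sat_tr m coD); last by case=> [[i j]|l] /=.
  by rewrite mp; apply: sat_ext => -[[i j]|l] //=.
split=> [[U H]|[U H]].
  have U' i j : U_set D q' (block (vs i) j).
    by apply: (U (inl (i, j))); apply/In_mem; rewrite mem_enum.
  by split=> //; apply/E.
by split; [case=> [[i j]|l] _ /=|apply/E].
Qed.

Lemma ctranslation_exists (n : nat) (p : formula L' (cvar n d k)) :
  exists p', ctranslation D p p'.
Proof.
by have [m [mp _]] := normal_form_exists p; eexists; exists m.
Qed.

Lemma code_composition_exists :
  exists GD : code L L'' (d * d') (k * d' + k'), code_composition G D GD.
Proof.
have [U HU] := ctranslation_exists (code_U G).
have [E HE] := ctranslation_exists (code_E G).
have /choice[c Hc] : forall c, exists p', ctranslation D (code_c G c) p'.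
  by move=> c; exact: ctranslation_exists.
have Hf f : {p' | ctranslation D (code_f G f) p'}.
  by apply: cid; exact: ctranslation_exists.
have HR R : {p' | ctranslation D (code_R G R) p'}.
  by apply: cid; exact: ctranslation_exists.
exists (Code U E c (fun f => sval (Hf f)) (fun R => sval (HR R))).
by split=> //= [f|R]; [exact: (svalP (Hf f))|exact: (svalP (HR R))].
Qed.

Variables (GD : code L L'' (d * d') (k * d' + k')) (r : 'I_(k * d' + k') -> C).
Hypotheses (GDP : code_composition G D GD) (rP : comp_par r).

Lemma comp_U_set v : U_set GD r v <-> comp_U v.
Proof.
have [HU _ _ _ _] := GDP; rewrite /U_set /= (csat_ctranslation _ rP HU).
by split=> -[U Uv]; split=> // j; exact: (U ord0).
Qed.

Lemma coordinates_comp :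
  coordinates GD r comp_mu (fun a => glue (fun j => g' (g a j))).
Proof.
have [_ HE Hc Hf HR] := GDP.
have blockU v : U_set GD r v -> forall j, U_set D q' (block v j).
  by move=> /comp_U_set[].
have fconsE (n : nat) (v : 'I_(d * d') -> C) (vs : 'I_n -> 'I_(d * d') -> C) :
    (fun i j => nu (block (fcons v vs i) j)) =
    fcons (fun j => nu (block v j)) (fun i j => nu (block (vs i) j)).
  exact: (fcons_comp (fun v j => nu (block v j))).
have fconsU (n : nat) v (vs : 'I_n -> 'I_(d * d') -> C) : U_set GD r v ->
    (forall i, U_set GD r (vs i)) ->
    forall i j, U_set D q' (block (fcons v vs i) j).
  by move=> Uv Uvs i; rewrite /fcons; case: unlift => [i'|]; exact: blockU.
have lastU v : U_set GD r v -> U_set G q (fun j => nu (block v j)).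
  by move=> /comp_U_set[].
split=> [a|a|v v' Uv Uv'|c v Uv|f v vs Uv Uvs|R vs Uvs].
- apply/comp_U_set; split=> [j|]; rewrite block_glue; first exact: (co_U coD).
  rewrite (_ : (fun j => _) = g a); first exact: (co_U coG).
  by apply: funext => j; rewrite (co_K coD).
- rewrite /comp_mu block_glue -[RHS](co_K coG); congr mu.
  by apply: funext => j; rewrite (co_K coD).
- rewrite /E_rel (csat_ctranslation _ rP HE) fconsE.
  rewrite -(co_E coG (lastU _ Uv) (lastU _ Uv')).
  by split=> [[]|H] //; split=> //; exact: fconsU.
- rewrite (csat_ctranslation _ rP (Hc c)) -(co_c coG c (lastU _ Uv)).
  by split=> [[]|H] //; split=> // _; exact: blockU.
- rewrite (csat_ctranslation _ rP (Hf f)) fconsE.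
  rewrite -(co_f coG (lastU _ Uv) (fun i => lastU _ (Uvs i))).
  by split=> [[]|H] //; split=> //; exact: fconsU.
- rewrite (csat_ctranslation _ rP (HR R)).
  rewrite -(co_R coG (fun i => lastU _ (Uvs i))).
  by split=> [[]|H] //; split=> // i; exact: blockU.
Qed.

End Composition.

Section CompositionOfInterpretations.
Variables (L L' L'' : language) (A : structure L) (B : structure L')
          (C : structure L'').
Variables (d k d' k' : nat).

Lemma composition_coordinates (I : interpretation A B d k)
    (I' : interpretation B C d' k') J g g' :
  composition I I' J ->
  coordinates (it_code I) (it_par I) (it_map I) g ->
  coordinates (it_code I') (it_par I') (it_map I') g' ->
  (forall v, U_set (it_code J) (it_par J) v <->
     comp_U (it_code I) (it_code I') (it_par I) (it_par I') (it_map I') v) /\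
  (forall v, U_set (it_code J) (it_par J) v ->
     it_map J v = comp_mu (it_map I) (it_map I') v).
Proof.
move=> [JP rP mapP] co co'; split=> // v; exact: (comp_U_set co' JP rP).
Qed.

Lemma composition_exists (I : interpretation A B d k)
    (I' : interpretation B C d' k') :
  exists J, composition I I' J.
Proof.
have [g co] := interpretation_coordinates I.
have [g' co'] := interpretation_coordinates I'.
have [GD GDP] := code_composition_exists (it_code I) (it_code I').
have [r rP] := comp_par_exists (it_par I) co'.
have [J [eG er em]] :=
  interpretation_of_coordinates (coordinates_comp co co' GDP rP).
by exists J; split; rewrite ?eG ?er ?em.
Qed.

End CompositionOfInterpretations.

(** * Formulas for finite systems *)

Fixpoint bigand (L : language) (X : Type) (s : seq (formula L X)) :
    formula L X :=
  if s is p :: s then Conj p (bigand s) else verum L X.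

Lemma sat_bigand (L : language) (M : structure L) (X : Type) (v : X -> M) s :
  sat v (bigand s) <-> forall p, List.In p s -> sat v p.
Proof.
elim: s => [|p s IH] /=.
  by split=> // _; have [a] := carrier_inh M; exists a.
rewrite IH; split=> [[pv H] r [<-|/H]|H] //.
by split=> [|r rs]; apply: H; auto.
Qed.

Lemma finite_set_list (T : Type) (S : set T) : finite_set S ->
  exists s : seq T, forall p, S p <-> List.In p s.
Proof.
elim/Pchoice: T => T in S *; move=> /finite_seqP[s ->].
by exists s => p; rewrite In_mem.
Qed.

(** Finite systems amount to single formulas, and only formulas can be put
    together by connectives and substitution. *)
Lemma definable_formula (L : language) (M : structure L) (m : nat)
    (X : set ('I_m -> M)) :
  definable X <-> exists p : pformula M 'I_m, X = [set a | psat a p].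
Proof.
split=> [[S [[_ finS] _] ->]|[p ->]].
  have [s sP] := finite_set_list ((finite_setPn _).2 finS).
  exists (bigand s); apply/seteqP; split=> a /=.
    by move=> Va; apply/sat_bigand => p /sP; exact: Va.
  by move=> /sat_bigand H p /sP; exact: H.
exists [set p]; first by apply: small_set1; exact: infinite_nat.
by apply/seteqP; split=> [a Ha _ ->|a Va] //; exact: Va.
Qed.

(** * Strong homotopy to the identity as definability of a coordinate map *)

Section Homotopy.
Variables (L L' : language) (A : structure L) (d k : nat).

(** For an interpretation of [A] in itself, a homotopy to the identical
    interpretation is forced to be the coordinate map; so only the
    definability of that map is at stake. *)
Lemma homotopic_id (J : interpretation A A d k) :
  strongly_homotopic J (id_interpretation A) <->
  exists p : pformula A ('I_d + 'I_1), forall z a,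
    psat2 p z a <-> U_set (it_code J) (it_par J) z /\ it_map J z = a ord0.
Proof.
pose Gr (lambda : interpreted (it_wd J) -> interpreted (id_wd A)) :=
  [set v : 'I_(d + 1) -> A |
     exists (U1 : U_set (it_code J) (it_par J) (fun i => v (lshift 1 i)))
            (U2 : U_set (id_code L) (id_par A) (fun j => v (rshift d j))),
       lambda (U_cls U1) = U_cls U2].
pose Gp v := U_set (it_code J) (it_par J) (fun i => v (lshift 1 i)) /\
  it_map J (fun i => v (lshift 1 i)) = v (rshift d ord0).
have GrE lambda : (forall x, it_bar (i := J) x = id_bar (lambda x)) ->
    forall v, Gr lambda v <-> Gp v.
  move=> lamP v; split=> [[U1 [U2 e]]|[U1 e]].
    by split=> //; rewrite -(it_barP U1) lamP e id_barP.
  exists U1, (id_U _); apply: (can_inj (@id_barK _ A)).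
  by rewrite -lamP it_barP e id_barP.
split=> [[lambda [_ /definable_formula[p ep] lamP]]|[p pP]].
  exists (rename (fun x => match x with
                           | inl w => inl (fintype.split w)
                           | inr c => inr c
                           end) p) => z a.
  pose v w := match fintype.split w with inl i => z i | inr j => a j end.
  have vl : (fun i => v (lshift 1 i)) = z.
    apply: funext => i; rewrite /v; case: split_ordP => j /eqP.
      by rewrite eq_shift => /eqP <-.
    by rewrite eq_shift.
  have vr : v (rshift d ord0) = a ord0.
    rewrite /v; case: split_ordP => j /eqP; last by rewrite eq_shift => /eqP <-.
    by rewrite eq_shift.
  have -> : psat2 (rename (fun x => match x with
                           | inl w => inl (fintype.split w)
                           | inr c => inr c
                           end) p) z a = psat v p.
    rewrite /psat2 /psat sat_rename; congr (sat _ _).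
    by apply: funext => -[w|c].
  have -> : psat v p = Gr lambda v by rewrite /Gr ep.
  by rewrite GrE // /Gp vl vr.
have [bij barc barf barR] := it_iso J.
pose lambda : interpreted (it_wd J) -> interpreted (id_wd A) :=
  fun x => id_cls (it_bar (i := J) x).
have lamP x : it_bar (i := J) x = id_bar (lambda x) by rewrite id_clsK.
exists lambda; split=> //.
- split=> [|c|f xs|R xs].
  + apply: (bij_comp _ bij).
    by exists (@id_bar _ A); [exact: id_clsK|exact: id_barK].
  + by rewrite /lambda barc.
  + rewrite /lambda barf /=; congr (id_cls (fint _)).
    by apply: funext => i; rewrite id_clsK.
  + rewrite barR /=; suff -> : (fun i => id_bar (lambda (xs i))) =
      (fun i => it_bar (i := J) (xs i)) by [].
    by apply: funext.
- apply/definable_formula.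
  exists (rename (fun x => match x with
                           | inl (inl i) => inl (lshift 1 i)
                           | inl (inr j) => inl (rshift d j)
                           | inr c => inr c
                           end) p).
  apply/funext => v; apply/propext; apply: (iff_trans (GrE _ lamP v)).
  apply: (iff_trans (iff_sym (pP _ (fun j => v (rshift d j))))).
  rewrite /psat2 /psat /= sat_rename.
  by apply: sat_ext => -[[i|j]|c].
Qed.

End Homotopy.

(** * From strong bi-interpretations to equivalences of categories *)

Definition flip_formula (L : language) (M : structure L) (m n : nat)
    (p : pformula M ('I_m + 'I_n)) : pformula M ('I_n + 'I_m) :=
  rename (fun x => match x with
                   | inl (inl i) => inl (inr i)
                   | inl (inr j) => inl (inl j)
                   | inr c => inr c
                   end) p.

Lemma psat2_flip (L : language) (M : structure L) (m n : nat)
    (p : pformula M ('I_m + 'I_n)) a b :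
  psat2 (flip_formula p) b a <-> psat2 p a b.
Proof.
by rewrite /psat2 /psat sat_rename; apply: sat_ext => -[[i|j]|c].
Qed.

Section NaturalIsomorphism.
Variables (L L' : language) (A : structure L) (B : structure L').
Variables (d k d' k' : nat) (G : code L L' d k) (D : code L' L d' k').
Variables (q : 'I_k -> B) (mu : ('I_d -> B) -> A) (g : A -> 'I_d -> B).
Variables (q' : 'I_k' -> A) (nu : ('I_d' -> A) -> B) (g' : B -> 'I_d' -> A).
Hypotheses (coG : coordinates G q mu g) (coD : coordinates D q' nu g').

Variable theta : pformula A ('I_(d * d') + 'I_1).
Hypothesis thetaP : forall z a,
  psat2 theta z a <-> comp_U G D q q' nu z /\ comp_mu mu nu z = a ord0.

(** The [i]-th coordinate of a tuple that was pulled back twice. *)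
Definition coordinate (T : Type) (m : nat) (z : 'I_(m * d * d') -> T)
    (i : 'I_m) : 'I_(d * d') -> T :=
  fun p => z (flat (flat (i, (unflat p).1), (unflat p).2)).

Lemma block_coordinate (T : Type) (m : nat) (z : 'I_(m * d * d') -> T) i j :
  block (coordinate z i) j = block z (flat (i, j)).
Proof. by apply: funext => j'; rewrite /block /coordinate flatK. Qed.

Lemma comp_U_coordinate (m : nat) (z : 'I_(m * d * d') -> A) :
  (forall i, comp_U G D q q' nu (coordinate z i)) <->
  inU D q' z /\ inU G q (mus nu z).
Proof.
have E i : (fun j => nu (block (coordinate z i) j)) = block (mus nu z) i.
  by apply: funext => j; rewrite block_coordinate.
split=> [H|[Uz Uz'] i].
  split=> [x|i]; last by rewrite -E; have [] := H i.
  have [Uz _] := H (unflat x).1; have := Uz (unflat x).2.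
  by rewrite block_coordinate -surjective_pairing unflatK.
split=> [j|]; last by rewrite E; exact: Uz'.
by rewrite block_coordinate; exact: Uz.
Qed.

Lemma comp_mu_coordinate (m : nat) (z : 'I_(m * d * d') -> A) i :
  comp_mu mu nu (coordinate z i) = mus mu (mus nu z) i.
Proof.
by congr mu; apply: funext => j; rewrite block_coordinate.
Qed.

Definition theta_tuple (m : nat) : pformula A ('I_(m * d * d') + 'I_m) :=
  bigand [seq rename (fun x =>
            match x with
            | inl (inl p) => inl (inl (coordinate id i p))
            | inl (inr _) => inl (inr i)
            | inr c => inr c
            end) theta | i <- enum 'I_m].

Lemma psat2_theta_tuple (m : nat) z (a : 'I_m -> A) :
  psat2 (theta_tuple m) z a <->
  [/\ inU D q' z, inU G q (mus nu z) & mus mu (mus nu z) = a].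
Proof.
have E i : psat2 (rename (fun x =>
            match x with
            | inl (inl p) => inl (inl (coordinate id i p))
            | inl (inr _) => inl (inr i)
            | inr c => inr c
            end) theta) z a <->
    comp_U G D q q' nu (coordinate z i) /\ comp_mu mu nu (coordinate z i) = a i.
  rewrite -(thetaP _ (fun=> a i)) /psat2 /psat sat_rename.
  by apply: sat_ext => -[[p|j]|c].
rewrite /psat2 /psat sat_bigand; split=> [H|[Uz Uz' e] r].
  have Hi i := (E i).1 (H _ ((List.in_map_iff _ _ _).2
    (ex_intro _ i (conj erefl ((In_mem _ _).2 (mem_enum 'I_m i)))))).
  have [Uz Uz'] := (comp_U_coordinate z).1 (fun i => (Hi i).1).
  split=> //; apply: funext => i; rewrite -comp_mu_coordinate.
  by have [] := Hi i.
move/List.in_map_iff => [i [<- _]]; apply/E.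
rewrite comp_mu_coordinate e; split=> //.
by apply: (comp_U_coordinate z).2.
Qed.

Variables (alpha beta : option Type).
Hypotheses (alphaP : admissible alpha) (betaP : admissible beta).

Let PP (m : nat) (X : plset alpha beta A m) :
    plset alpha beta A (m * d * d') :=
  pull_pl coD alphaP betaP (pull_pl coG alphaP betaP X).

(** The graph of the isomorphism between the image of [X] under both functors
    and [X]. *)
Definition unwind (m : nat) (X : plset alpha beta A m)
    (z : 'I_(m * d * d') -> A) (a : 'I_m -> A) : Prop :=
  [/\ inU D q' z, inU G q (mus nu z) & pl_rel X (mus mu (mus nu z)) a].

Lemma PP_set (m : nat) (X : plset alpha beta A m) z :
  pl_set (PP X) z <->
  [/\ inU D q' z, inU G q (mus nu z) & pl_set X (mus mu (mus nu z))].
Proof. by split=> [[? []]|[]]. Qed.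

Lemma PP_rel (m : nat) (X : plset alpha beta A m) z z' :
  pl_rel (PP X) z z' <->
  [/\ inU D q' z /\ inU G q (mus nu z), inU D q' z' /\ inU G q (mus nu z') &
      pl_rel X (mus mu (mus nu z)) (mus mu (mus nu z'))].
Proof. by split=> [[? ? []]|[[? ?] [? ?]]]. Qed.

(** The hypothesis places one of the two tuples in its object; the closure
    property of a formula equivalence then places the other one.  So [p]
    meets the second clause of [induces] in both directions, as needed for the
    isomorphism and for its inverse. *)
Lemma unwind_formula (m : nat) (X : plset alpha beta A m) :
  exists p : pformula A ('I_(m * d * d') + 'I_m),
    forall z a, pl_set (PP X) z \/ pl_set X a -> (psat2 p z a <-> unwind X z a).
Proof.
have [E [_ EP Ecl]] := pl_formula X.
exists (compose_formula (theta_tuple m) E) => z a Hza.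
rewrite psat2_compose; split=> [[_ [/psat2_theta_tuple[Uz Uz' <-] Ea]]|].
  split=> //.
  have [Xz Xa] : pl_set X (mus mu (mus nu z)) /\ pl_set X a.
    case: Hza => [/PP_set[_ _ Xz]|Xa]; split=> //.
      by apply: (Ecl _ a Xz); left.
    by apply: (Ecl a _ Xa); right.
  exact/EP.
move=> [Uz Uz' za]; exists (mus mu (mus nu z)).
have [Xz Xa] := pl_support za.
by split; [exact/psat2_theta_tuple|exact/EP].
Qed.

Lemma unwind_exists (m : nat) (X : plset alpha beta A m) :
  exists (F : formula_map (PP X) X) (F' : formula_map X (PP X)),
    [/\ forall z a, mrel (sval F) z a <-> unwind X z a,
        (forall x, sval F' (sval F x) = x) & forall x, sval F (sval F' x) = x].
Proof.
have [p pP] := unwind_formula X.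
have [F FP] : exists F : pl_quot (PP X) -> pl_quot X,
    forall z a, mrel F z a <-> unwind X z a.
  apply: graph_exists => [z a [Uz Uz' za]|z /PP_set[Uz Uz' Xz]|
    z z' a a' /PP_rel[[Uz Uz'] [Vz Vz'] zz] [_ _ za]].
  - by have [Xz Xa] := pl_support za; split=> //; exact/PP_set.
  - by exists (mus mu (mus nu z)); split=> //; exact: pl_refl.
  - split=> [[_ _ za']|aa].
      by apply: pl_trans za'; exact: pl_trans (pl_sym za) zz.
    by split=> //; exact: pl_trans (pl_trans (pl_sym zz) za) aa.
have [F' FP'] : exists F' : pl_quot X -> pl_quot (PP X),
    forall a z, mrel F' a z <-> unwind X z a.
  apply: graph_exists => [a z [Uz Uz' za]|a Xa|a a' z z' aa [Uz Uz' za]].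
  - by have [Xz Xa] := pl_support za; split=> //; exact/PP_set.
  - exists (lift_tuple g' (lift_tuple g a)).
    have e : mus nu (lift_tuple g' (lift_tuple g a)) = lift_tuple g a.
      exact: (mus_lift coD).
    rewrite /unwind e (mus_lift coG); split; last exact: pl_refl.
    + exact: (inU_lift coD).
    + exact: (inU_lift coG).
  - split=> [[Vz Vz' za']|/PP_rel[_ [Vz Vz'] zz]].
      apply/PP_rel; split=> //.
      exact: pl_trans (pl_trans za aa) (pl_sym za').
    by split=> //; exact: pl_trans (pl_sym zz) (pl_trans za aa).
have pF : induces p F.
  by apply/inducesP => z a Xz; rewrite pP ?FP //; left.
have pF' : induces (flip_formula p) F'.
  by apply/inducesP => a z Xa; rewrite psat2_flip pP ?FP' //; right.
exists (exist _ F (ex_intro _ p pF)).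
exists (exist _ F' (ex_intro _ (flip_formula p) pF')); split=> //=.
  move=> x; suff /(congr1 (fun f => f x)) : (fun x => F' (F x)) = id by [].
  apply: mrel_inj => z z' /mrel_comp[a [/FP[Uz Uz' za] /FP'[Vz Vz' za']]].
  by apply/mrel_id/PP_rel; split=> //; exact: pl_trans za (pl_sym za').
move=> x; suff /(congr1 (fun f => f x)) : (fun x => F (F' x)) = id by [].
apply: mrel_inj => a a' /mrel_comp[z [/FP'[Uz Uz' za] /FP[Vz Vz' za']]].
by apply/mrel_id; exact: pl_trans (pl_sym za) za'.
Qed.

Lemma pull_natural_isomorphism :
  naturally_isomorphic
    (functor_comp (pull_functor coG alphaP betaP)
                  (pull_functor coD alphaP betaP))
    (functor_id (PLS alpha beta A)).
Proof.
pose F m (X : plset alpha beta A m) := cid (unwind_exists X).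
pose eta (O : PLS alpha beta A) :
    hom (functor_comp (pull_functor coG alphaP betaP)
                      (pull_functor coD alphaP betaP) O)
        (functor_id (PLS alpha beta A) O) :=
  match O return @pls_hom alpha beta L A (pull_ob coD alphaP betaP
                            (pull_ob coG alphaP betaP O)) O with
  | None => tt
  | Some X => sval (F _ (projT2 X))
  end.
exists eta; split=> [[X|]|[X|] [Y|] f] //.
- have [F' [_ H H']] := svalP (F _ (projT2 X)).
  by exists F'; split; apply: eq_exist; apply: funext.
- by exists tt.
- have [F'X [HX _ _]] := svalP (F _ (projT2 X)).
  have [F'Y [HY _ _]] := svalP (F _ (projT2 Y)).
  apply: eq_exist; apply: mrel_inj => z b.
  move=> /mrel_comp[z' [/mrel_pull[Uz Uz' /mrel_pull[Vz Vz' zz]] /HY[_ _ zb]]].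
  have [Xz [_ _]] := zz.
  apply/mrel_comp; exists (mus mu (mus nu z)); split.
    by apply/HX; split=> //; exact: pl_refl.
  by apply: mrel_compat zz => //; exact: pl_refl.
Qed.

End NaturalIsomorphism.

Theorem equivalent_of_bi_interpretable (LA LB : language) (A : structure LA)
    (B : structure LB) (alpha beta : option Type) :
  admissible alpha -> admissible beta ->
  strongly_bi_interpretable A B -> equivalent_Tr alpha beta A B.
Proof.
move=> alphaP betaP [d [k [d' [k' [I [I' [[J JP hJ] [J' JP' hJ']]]]]]]].
have [g co] := interpretation_coordinates I.
have [g' co'] := interpretation_coordinates I'.
have theta (L L' : language) (C : structure L) (C' : structure L')
    (e l e' l' : nat) (K : interpretation C C' e l)
    (K' : interpretation C' C e' l') (N : interpretation C C _ _) h h' :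
    coordinates (it_code K) (it_par K) (it_map K) h ->
    coordinates (it_code K') (it_par K') (it_map K') h' ->
    composition K K' N -> strongly_homotopic N (id_interpretation C) ->
    exists p : pformula C ('I_(e * e') + 'I_1), forall z a, psat2 p z a <->
      comp_U (it_code K) (it_code K') (it_par K) (it_par K') (it_map K') z /\
      comp_mu (it_map K) (it_map K') z = a ord0.
  move=> coK coK' NP /homotopic_id[p pP]; exists p => z a.
  have [UN muN] := composition_coordinates NP coK coK'.
  rewrite pP -UN.
  by split=> -[Uz e1]; split=> //; move: e1; rewrite muN.
have [p pP] := theta _ _ _ _ _ _ _ _ _ _ _ _ _ co co' JP hJ.
have [p' pP'] := theta _ _ _ _ _ _ _ _ _ _ _ _ _ co' co JP' hJ'.
exists (pull_functor co alphaP betaP), (pull_functor co' alphaP betaP); split.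
- exact: translation_pull_functor.
- exact: translation_pull_functor.
- exact: (pull_natural_isomorphism co co' pP).
- exact: (pull_natural_isomorphism co' co pP').
Qed.

(** * Equivalences of categories are full *)

(** Conjugation by the natural isomorphism recovers an arrow from its
    image. *)
Lemma natural_iso_faithful (C D : category) (F : functor C D)
    (H : functor D C) :
  naturally_isomorphic (functor_comp F H) (functor_id C) ->
  forall (x y : C) (f f' : hom x y), fhom F f = fhom F f' -> f = f'.
Proof.
move=> [eta [iso nat]] x y f f' e.
have [i [_ ie]] := iso x.
have E (h : hom x y) : h = cmp i (cmp (fhom H (fhom F h)) (eta y)).
  by rewrite [cmp (fhom _ _) _]nat cmpA ie cmp_idl.
by rewrite (E f) (E f') e.
Qed.

(** A preimage of [h] is the conjugate of [fhom H h]: both have the same image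
    under [H], and [H] is faithful. *)
Lemma equivalence_full (C D : category) (F : functor C D) (H : functor D C) :
  naturally_isomorphic (functor_comp F H) (functor_id C) ->
  naturally_isomorphic (functor_comp H F) (functor_id D) ->
  forall (x y : C) (h : hom (F x) (F y)), exists f, fhom F f = h.
Proof.
move=> [eta [iso nat]] HF x y h.
have [i [ei _]] := iso x; have [j [ej _]] := iso y.
exists (cmp i (cmp (fhom H h) (eta y))); set f := cmp _ _.
apply: (natural_iso_faithful HF).
have E : cmp (fhom H (fhom F f)) (eta y) = cmp (fhom H h) (eta y).
  by rewrite [LHS]nat /= /f cmpA ei cmp_idl.
have := congr1 (fun u => cmp u j) E.
by rewrite -!cmpA ej !cmp_idr.
Qed.

Lemma full_arrow (C D : category) (F : functor C D) (x y : C) (u v : D)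
    (h : hom u v) :
  (forall x y (h : hom (F x) (F y)), exists f, fhom F f = h) ->
  F x = u -> F y = v -> exists f : hom x y, arrow (fhom F f) = arrow h.
Proof.
by move=> full eu ev; subst u v; have [f <-] := full x y h; exists f.
Qed.

Lemma fhom_arrow (C D : category) (F : functor C D) (x y x' y' : C)
    (f : hom x y) (f' : hom x' y') :
  arrow f = arrow f' -> arrow (fhom F f) = arrow (fhom F f').
Proof.
move=> e; pose T := {xy : C * C & hom xy.1 xy.2}.
exact: (congr1 (fun t : T => arrow (fhom F (projT2 t))) e).
Qed.

(** * Arrows as relations *)

Section ArrowGraph.
Variables (alpha beta : option Type) (L : language) (M : structure L).

(** The lengths of the tuples are part of the arguments, so that the graph
    depends on nothing but the arrow: it can be compared across equations
    between objects, where the types of the maps differ. *)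
Definition arr_graph (O P : PLS alpha beta M) (f : hom O P)
    (x y : {m : nat & 'I_m -> M}) : Prop :=
  match O, P return @pls_hom alpha beta L M O P -> Prop with
  | Some X, Some Y => fun f => exists a b,
      [/\ x = existT _ (projT1 X) a, y = existT _ (projT1 Y) b &
          mrel (sval f) a b]
  | _, _ => fun _ => False
  end f.

Definition pt (m : nat) (a : 'I_m -> M) : {m : nat & 'I_m -> M} :=
  existT _ m a.

Lemma pt_inj (m : nat) : injective (@pt m).
Proof. by move=> a b; exact/Eqdep_dec.inj_pair2_eq_dec/eq_comparable. Qed.

Lemma arr_graphE (m n : nat) (X : plset alpha beta M m)
    (Y : plset alpha beta M n) (f : formula_map X Y) a b :
  arr_graph (O := pls_some X) (P := pls_some Y) f (pt a) (pt b) <->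
  mrel (sval f) a b.
Proof.
by split=> [[a' [b' [/pt_inj-> /pt_inj-> //]]]|ab]; exists a, b.
Qed.

Lemma arr_graph_arrow (O P O' P' : PLS alpha beta M) (f : hom O P)
    (f' : hom O' P') x y :
  arrow f = arrow f' -> arr_graph f x y -> arr_graph f' x y.
Proof.
pose T := {xy : PLS alpha beta M * PLS alpha beta M & hom xy.1 xy.2}.
by move/(congr1 (fun t : T => arr_graph (projT2 t) x y)) => /= ->.
Qed.

Lemma arr_graph_cmp (O P Q : PLS alpha beta M) (f : hom O P) (h : hom P Q)
    x z :
  arr_graph (cmp f h) x z <-> exists y, arr_graph f x y /\ arr_graph h y z.
Proof.
case: O P Q f h => [[m X]|] [[n Y]|] [[s Z]|] f h;
  try by [case: f|case: h|split=> // -[? []]].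
split=> [[a [c [-> -> /mrel_comp[b [ab bc]]]]]|[y [[a [b [-> -> ab]]]]]].
  exists (pt b); split; first by exists a, b.
  by exists b, c.
move=> [b' [c [/pt_inj <- -> bc]]]; exists a, c; split=> //.
by apply/mrel_comp; exists b.
Qed.

Lemma arr_graph_total (O P : PLS alpha beta M) (f : hom O P) (m n : nat)
    (X : plset alpha beta M m) (Y : plset alpha beta M n) a :
  O = pls_some X -> P = pls_some Y -> pl_set X a ->
  exists b : 'I_n -> M, arr_graph f (pt a) (pt b).
Proof.
move=> eO eP Xa; subst O P; have [b ab] := mrel_total (sval f) Xa.
by exists b; apply/arr_graphE.
Qed.

Lemma arr_graph_formula (O P : PLS alpha beta M) (f : hom O P) (m n : nat)
    (X : plset alpha beta M m) (Y : plset alpha beta M n) :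
  O = pls_some X -> P = pls_some Y ->
  exists p : pformula M ('I_m + 'I_n), forall a b, pl_set X a ->
    (psat2 p a b <-> arr_graph f (pt a) (pt b)).
Proof.
move=> eO eP; subst O P; have [p /inducesP pP] := svalP f.
by exists p => a b Xa; rewrite pP // arr_graphE.
Qed.

(** The formula of the constant map is that of the equivalence of [Y], with
    the coordinates of [b] as parameters. *)
Lemma constant_map (m n : nat) (X : plset alpha beta M m)
    (Y : plset alpha beta M n) b : pl_set Y b ->
  exists f : formula_map X Y, forall a c,
    mrel (sval f) a c <-> pl_set X a /\ pl_rel Y b c.
Proof.
move=> Yb; have [E [_ EP Ecl]] := pl_formula Y.
have [F FP] : exists F : pl_quot X -> pl_quot Y, forall a c,
    mrel F a c <-> pl_set X a /\ pl_rel Y b c.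
  apply: graph_exists => [a c [Xa /pl_support[]]|a Xa|a a' c c' aa [_ bc]].
  - by [].
  - by exists b; split=> //; exact: pl_refl.
  - have [_ Xa'] := pl_support aa.
    split=> [[_]|cc]; first exact: pl_trans (pl_sym bc).
    by split=> //; exact: pl_trans bc cc.
pose p : pformula M ('I_m + 'I_n) :=
  rename (fun x => match x with
                   | inl (inl i) => inr (b i)
                   | inl (inr j) => inl (inr j)
                   | inr c => inr c
                   end) E.
have pE a c : psat2 p a c <-> psat2 E b c.
  by rewrite /psat2 /psat sat_rename; apply: sat_ext => -[[i|j]|e].
have pF : induces p F.
  apply/inducesP => a c Xa; rewrite pE FP; split=> [bc|[_ bc]].
    by split=> //; apply/EP => //; apply: (Ecl b) => //; left.
  by have [_ Yc] := pl_support bc; apply/EP.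
by exists (exist _ F (ex_intro _ p pF)).
Qed.

End ArrowGraph.

(** * The point and the whole structure as objects *)

Section Objects.
Variables (alpha beta : option Type).
Hypotheses (alphaP : admissible alpha) (betaP : admissible beta).
Variables (L : language) (M : structure L) (a0 : M).

(** A valid formula that has a translation in every number of variables: the
    language need not have any sentence without quantifiers, but the parameter
    [a0] provides one. *)
Definition triv (X : Type) : fo (unnested L) (X + M) :=
  Atom (UEq L (inr a0) (inr a0)).

Lemma V_triv (m : nat) : V [set embed (triv 'I_m)] = setT.
Proof. by apply/seteqP; split=> // a _ _ ->. Qed.

Lemma setT_logical (m : nat) : logical alpha beta [set: 'I_m -> M].
Proof.
by exists [set embed (triv 'I_m)]; [exact: small_set1|rewrite V_triv].
Qed.

Lemma eq_support (m : nat) (a a' : 'I_m -> M) :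
  a = a' -> [set: 'I_m -> M] a /\ [set: 'I_m -> M] a'.
Proof. by []. Qed.

Lemma setT_neq0 (m : nat) : [set: 'I_m -> M] !=set0.
Proof. by exists (fun _ => a0). Qed.

Definition point_formula : fo (unnested L) ('I_0 + 'I_0 + M) := triv _.

Lemma point_equivalence :
  formula_equivalence [set: 'I_0 -> M] eq (embed point_formula).
Proof.
split=> // [|a a' _ _]; first by split=> // a b c _ _ _ -> ->.
by split=> // _; apply: funext; case.
Qed.

Definition point_pl : plset alpha beta M 0 :=
  PLSet (@setT_neq0 0) (setT_logical 0) (@eq_support 0)
    (ex_intro _ _ point_equivalence).

Definition line_formula : fo (unnested L) ('I_1 + 'I_1 + M) :=
  Atom (UEq L (inl (inl ord0)) (inl (inr ord0))).

Lemma line_equivalence :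
  formula_equivalence [set: 'I_1 -> M] eq (embed line_formula).
Proof.
split=> // [|a a' _ _]; first by split=> // a b c _ _ _ -> ->.
split=> [->//|e]; apply: funext => i; rewrite (ord1 i); exact: e.
Qed.

Definition line_pl : plset alpha beta M 1 :=
  PLSet (@setT_neq0 1) (setT_logical 1) (@eq_support 1)
    (ex_intro _ _ line_equivalence).

Lemma presents_point :
  presents point_pl [set embed (triv 'I_0)] (embed point_formula).
Proof. by split; [rewrite V_triv|exact: point_equivalence]. Qed.

Lemma presents_line :
  presents line_pl [set embed (triv 'I_1)] (embed line_formula).
Proof. by split; [rewrite V_triv|exact: line_equivalence]. Qed.

End Objects.

(** * The coordinate map of a full translation functor *)

Section NormalTranslations.
Variables (L L' : language) (A : structure L) (B : structure L').
Variables (d k : nat) (G : code L L' d k) (q : 'I_k -> B) (g : A -> 'I_d -> B).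

(** A formula in normal form is its own normal form; so there is a definite
    translation, and its meaning can be computed before anything is known
    about the code. *)
Definition ntr (X : finType) (Y : Type) (h : X * 'I_d -> Y)
    (n : fo (unnested L) (X + A)) : pformula B Y :=
  rename (fun z => match z with
                   | inl (inl x, j) => inl (h (x, j))
                   | inl (inr a, j) => inr (g a j)
                   | inr l => inr (q l)
                   end)
    (translation G
       (map inl (enum X) ++ map inr (params (embed n : pformula A X))) n).

Lemma ntr_ptranslation (X : finType) (Y : Type) (h : X * 'I_d -> Y)
    (n : fo (unnested L) (X + A)) :
  is_normal n -> ptranslation G q g h (embed n) (ntr h n).
Proof. by move=> nn; exists n. Qed.

Lemma ntr_strans (m : nat) (n : fo (unnested L) ('I_m + A)) :
  is_normal n ->
  strans G q g [set embed n : pformula A 'I_m] [set ntr (@flat m d) n].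
Proof.
move=> nn; exists (fun _ => ntr (@flat m d) n).
  by move=> _ ->; exact: ntr_ptranslation.
apply/seteqP; split=> [_ ->|_ [_ _ <-]] //.
by exists (embed n).
Qed.

Definition assign (X : Type) (w : X -> 'I_d -> B) (z : X + A) : 'I_d -> B :=
  match z with inl x => w x | inr a => g a end.

Lemma psat_ntr (X : finType) (Y : Type) (h : X * 'I_d -> Y) n (v : Y -> B) :
  psat v (ntr h n) <->
  [/\ forall x : X, U_set G q (fun j => v (h (x, j))),
      forall a, List.In a (params (embed n : pformula A X)) -> U_set G q (g a) &
      sat (tval (assign (fun x j => v (h (x, j)))) q) (tr G n)].
Proof. exact: psat_ptranslation_raw. Qed.

Lemma V_ntr (m : nat) (n : fo (unnested L) ('I_m + A)) b :
  V [set ntr (@flat m d) n] b <->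
  [/\ inU G q b,
      forall a, List.In a (params (embed n : pformula A 'I_m)) ->
        U_set G q (g a) &
      sat (tval (assign (block b)) q) (tr G n)].
Proof.
by rewrite -(psat_ntr (@flat m d) n b); split=> [H|H _ ->] //; exact: H.
Qed.

Lemma sat_tr_Eq (X : Type) (w : X -> 'I_d -> B) x y :
  sat (tval w q) (tr G (Atom (UEq L x y))) <-> E_rel G q (w x) (w y).
Proof. by rewrite /= sat_plug fcons_comp. Qed.

Lemma sat_tr_urename (X Y : Type) (r : X -> Y) (w : Y -> 'I_d -> B)
    (u : unnested L X) :
  sat (tval w q) (tr G (Atom (urename r u))) <->
  sat (tval (fun x => w (r x)) q) (tr G (Atom u)).
Proof.
case: u => [x x'|x c|f xs x0|R xs] /=; rewrite !sat_plug //.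
- by rewrite fcons_comp (fcons_comp (fun x => w (r x))).
- by rewrite fcons_comp (fcons_comp (fun x => w (r x))).
Qed.

(** With [s] the list of all variables, the matrix of the sentence
    for all x, if x = a then p. *)
Definition unless (m : nat) (a : 'I_m -> A) (s : seq 'I_m)
    (p : fo (unnested L) ('I_m + A)) : fo (unnested L) ('I_m + A) :=
  foldr (fun i r => Disj (Neg (Atom (UEq L (inl i) (inr (a i))))) r) p s.

Lemma unless_normal (m : nat) (a : 'I_m -> A) s p :
  is_literal p -> is_normal (unless a s p).
Proof.
move=> lp; have dnf : is_dnf (unless a s p).
  elim: s => [|i s IH] /=; last by rewrite IH.
  by case: p lp => //= -[].
by case: (unless a s p) dnf.
Qed.

Lemma sat_unless (m : nat) (a : 'I_m -> A) s p (v : 'I_m + A -> A) :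
  sat v (embed (unless a s p)) <->
  (exists2 i, List.In i s & v (inl i) <> v (inr (a i))) \/ sat v (embed p).
Proof.
elim: s => [|i s IH] /=; first by split=> [|[[]|]]; auto.
rewrite IH; split=> [[n|[[j js n]|H]]|[[j [<-|js] n]|H]]; auto.
- by left; exists i => //; left.
- by left; exists j => //; right.
- by right; left; exists j.
Qed.

Lemma sat_tr_unless (m : nat) (a : 'I_m -> A) s p (w : 'I_m + A -> 'I_d -> B) :
  sat (tval w q) (tr G (unless a s p)) <->
  (exists2 i, List.In i s & ~ E_rel G q (w (inl i)) (w (inr (a i)))) \/
  sat (tval w q) (tr G p).
Proof.
elim: s => [|i s IH]; first by split=> [|[[]|]]; auto.
rewrite /unless [foldr _ _ _]/= -/(unless a s p).
have -> : forall r r' : fo (unnested L) ('I_m + A),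
    sat (tval w q) (tr G (Disj r r')) =
    (sat (tval w q) (tr G r) \/ sat (tval w q) (tr G r')) by [].
have -> : forall r : fo (unnested L) ('I_m + A),
    sat (tval w q) (tr G (Neg r)) = (~ sat (tval w q) (tr G r)) by [].
rewrite IH sat_tr_Eq; split=> [[n|[[j js n]|H]]|[[j [<-|js] n]|H]]; auto.
- by left; exists i => //; left.
- by left; exists j => //; right.
- by right; left; exists j.
Qed.

End NormalTranslations.

Lemma pls_some_inj (alpha beta : option Type) (L : language)
    (M : structure L) (m : nat) : injective (@pls_some alpha beta L M m).
Proof.
move=> X Y [e].
exact: (Eqdep_dec.inj_pair2_eq_dec nat (@eq_comparable nat) _ _ _ _ e).
Qed.

Section FullFunctor.
Variables (alpha beta : option Type).
Hypotheses (alphaP : admissible alpha) (betaP : admissible beta).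
Variables (L L' : language) (A : structure L) (B : structure L').
Variables (F : functor (PLS alpha beta A) (PLS alpha beta B)).
Variables (d k : nat) (G : code L L' d k) (q : 'I_k -> B) (g : A -> 'I_d -> B).
Hypothesis Fcond : functor_conditions alpha beta G q g.
Hypothesis Fob : forall m (X : plset alpha beta A m) S E T E',
  small_system alpha beta S -> presents X S E ->
  strans G q g S T -> ptrans2 G q g E E' ->
  exists2 X' : plset alpha beta B (m * d),
    F (pls_some X) = pls_some X' & presents X' T E'.
Hypothesis Farr :
  forall m n (X : plset alpha beta A m) (Y : plset alpha beta A n)
      (f : formula_map X Y) phi phi',
    induces phi (sval f) -> ptrans2 G q g phi phi' ->
    exists (X' : plset alpha beta B (m * d))
           (Y' : plset alpha beta B (n * d)) (f' : formula_map X' Y'),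
      induces phi' (sval f') /\
      arrow (fhom F (f : hom (c := PLS alpha beta A)
                             (pls_some X) (pls_some Y))) =
      arrow (f' : hom (c := PLS alpha beta B)
                      (pls_some X') (pls_some Y')).

(** The sentence a = a is satisfiable, and hence so is its translation. *)
Lemma image_of_parameter a : U_set G q (g a) /\ E_rel G q (g a) (g a).
Proof.
pose n : fo (unnested L) ('I_0 + A) := Atom (UEq L (inr a) (inr a)).
have VT : V [set ntr G q g (@flat 0 d) n] !=set0.
  apply/set0P/eqP => /(F1 Fcond (small_system1 alphaP betaP _)
    (ntr_strans G q g (n := n) isT)).2 e.
  have : V [set embed n] (fun i => from_ord0 A i) by move=> _ ->.
  by rewrite e.
have [b /V_ntr[_ Ua /sat_tr_Eq]] := VT.
by split=> //; apply: Ua; left.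
Qed.

(** A matrix that is valid in [A] defines the same set as a trivial formula,
    and the translations of both then define the same set too. *)
Lemma transfer (m : nat) (n : fo (unnested L) ('I_m + A)) :
  is_normal n -> (forall v : 'I_m -> A, psat v (embed n : pformula A 'I_m)) ->
  forall w : 'I_m -> 'I_d -> B, (forall i, U_set G q (w i)) ->
  sat (tval (assign g w) q) (tr G n).
Proof.
move=> nn valid w Uw; have [a0] := carrier_inh A.
have eV : V [set embed (triv a0 'I_m)] = V [set embed n].
  by rewrite V_triv; apply/esym/seteqP; split=> // v _ _ ->; exact: valid.
have := F2 Fcond (small_system1 alphaP betaP _) (small_system1 alphaP betaP _)
  (ntr_strans G q g (n := triv a0 'I_m) isT) (ntr_strans G q g nn) eV.
move=> /(congr1 (fun X => X (glue w))) e.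
have : V [set ntr G q g (@flat m d) n] (glue w).
  rewrite -e; have [Ua Ea] := image_of_parameter a0.
  apply/V_ntr; split=> [i|a|]; last exact/sat_tr_Eq.
    by rewrite block_glue.
  by move=> /= [<-|[<-|[]]].
by move=> /V_ntr[_ _]; rewrite block_glue.
Qed.

(** Let [p] be the atom or its negation, whichever is true at [a].  Then
    x = a implies p, for all x, and this can be transferred; at tuples in the
    classes of the images of [a] its premise is satisfied. *)
Lemma translated_atom (m : nat) (u : unnested L 'I_m) (bs : 'I_m -> 'I_d -> B)
    (a : 'I_m -> A) :
  (forall i, U_set G q (bs i)) -> (forall i, E_rel G q (bs i) (g (a i))) ->
  sat (tval bs q) (tr G (Atom u)) <-> sat a (embed (Atom u)).
Proof.
move=> Ubs Ebs.
have main p : is_literal p ->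
    sat (fun z : 'I_m + A => match z with inl i => a i | inr c => c end)
      (embed p) ->
    sat (tval (assign g bs) q) (tr G p).
  move=> lp ap.
  have := transfer (unless_normal a (enum 'I_m) lp) _ Ubs.
  have valid : forall v : 'I_m -> A,
      psat v (embed (unless a (enum 'I_m) p) : pformula A 'I_m).
    move=> v; apply/sat_unless.
    have [<-//|nv] := pselect (a = v); first by right.
    left; have [i ni] : exists i, v i <> a i.
      by apply/existsNP => H; apply: nv; apply: funext.
    by exists i => //; apply/In_mem; rewrite mem_enum.
  by move=> /(_ valid)/sat_tr_unless[[i _ /(_ (Ebs i))]|].
have atom : sat (fun z : 'I_m + A => match z with inl i => a i | inr c => c end)
    (embed (Atom (urename inl u))) = sat a (embed (Atom u)).
  exact: (sat_nrename _ _ (Atom u)).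
split=> H.
  apply: contrapT => nH; have := main (Neg (Atom (urename inl u))) isT.
  by rewrite [sat _ _]/= -[aeval _ _]/(sat _ (embed (Atom _))) atom => /(_ nH);
    apply; apply/sat_tr_urename.
apply/(sat_tr_urename G q inl (assign g bs)).
by apply: main => //; rewrite atom.
Qed.

Hypothesis full : forall x y (h : hom (F x) (F y)), exists f, fhom F f = h.

(** The elements of [A] are the arrows from a point to [A].  As [F] is full,
    every class of [U_set G q] is the image of such an arrow. *)
Lemma image_of_parameters_exhausts b :
  U_set G q b -> exists a, E_rel G q b (g a).
Proof.
move=> Ub; have [a0] := carrier_inh A.
pose X := point_pl alphaP betaP a0; pose Y := line_pl alphaP betaP a0.
have [X' FX _] := Fob (small_system1 alphaP betaP _)
  (presents_point alphaP betaP a0)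
  (ntr_strans G q g (n := triv a0 'I_0) isT)
  (ntr_ptranslation G q g (@flat2 0 0 d) (n := point_formula a0) isT).
have [Y' FY [YT [_ YE _]]] := Fob (small_system1 alphaP betaP _)
  (presents_line alphaP betaP a0)
  (ntr_strans G q g (n := triv a0 'I_1) isT)
  (ntr_ptranslation G q g (@flat2 1 1 d) (n := line_formula A) isT).
pose b1 : 'I_(1 * d) -> B := glue (fun _ : 'I_1 => b).
have Yb : pl_set Y' b1.
  rewrite YT; apply/V_ntr; have [Ua Ea] := image_of_parameter a0.
  split=> [i|a|]; last exact/sat_tr_Eq.
    by rewrite block_glue.
  by move=> /= [<-|[<-|[]]].
have [h hP] := constant_map X' Yb.
have [f fh] := full_arrow (h : hom (c := PLS alpha beta B)
  (pls_some X') (pls_some Y')) full FX FY.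
have [o Xo] : exists o, pl_set X' o := pl_nonempty X'.
pose oA : 'I_0 -> A := fun i => from_ord0 A i.
have [a oa] := mrel_total (sval (f : formula_map X Y)) (a := oA) I.
pose n : fo (unnested L) ('I_0 + 'I_1 + A) :=
  Atom (UEq L (inl (inr ord0)) (inr (a ord0))).
have nf : induces (embed n) (sval (f : formula_map X Y)).
  apply/inducesP => o' c _.
  have -> : o' = oA by apply: funext; case.
  split=> [/= e|/(mrel_fun oa)/= <-//].
  by have -> : c = a by apply: funext => i; rewrite (ord1 i).
have [X2 [Y2 [f2 [f2P fe]]]] := Farr nf
  (ntr_ptranslation G q g (@flat2 0 1 d) (n := n) isT).
have : mrel (sval f2) o b1.
  apply/arr_graphE; apply: (arr_graph_arrow (etrans (esym fh) fe)).
  by apply/arr_graphE/hP; split=> //; exact: pl_refl.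
move=> ob; have [X2o _] := ob.
move/inducesP: f2P => /(_ o b1 X2o)/iffRL/(_ ob)/psat_ntr[_ _ /sat_tr_Eq] /= H.
exists (a ord0); suff -> : b = fun j => b1 (flat (ord0, j)) by [].
by rewrite -[RHS]/(block b1 ord0) block_glue.
Qed.

Lemma extracted_coordinates : exists mu, coordinates G q mu g.
Proof.
have /choice[mu muE] : forall b, exists a, U_set G q b -> E_rel G q b (g a).
  move=> b; have [Ub|nU] := pselect (U_set G q b).
    by have [a Ea] := image_of_parameters_exhausts Ub; exists a.
  by have [a0] := carrier_inh A; exists a0.
have gU a : U_set G q (g a) by have [] := image_of_parameter a.
have bothU (n : nat) b (bs : 'I_n -> 'I_d -> B) : U_set G q b ->
    (forall i, U_set G q (bs i)) -> forall i, U_set G q (fcons b bs i).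
  by move=> Ub Ubs i; rewrite /fcons; case: unlift.
have bothE (n : nat) b a (bs : 'I_n -> 'I_d -> B) (a' : 'I_n -> A) :
    E_rel G q b (g a) -> (forall i, E_rel G q (bs i) (g (a' i))) ->
    forall i, E_rel G q (fcons b bs i) (g (fcons a a' i)).
  by move=> Eb Ebs i; rewrite /fcons; case: unlift.
have eqP b b' a a' : U_set G q b -> U_set G q b' -> E_rel G q b (g a) ->
    E_rel G q b' (g a') -> E_rel G q b b' <-> a = a'.
  move=> Ub Ub' Eb Eb'.
  have := translated_atom (UEq L ord0 (lift ord0 ord0))
    (bothU 1 b (fun _ => b') Ub (fun _ => Ub'))
    (bothE 1 b a (fun _ => b') (fun _ => a') Eb (fun _ => Eb')).
  by rewrite sat_tr_Eq /= /fcons unlift_none liftK.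
exists mu; split=> [//|a|b b' Ub Ub'|c b Ub|f b bs Ub Ubs|R bs Ubs].
- have [_ Ea] := image_of_parameter a.
  by apply/esym/(eqP (g a) (g a)) => //; exact: muE.
- by apply: eqP => //; exact: muE.
- have := translated_atom (UCst (ord0 : 'I_1) c) (bs := fun _ => b)
    (a := fun _ => mu b) (fun _ => Ub) (fun _ => muE _ Ub).
  by rewrite /= sat_plug.
- have := translated_atom (UFun (f := f) (fun i => lift ord0 i) ord0)
    (bothU _ b bs Ub Ubs)
    (bothE _ b (mu b) bs (fun i => mu (bs i)) (muE _ Ub)
      (fun i => muE _ (Ubs i))).
  rewrite [tr _ _]/= sat_plug => H.
  have e1 : (fun i => fcons b bs (fcons ord0 (fun i => lift ord0 i) i)) =
      fcons b bs.
    by apply: funext => i; rewrite {2}/fcons; case: unliftP => [j ->|->].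
  rewrite e1 in H; rewrite H /= /fcons unlift_none.
  have -> : (fun i => if unlift ord0 (lift ord0 i) is Some j
      then mu (bs j) else mu b) = (fun i => mu (bs i)).
    by apply: funext => i; rewrite liftK.
  by split=> ->.
- have := translated_atom (UPred (R := R) id) (bs := bs)
    (a := fun i => mu (bs i)) Ubs (fun i => muE _ (Ubs i)).
  by rewrite [tr _ _]/= sat_plug.
Qed.

(** * The action of a translation functor with a coordinate map *)

Variable mu : ('I_d -> B) -> A.
Hypothesis co : coordinates G q mu g.

Lemma translated_object (m : nat) (X : plset alpha beta A m) :
  F (pls_some X) = pls_some (pull_pl co alphaP betaP X).
Proof.
have [S Ss XS] := logical_system alphaP betaP (pl_logical X).
have [E EX] := pl_formula X.
have [T ST] := strans_exists G q g S; have [E' EE'] := ptrans2_exists G q g E.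
have XSE : presents X S E by [].
have [X' -> X'T] := Fob Ss XSE ST EE'.
congr pls_some; apply: presents_unique X'T _.
exact: presents_pull Ss XSE ST EE'.
Qed.

Lemma translated_arrow (m n : nat) (X : plset alpha beta A m)
    (Y : plset alpha beta A n) (f : formula_map X Y) :
  arrow (fhom F (f : hom (c := PLS alpha beta A) (pls_some X) (pls_some Y))) =
  arrow (pull_fm co alphaP betaP f : hom (c := PLS alpha beta B)
           (pls_some (pull_pl co alphaP betaP X))
           (pls_some (pull_pl co alphaP betaP Y))).
Proof.
have [phi phiP] := svalP f; have [phi' pp] := ptrans2_exists G q g phi.
have [X' [Y' [f' [f'P e]]]] := Farr phiP pp.
have [eX eY] := congr1 (@projT1 _ _) e.
have := pls_some_inj (etrans (esym (translated_object X)) eX).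
have := pls_some_inj (etrans (esym (translated_object Y)) eY).
move=> {}eY {}eX.
rewrite e; subst X' Y'; congr arrow; case: f' f'P {e} => f' Hf' /= f'P.
apply: eq_exist; apply: induces_unique f'P _.
exact: induces_pull pp.
Qed.

End FullFunctor.

(** * From equivalences of categories to strong bi-interpretations *)

Section Unwinding.
Variables (alpha beta : option Type).
Hypotheses (alphaP : admissible alpha) (betaP : admissible beta).
Variables (L L' : language) (A : structure L) (B : structure L').
Variables (d k d' k' : nat) (G : code L L' d k) (D : code L' L d' k').
Variables (q : 'I_k -> B) (mu : ('I_d -> B) -> A) (g : A -> 'I_d -> B).
Variables (q' : 'I_k' -> A) (nu : ('I_d' -> A) -> B) (g' : B -> 'I_d' -> A).
Hypotheses (coG : coordinates G q mu g) (coD : coordinates D q' nu g').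
Variables (F : functor (PLS alpha beta A) (PLS alpha beta B))
          (H : functor (PLS alpha beta B) (PLS alpha beta A)).
Hypothesis Fob : forall m (X : plset alpha beta A m),
  F (pls_some X) = pls_some (pull_pl coG alphaP betaP X).
Hypothesis Hob : forall m (X : plset alpha beta B m),
  H (pls_some X) = pls_some (pull_pl coD alphaP betaP X).
Hypothesis Farr : forall m n (X : plset alpha beta A m)
    (Y : plset alpha beta A n) (f : formula_map X Y),
  arrow (fhom F (f : hom (c := PLS alpha beta A) (pls_some X) (pls_some Y))) =
  arrow (pull_fm coG alphaP betaP f : hom (c := PLS alpha beta B)
           (pls_some (pull_pl coG alphaP betaP X))
           (pls_some (pull_pl coG alphaP betaP Y))).
Hypothesis Harr : forall m n (X : plset alpha beta B m)
    (Y : plset alpha beta B n) (f : formula_map X Y),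
  arrow (fhom H (f : hom (c := PLS alpha beta B) (pls_some X) (pls_some Y))) =
  arrow (pull_fm coD alphaP betaP f : hom (c := PLS alpha beta A)
           (pls_some (pull_pl coD alphaP betaP X))
           (pls_some (pull_pl coD alphaP betaP Y))).
Hypothesis HF : naturally_isomorphic (functor_comp F H)
                                     (functor_id (PLS alpha beta A)).

Lemma HF_object (m : nat) (X : plset alpha beta A m) :
  functor_comp F H (pls_some X) =
  pls_some (pull_pl coD alphaP betaP (pull_pl coG alphaP betaP X)).
Proof. by rewrite -Hob -Fob. Qed.

Lemma HF_arrow (m n : nat) (X : plset alpha beta A m)
    (Y : plset alpha beta A n) (f : formula_map X Y) z z' :
  arr_graph (fhom (functor_comp F H)
    (f : hom (c := PLS alpha beta A) (pls_some X) (pls_some Y))) (pt z) (pt z')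
  <-> mrel (pull_map (co := coD) (alphaP := alphaP) (betaP := betaP)
        (pull_map (co := coG) (alphaP := alphaP) (betaP := betaP) (sval f)))
        z z'.
Proof.
have e := etrans (fhom_arrow H (Farr f)) (Harr (pull_fm coG alphaP betaP f)).
split=> [/(arr_graph_arrow e)/arr_graphE //|zz].
by apply: (arr_graph_arrow (esym e)); apply/arr_graphE.
Qed.

(** Naturality with respect to the points of [A] determines the component of
    the isomorphism at [A]: it is the composite coordinate map. *)
Lemma component_at_line : exists p : pformula A ('I_(1 * d * d') + 'I_1),
  forall z a, inU D q' z -> inU G q (mus nu z) ->
    (psat2 p z a <-> mus mu (mus nu z) = a).
Proof.
have [a0] := carrier_inh A.
pose X := point_pl alphaP betaP a0; pose Y := line_pl alphaP betaP a0.
have [eta [_ nat]] := HF.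
have [p pP] := arr_graph_formula (eta (pls_some Y)) (HF_object Y) erefl.
exists p => z a Uz Uz'.
have Yz : pl_set (pull_pl coD alphaP betaP (pull_pl coG alphaP betaP Y)) z.
  by split.
rewrite pP //.
have uniq c : arr_graph (eta (pls_some Y)) (pt z) (pt c) ->
    mus mu (mus nu z) = c.
  move=> zc.
  have [f fP] := constant_map X (Y := Y) (b := mus mu (mus nu z)) I.
  pose o : 'I_0 -> A := fun i => from_ord0 A i.
  have : arr_graph (cmp (fhom (functor_comp F H)
      (f : hom (c := PLS alpha beta A) (pls_some X) (pls_some Y)))
      (eta (pls_some Y))) (pt (lift_tuple g' (lift_tuple g o))) (pt c).
    apply/arr_graph_cmp; exists (pt z); split=> //; apply/HF_arrow.
    have e : mus nu (lift_tuple g' (lift_tuple g o)) = lift_tuple g o.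
      exact: (mus_lift coD).
    apply/mrel_pull; split=> //; first exact: (inU_lift coD).
    apply/mrel_pull; rewrite e; split=> //; first exact: (inU_lift coG).
    by apply/fP.
  rewrite nat => /arr_graph_cmp[y [_]].
  by move=> [o' [c' [_ /pt_inj -> /fP[_ /= <-]]]].
split=> [/uniq//|<-].
have [c zc] := arr_graph_total (eta (pls_some Y)) (HF_object Y) erefl Yz.
by rewrite (uniq _ zc).
Qed.

Lemma composite_definable (GD : code L L (d * d') (k * d' + k')) r :
  code_composition G D GD -> comp_par D q q' nu r ->
  exists p : pformula A ('I_(d * d') + 'I_1), forall z a,
    psat2 p z a <-> U_set GD r z /\ comp_mu mu nu z = a ord0.
Proof.
move=> GDP rP; have [p pP] := component_at_line.
pose U : pformula A ('I_(d * d') + 'I_1) :=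
  rename (fun x => match x with
                   | inl (_, j) => inl (inl j)
                   | inr l => inr (r l)
                   end) (code_U GD).
(* The object [A] consists of 1-tuples, so its image consists of tuples of
   length 1 * d * d'; [s] identifies these with tuples of length d * d'. *)
pose s (x : 'I_(1 * d * d')) : 'I_(d * d') :=
  flat ((unflat (unflat x).1).2, (unflat x).2).
pose p' : pformula A ('I_(d * d') + 'I_1) :=
  rename (fun x => match x with
                   | inl (inl i) => inl (inl (s i))
                   | inl (inr j) => inl (inr j)
                   | inr c => inr c
                   end) p.
exists (Conj U p') => z a.
have UE : psat2 U z a <-> U_set GD r z.
  by rewrite /psat2 /psat sat_rename; apply: sat_ext => -[[i j]|l].
pose z' : 'I_(1 * d * d') -> A := fun x => z (s x).
have z'E : coordinate z' ord0 = z.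
  apply: funext => x; rewrite /coordinate /z' /s !flatK /=.
  by rewrite -surjective_pairing unflatK.
have p'E : psat2 p' z a <-> psat2 p z' a.
  by rewrite /psat2 /psat sat_rename; apply: sat_ext => -[[i|j]|c].
have muE : mus mu (mus nu z') ord0 = comp_mu mu nu z.
  by rewrite -comp_mu_coordinate z'E.
have main : U_set GD r z -> (psat2 p' z a <-> comp_mu mu nu z = a ord0).
  move=> /(comp_U_set coD GDP rP) Uz.
  have [Uz1 Uz2] : inU D q' z' /\ inU G q (mus nu z').
    by apply/comp_U_coordinate => i; rewrite (ord1 i) z'E.
  rewrite p'E pP // -muE; split=> [->//|e].
  by apply: funext => i; rewrite (ord1 i).
have -> : psat2 (Conj U p') z a <-> U_set GD r z /\ psat2 p' z a.
  by rewrite -UE.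
by split=> -[Uz e]; split=> //; apply/main.
Qed.

End Unwinding.

(** All compositions of two interpretations have the same coordinate map, so
    any one of them can be taken. *)
Lemma homotopic_of_definable (L L' : language) (A : structure L)
    (B : structure L') (d k d' k' : nat) (I : interpretation A B d k)
    (I' : interpretation B A d' k') :
  (forall GD r, code_composition (it_code I) (it_code I') GD ->
     comp_par (it_code I') (it_par I) (it_par I') (it_map I') r ->
     exists p : pformula A ('I_(d * d') + 'I_1), forall z a, psat2 p z a <->
       U_set GD r z /\ comp_mu (it_map I) (it_map I') z = a ord0) ->
  exists2 J, composition I I' J & strongly_homotopic J (id_interpretation A).
Proof.
move=> H; have [J JP] := composition_exists I I'; exists J => //.
have [GDP rP muJ] := JP; have [p pP] := H _ _ GDP rP.
apply/homotopic_id; exists p => z a; rewrite pP.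
by split=> -[Uz e]; split=> //; move: e; rewrite muJ.
Qed.

Theorem bi_interpretable_of_equivalent (LA LB : language) (A : structure LA)
    (B : structure LB) (alpha beta : option Type) :
  admissible alpha -> admissible beta ->
  equivalent_Tr alpha beta A B -> strongly_bi_interpretable A B.
Proof.
move=> alphaP betaP [F [H [KF KH HF FH]]].
have [d [k [G [q [g [Fc _ Fob Farr]]]]]] := KF.
have [d' [k' [D [q' [g' [Hc _ Hob Harr]]]]]] := KH.
have [mu coG] := extracted_coordinates alphaP betaP Fc Fob Farr
  (equivalence_full HF FH).
have [nu coD] := extracted_coordinates alphaP betaP Hc Hob Harr
  (equivalence_full FH HF).
have Fob' m (X : plset alpha beta A m) :=
  translated_object alphaP betaP Fob coG X.
have Hob' m (X : plset alpha beta B m) :=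
  translated_object alphaP betaP Hob coD X.
have Farr' m n (X : plset alpha beta A m) (Y : plset alpha beta A n)
    (f : formula_map X Y) := translated_arrow alphaP betaP Fob Farr coG f.
have Harr' m n (X : plset alpha beta B m) (Y : plset alpha beta B n)
    (f : formula_map X Y) := translated_arrow alphaP betaP Hob Harr coD f.
have [I [eG eq em]] := interpretation_of_coordinates coG.
have [I' [eD eq' en]] := interpretation_of_coordinates coD.
exists d, k, d', k', I, I'; split; apply: homotopic_of_definable;
  rewrite eG eD eq eq' em en => GD r GDP rP.
- exact: (composite_definable Fob' Hob' Farr' Harr' HF GDP rP).
- exact: (composite_definable Hob' Fob' Harr' Farr' FH GDP rP).
Qed.

Lemma admissible_omega : admissible omega.
Proof. exact: infinite_nat. Qed.

Theorem theorem13 (LA LB : language) (A : structure LA) (B : structure LB) :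
  [/\ strongly_bi_interpretable A B <-> equivalent_Tr omega omega A B,
      strongly_bi_interpretable A B <-> equivalent_Tr None None A B &
      strongly_bi_interpretable A B ->
      forall alpha beta : Type,
        infinite_set [set: alpha] -> infinite_set [set: beta] ->
        ([set: alpha] #<= [set: beta])%card ->
        equivalent_Tr (Some alpha) (Some beta) A B].
Proof.
split.
- split.
    exact: (equivalent_of_bi_interpretable admissible_omega admissible_omega).
  exact: (bi_interpretable_of_equivalent admissible_omega admissible_omega).
- by split; [exact: equivalent_of_bi_interpretable|
             exact: bi_interpretable_of_equivalent].
- by move=> bi alpha beta infa infb _; exact: equivalent_of_bi_interpretable.
Qed.
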